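(* For $\epsilon>0$ let $\Sigma(\epsilon)=(\mathbb{R}^2\setminus\sqrt{\epsilon}\,\mathbb{Z}^2)/\sqrt{\epsilon}\,\mathbb{Z}^2$, i.e. the torus $\mathbb{R}^2/\sqrt{\epsilon}\,\mathbb{Z}^2$ with the image of the lattice point removed, with its induced symplectic form (total area $\epsilon$). There exist constants $\epsilon_0>0$, $c>0$ and a smooth family $(J_\epsilon)_{\epsilon\in(0,\epsilon_0]}$ of symplectic embeddings $$J_\epsilon\colon \Sigma(\epsilon)\times\mathrm{B}^2(1)\hookrightarrow \mathrm{B}^4(\sqrt{3}+c\epsilon).$$
   Context: $\mathbb{R}^{2m}$ carries the standard symplectic form $\sum \mathrm{d}x_i\wedge\mathrm{d}y_i$, and $\mathrm{B}^{2m}(\rho)$ denotes the open ball of radius $\rho$ centered at the origin. $\Sigma(\epsilon)$ inherits the form $\mathrm{d}x\wedge\mathrm{d}y$ from $\mathbb{R}^2$, and $\Sigma(\epsilon)\times\mathrm{B}^2(1)$ carries the product symplectic form. Smooth families: for smooth manifolds $P,M,N$ and submanifolds $B_p\subset N$, a family of embeddings $(\phi_p\colon B_p\hookrightarrow M)_{p\in P}$ is smooth if there is a smooth manifold $B$ and a smooth map $g\colon P\times B\to N$ with each $g(p,\cdot)$ an immersion and $B_p=g(p,B)$, such that $(p,b)\mapsto\phi_p(g(p,b))$ is smooth; when $P$ is a subset of a manifold $\tilde P$ (here $P=(0,\epsilon_0]\subset\mathbb{R}$) one requires these maps to extend smoothly to an open neighborhood of $P$. Here the domains $\Sigma(\epsilon)\times\mathrm{B}^2(1)$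 are parametrized by $\Sigma(1)\times\mathrm{B}^2(1)$ via the map induced by the dilation $x\mapsto\sqrt{\epsilon}\,x$ on the first factor. *)

(* Defs.v *)
From HB Require Import structures.
From mathcomp Require Import all_boot all_order all_algebra.
From mathcomp Require Import all_classical all_reals all_analysis.
Set Implicit Arguments. Unset Strict Implicit. Unset Printing Implicit Defensive.
Import Order.TTheory GRing.Theory Num.Theory.
Import numFieldNormedType.Exports.
Local Open Scope classical_set_scope.
Local Open Scope ring_scope.

Section Defs.
Variable R : realType.

Fixpoint iterD (V W : normedModType R) (vs : seq V) (f : V -> W) : V -> W :=
  match vs with
  | [::] => f
  | v :: vs' => fun x => derive (iterD vs' f) x v
  end.

Definition smooth_on (V W : normedModType R) (U : set V) (f : V -> W) : Prop :=
  open U /\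
  forall vs : seq V, forall x, U x ->
    {for x, continuous (iterD vs f)} /\ (forall v, derivable (iterD vs f) x v).

(* Coordinates on R^4 = 'rV_4 are (x, y, z1, z2): (x,y) the Sigma-factor,
   (z1,z2) the B^2(1)-factor; the target R^4 uses the same convention
   (x1, y1, x2, y2), with standard form dx1/\dy1 + dx2/\dy2. *)
Definition c0 : 'I_4 := @Ordinal 4 0 isT.
Definition c1 : 'I_4 := @Ordinal 4 1 isT.
Definition c2 : 'I_4 := @Ordinal 4 2 isT.
Definition c3 : 'I_4 := @Ordinal 4 3 isT.

Definition omega4 (v w : 'rV[R]_4) : R :=
  v ord0 c0 * w ord0 c1 - v ord0 c1 * w ord0 c0
  + v ord0 c2 * w ord0 c3 - v ord0 c3 * w ord0 c2.

Definition sqnorm4 (v : 'rV[R]_4) : R := \sum_(i < 4) (v ord0 i) ^+ 2.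

Definition latt (eps : R) (m n : int) : 'rV[R]_4 :=
  \row_(i < 4) (if i == c0 then Num.sqrt eps * m%:~R
                else if i == c1 then Num.sqrt eps * n%:~R else 0).

(* lift of Sigma(eps) x B^2(1):  (R^2 \ sqrt(eps) Z^2) x B^2(1) in R^4 *)
Definition dom (eps : R) : set 'rV[R]_4 :=
  [set p | ~ (exists m n : int, p ord0 c0 = Num.sqrt eps * m%:~R /\
                                 p ord0 c1 = Num.sqrt eps * n%:~R)
           /\ (p ord0 c2) ^+ 2 + (p ord0 c3) ^+ 2 < 1].

Definition dil (eps : R) (q : 'rV[R]_4) : 'rV[R]_4 :=
  \row_(i < 4) (if (i == c0) || (i == c1) then Num.sqrt eps * q ord0 i
                else q ord0 i).

(* f : lift of a map Sigma(eps) x B^2(1) -> R^4, i.e. a sqrt(eps)Z^2-periodic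
   map on dom eps.  The induced map is a symplectic embedding into B^4(r). *)
Definition sympl_emb_into_ball (eps : R) (f : 'rV[R]_4 -> 'rV[R]_4) (r : R)
  : Prop :=
  (forall p m n, dom eps p -> f (p + latt eps m n) = f p) /\
  smooth_on (dom eps) f /\
  (forall p, dom eps p -> forall v w : 'rV[R]_4,
      omega4 ('D_v f p) ('D_w f p) = omega4 v w) /\
  (forall p q, dom eps p -> dom eps q -> f p = f q ->
      exists m n, q = p + latt eps m n) /\
  (* homeomorphism onto its image (inverse continuous, quotient topology) *)
  (forall p, dom eps p -> forall d : R, 0 < d -> exists2 e : R, 0 < e &
      forall q, dom eps q -> `|f q - f p| < e ->
        exists m n, `|q + latt eps m n - p| < d) /\
  (forall p, dom eps p -> sqnorm4 (f p) < r ^+ 2).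

(* smoothness of the family (J_eps)_{eps in (0, eps0]}, domains parametrized by
   Sigma(1) x B^2(1) via dilation, with smooth extension to an open
   neighbourhood of (0, eps0] *)
Definition smooth_family (eps0 : R) (J : R -> 'rV[R]_4 -> 'rV[R]_4) : Prop :=
  exists (U : set R) (H : (R * 'rV[R]_4)%type -> 'rV[R]_4),
    open U /\ `]0, eps0] `<=` U /\
    smooth_on [set x | U x.1 /\ dom 1 x.2] H /\
    (forall eps q, 0 < eps <= eps0 -> dom 1 q -> H (eps, q) = J eps (dil eps q)).

End Defs.

(* Main.v *)
Require Import Defs.
From HB Require Import structures.
From mathcomp Require Import all_boot all_order all_algebra.
From mathcomp Require Import all_classical all_reals all_analysis.
From mathcomp Require Import zify ring lra.
Import Order.TTheory GRing.Theory Num.Theory.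
Import numFieldNormedType.Exports.
Local Open Scope classical_set_scope.
Local Open Scope ring_scope.
Set Implicit Arguments. Unset Strict Implicit. Unset Printing Implicit Defensive.
(** Use the angle [phi] and the action [I] on the first plane of the target, and rearrange the
    fibre disc as a region [0 < u < Lu], [-1 < v < 1], where [Lu] tends to [pi / 2].  An
    area-preserving map opens the puncture of the torus to a slit, and stretching along the
    slit turns the punctured torus of area [e] into two crossing thin annuli of width [O(e)]:
    a ring, which is wrapped around the circle of action [I0], and a band, which leaves the
    ring on the side of larger action and has to return to it from the other side.  To get
    there the band is dropped back in action and crosses the circle [I = I0]; it avoids the
    ring because it is lifted in the fibre by [chi I >= Lu].  The lift is symplectic together
    with the shear [phi + chi' I * v], and since [|v| < 1] the band stays away from the ring
    and from itself as long as [|chi'| < pi].  Hence [chi] needs to rise over an action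
    interval of length about [Lu / pi], about [1/2], and [2 I + 2 u / pi] remains below
    [3 + O(e)].

    The inverse of an injective symplectic map is continuous: for [y] close to [f p] a minimum
    of [|f - y|^2] over a small cube around [p] is interior, and it is a solution of [f x = y]
    because the partial derivatives of [f] are linearly independent. *)

(** * Smooth functions *)

(** The radius comes from a budget of action. The band crosses [I = I0] where [chi] is at least
    [Lu], about [pi / 2], and joins the ring where [chi] vanishes. As the slope of [chi] stays below
    [pi], the ring carries legs near angle 0 that reach out to [Qa], about [1/2], on both sides of
    [I0]. Positive action then puts [I0] near [1/2], so [2 I] goes up to about 2, and [2 u / pi]
    adds 1. The lift does not exceed this: since [chi' > - pi], the quantity [2 I + 2 chi / pi]
    increases with [I].

    A coordinate [P] with [dP /\ dQ = e dX /\ dY] has to be steep on the ring and slow on the band,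
    while the torus closes up in both directions. A slit of length independent of [e] makes room for
    this: over the steep part the sides [Y < 0] and [Y > 0] of the slit become opposite edges of the
    ring and are not glued; off the slit, where [P] is slow, the band joins them.

    Smoothness in [e] is kept by building the profiles from [exp (- 1/t)] rescaled by [e]; rounding
    a corner in this way costs only [O(e)]. *)

Section SmoothCalculus.
Variable R : realType.

(* Only directional derivatives are used: [Cn n U f] iterates them [n] times in arbitrary
   directions, so that membership is proved by induction on [n]. *)
Fixpoint Cn (V W : normedModType R) (n : nat) (U : set V) (f : V -> W) : Prop :=
  (forall x, U x -> {for x, continuous f}) /\
  if n is n'.+1 then
    (forall x v, U x -> derivable f x v) /\ (forall v, Cn n' U ('D_v f))
  else True.

Definition sm {V W : normedModType R} (U : set V) (f : V -> W) := forall n, Cn n U f.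

Lemma Cn_cont {V W : normedModType R} n (U : set V) (f : V -> W) x :
  Cn n U f -> U x -> {for x, continuous f}.
Proof. by case: n => [|n] [h _]; exact: h. Qed.

Lemma CnW {V W : normedModType R} n (U : set V) (f : V -> W) :
  Cn n.+1 U f -> Cn n U f.
Proof.
elim: n f => [|n IH] f; first by case=> h _; split.
by case=> h [hd hD]; split => //; split => // v; apply: IH; exact: hD.
Qed.

Lemma Cn_sub {V W : normedModType R} n (U U' : set V) (f : V -> W) :
  U' `<=` U -> Cn n U f -> Cn n U' f.
Proof.
move=> s; elim: n f => [|n IH] f.
  by case=> h _; split => // x /s; exact: h.
case=> h [hd hD]; split; first by move=> x /s; exact: h.
by split=> [x v /s|v]; [exact: hd | apply: IH; exact: hD].
Qed.

Lemma Cn_eq {V W : normedModType R} n (U : set V) (f g : V -> W) :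
  open U -> (forall x, U x -> f x = g x) -> Cn n U f -> Cn n U g.
Proof.
move=> oU; elim: n f g => [|n IH] f g fg.
  case=> h _; split => // x Ux.
  rewrite /prop_for /continuous_at -(fg x Ux); apply: cvg_trans (h _ Ux).
  apply: near_eq_cvg; near=> y; apply: fg; near: y; exact: open_nbhs_nbhs.
have nfg x : U x -> \near x, f x = g x.
  by move=> Ux; near=> y; apply: fg; near: y; exact: open_nbhs_nbhs.
case=> h [hd hD]; split.
  move=> x Ux; rewrite /prop_for /continuous_at -(fg x Ux); apply: cvg_trans (h _ Ux).
  exact: near_eq_cvg (nfg _ Ux).
split=> [x v Ux|v].
  exact: near_eq_derivable (nfg _ Ux) (hd _ _ Ux).
apply: IH (hD v) => x Ux; exact: near_eq_derive (nfg _ Ux).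
Unshelve. all: by end_near. Qed.

Lemma Cn_local {V W : normedModType R} n (U : set V) (f : V -> W) :
  (forall x, U x -> exists2 A, A x & Cn n A f) -> Cn n U f.
Proof.
elim: n f => [|n IH] f h.
  by split => // x Ux; have [A Ax [c _]] := h _ Ux; exact: c.
split; first by move=> x Ux; have [A Ax [c _]] := h _ Ux; exact: c.
split=> [x v Ux|v].
  by have [A Ax [_ [c _]]] := h _ Ux; exact: c.
by apply: IH => x Ux; have [A Ax [_ [_ c]]] := h _ Ux; exists A => //; exact: c.
Qed.

Lemma sm_sub {V W : normedModType R} (U U' : set V) (f : V -> W) :
  U' `<=` U -> sm U f -> sm U' f.
Proof. by move=> s h n; exact: Cn_sub s (h n). Qed.

Lemma sm_eq {V W : normedModType R} (U : set V) (f g : V -> W) :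
  open U -> (forall x, U x -> f x = g x) -> sm U f -> sm U g.
Proof. by move=> oU fg h n; exact: Cn_eq oU fg (h n). Qed.

Lemma sm_local {V W : normedModType R} (U : set V) (f : V -> W) :
  (forall x, U x -> exists2 A, A x & sm A f) -> sm U f.
Proof. by move=> h n; apply: Cn_local => x /h[A Ax hA]; exists A => //; exact: hA. Qed.

Lemma sm_smooth_on {V W : normedModType R} (U : set V) (f : V -> W) :
  open U -> sm U f -> smooth_on U f.
Proof.
move=> oU h; split => // vs.
have H : sm U (Defs.iterD vs f).
  elim: vs => [|v vs IH] //= n.
  by case: (IH n.+1) => _ [_]; exact.
move=> x Ux; split; first exact: Cn_cont (H 0%N) Ux.
by case: (H 1%N) => _ [d _] v; exact: d.
Qed.

Lemma sm_derivable {V W : normedModType R} (U : set V) (f : V -> W) x v :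
  sm U f -> U x -> derivable f x v.
Proof. by move=> /(_ 1%N) [_ [d _]]; exact: d. Qed.

Lemma sm_derive {V W : normedModType R} (U : set V) (f : V -> W) v :
  sm U f -> sm U ('D_v f).
Proof. by move=> h n; case: (h n.+1) => _ [_]; exact. Qed.

Lemma sm_cont {V W : normedModType R} (U : set V) (f : V -> W) x :
  sm U f -> U x -> {for x, continuous f}.
Proof. by move=> h; exact: Cn_cont (h 0%N). Qed.

Lemma Cn_cst {V W : normedModType R} n (U : set V) (a : W) : Cn n U (fun=> a).
Proof.
elim: n a => [|n IH] a; first by split => // x _; exact: cvg_cst.
split; first by move=> x _; exact: cvg_cst.
split=> [x v _|v]; first exact: derivable_cst.
suff -> : 'D_v (fun=> a) = (fun=> 0) :> (V -> W) by exact: IH.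
by apply/funext => x; exact: derive_cst.
Qed.

Lemma sm_cst {V W : normedModType R} (U : set V) (a : W) : sm U (fun=> a).
Proof. by move=> n; exact: Cn_cst. Qed.

(** Restricting to a line lets the one-variable chain rule, and later implicit differentiation,
    carry over to any normed space. *)
Lemma derive_line {V : normedModType R} (f : V -> R) (x v : V) :
  'D_1 (fun h : R => f (h *: v + x)) (0 : R) = 'D_v f x.
Proof.
rewrite /derive; set g1 := fun h => h^-1 *: _; set g2 := fun h => h^-1 *: _.
suff -> : g1 = g2 by [].
by apply/funext => h; rewrite /g1 /g2 /= addr0 scale0r add0r [_%:A]mulr1.
Qed.

Section ScalarFunctions.
Variable V : normedModType R.
Implicit Types (U : set V) (f g : V -> R).

Lemma CnD n U f g : open U -> Cn n U f -> Cn n U g ->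
  Cn n U (fun x => f x + g x).
Proof.
move=> oU; elim: n f g => [|n IH] f g.
  by case=> hf _ [hg _]; split => // x Ux; apply: cvgD; [exact: hf | exact: hg].
case=> hf [df Df] [hg [dg Dg]]; split.
  by move=> x Ux; apply: cvgD; [exact: hf | exact: hg].
split=> [x v Ux|v]; first by apply: derivableD; [exact: df | exact: dg].
apply: Cn_eq (IH _ _ (Df v) (Dg v)) => // x Ux.
by rewrite -deriveD//; [exact: df | exact: dg].
Qed.

Lemma CnM n U f g : open U -> Cn n U f -> Cn n U g ->
  Cn n U (fun x => f x * g x).
Proof.
move=> oU; elim: n f g => [|n IH] f g.
  by case=> hf _ [hg _]; split => // x Ux; apply: cvgM; [exact: hf | exact: hg].
move=> Hf Hg; case: (Hf) (Hg) => hf [df Df] [hg [dg Dg]]; split.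
  by move=> x Ux; apply: cvgM; [exact: hf | exact: hg].
split=> [x v Ux|v]; first by apply: derivableM; [exact: df | exact: dg].
apply: (@Cn_eq _ _ _ _ (fun x => f x * 'D_v g x + g x * 'D_v f x)) => //.
  by move=> x Ux; rewrite -deriveM//; [exact: df | exact: dg].
by apply: CnD => //; apply: IH; solve [exact: Df | exact: Dg | exact: CnW].
Qed.

Lemma smD U f g : open U -> sm U f -> sm U g -> sm U (fun x => f x + g x).
Proof. by move=> oU hf hg n; exact: CnD. Qed.

Lemma smM U f g : open U -> sm U f -> sm U g -> sm U (fun x => f x * g x).
Proof. by move=> oU hf hg n; exact: CnM. Qed.

Lemma smN U f : open U -> sm U f -> sm U (fun x => - f x).
Proof.
move=> oU hf; apply: (@sm_eq _ _ _ (fun x => (-1) * f x)) => //.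
  by move=> x _; rewrite mulN1r.
by apply: smM => //; exact: sm_cst.
Qed.

Lemma smB U f g : open U -> sm U f -> sm U g -> sm U (fun x => f x - g x).
Proof. by move=> oU hf hg; apply: smD => //; exact: smN. Qed.

Lemma is_derive_comp1 (g : R -> R) f x v (dg df : R) :
  is_derive (f x) 1 g dg -> is_derive x v f df ->
  is_derive x v (fun y => g (f y)) (dg * df).
Proof.
move=> hg [hf hfe].
have h1 : is_derive (0 : R) (1 : R) (fun h : R => f (h *: v + x)) df.
  apply: DeriveDef; first exact: ((derivable1P f x v).1 hf).
  by rewrite derive_line.
have h2 : is_derive (f ((0 : R) *: v + x)) 1 g dg by rewrite scale0r add0r.
have [h3 h4] := is_derive1_comp h2 h1.
apply: DeriveDef; first exact: ((derivable1P (fun y => g (f y)) x v).2 h3).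
by rewrite -derive_line -h4.
Qed.

(** The induction runs over all smooth [g] at once: the derivative is [g' (f x)] times ['D_v f], so
    the hypothesis is applied to [g'] while [f] stays fixed and loses one order. *)
Lemma Cn_comp1 n (O : set R) (g : R -> R) U f : open U ->
  (forall x, U x -> O (f x)) -> sm O g -> Cn n U f -> Cn n U (fun x => g (f x)).
Proof.
move=> oU UO; elim: n g => [|n IH] g sg Hf.
  case: Hf => hf _; split => // x Ux.
  by apply: (@continuous_comp _ _ _ f g); [exact: hf | apply: sm_cont sg _; exact: UO].
case: (Hf) => hf [df Df].
have D x v : U x -> is_derive x v (fun y => g (f y)) ('D_1 g (f x) * 'D_v f x).
  move=> Ux; apply: is_derive_comp1; apply: derivableP; last exact: df.
  by apply: sm_derivable sg _; exact: UO.
split.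
  move=> x Ux; apply: (@continuous_comp _ _ _ f g); first exact: hf.
  by apply: sm_cont sg _; exact: UO.
split=> [x v Ux|v]; first by case: (D x v Ux).
apply: (@Cn_eq _ _ _ _ (fun x => 'D_1 g (f x) * 'D_v f x)) => //.
  by move=> x Ux; case: (D x v Ux).
apply: (@CnM n U (fun x => 'D_1 g (f x)) ('D_v f) oU _ (Df v)).
apply: (IH ('D_1 g)) (CnW Hf).
exact: sm_derive.
Qed.

Lemma sm_comp1 (O : set R) (g : R -> R) U f : open U ->
  (forall x, U x -> O (f x)) -> sm O g -> sm U f -> sm U (fun x => g (f x)).
Proof. by move=> oU UO sg sf n; exact: (Cn_comp1 oU UO sg (sf n)). Qed.

End ScalarFunctions.

Lemma smX (V : normedModType R) (U : set V) (f : V -> R) k : open U -> sm U f ->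
  sm U (fun x => f x ^+ k).
Proof.
move=> oU hf; elim: k => [|k IH]; first exact: sm_cst.
apply: (@sm_eq _ _ _ (fun x => f x * f x ^+ k)) => //; first by move=> x _; rewrite exprS.
exact: smM.
Qed.

Lemma Cn_step n (U : set R) (g G : R -> R) : open U ->
  (forall x, U x -> is_derive x 1 g (G x)) -> Cn n U G -> Cn n.+1 U g.
Proof.
move=> oU dg hG; have D x v : U x -> is_derive x v g (v * G x).
  move=> Ux; have := @is_derive_comp1 R g (fun x => x) x v _ _ (dg x Ux) (is_derive_id _ _).
  by rewrite mulrC.
have c x : U x -> {for x, continuous g}.
  move=> Ux; apply/differentiable_continuous/derivable1_diffP.
  by case: (dg x Ux).
split => //; split => [x v Ux|v]; first by case: (D x v Ux).
apply: (@Cn_eq _ _ _ _ (fun x => v * G x)) => //.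
  by move=> x Ux; case: (D x v Ux).
by apply: CnM => //; exact: Cn_cst.
Qed.

(** Meant for functions whose derivative is an expression in the function itself, such as [x^-1] or
    the square root: order [n] for [g] gives order [n] for [G], hence order [n + 1] for [g]. *)
Lemma sm_bootstrap (U : set R) (g G : R -> R) : open U ->
  (forall x, U x -> is_derive x 1 g (G x)) ->
  (forall n, Cn n U g -> Cn n U G) -> sm U g.
Proof.
move=> oU dg hG; elim=> [|n IH]; last by apply: Cn_step dg _ => //; exact: hG.
split => // x Ux; apply/differentiable_continuous/derivable1_diffP.
by case: (dg x Ux).
Qed.

Lemma sm_id1 (U : set R) : open U -> sm U (fun x : R => x).
Proof.
move=> oU; apply: (@sm_bootstrap _ _ (fun=> 1)) => //.
by move=> n _; exact: Cn_cst.
Qed.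

Lemma open_neq0 : open [set x : R | x != 0].
Proof.
have -> : [set x : R | x != 0] = ~` [set 0] by apply/seteqP; split => x /= /eqP.
by rewrite openC; exact: closed_eq.
Qed.

End SmoothCalculus.

(** * Smoothness of the elementary functions and of [exp (- 1/t)] *)

Section ElementarySmooth.
Variable R : realType.

Lemma sm_inv : sm [set x : R | x != 0] (fun x => x^-1).
Proof.
apply: (@sm_bootstrap _ _ _ (fun x => - (x^-1) ^+ 2)).
- exact: open_neq0.
- move=> x /= x0; have := @is_deriveV R id x 1 1 x0 (is_derive_id x (1 : R)).
  by rewrite exprVn /= [_ *: 1]mulr1.
- move=> n h; apply: (@Cn_eq _ _ _ _ _ (fun x : R => (-1) * (x^-1 * x^-1))).
  + exact: open_neq0.
  + by move=> x _; rewrite mulN1r expr2.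
  + have o := @open_neq0 R; apply: CnM => //; first exact: Cn_cst.
    exact: CnM.
Qed.

Lemma sm_sin_cos n : Cn n [set: R] sin /\ Cn n [set: R] cos.
Proof.
have oT := @openT R; elim: n => [|n [IHs IHc]].
  by split; split => // x _; [exact: continuous_sin | exact: continuous_cos].
split; first exact: (@Cn_step _ _ _ _ cos).
apply: (@Cn_step _ _ _ _ (fun x => - sin x)) => //.
apply: (@Cn_eq _ _ _ _ _ (fun x : R => (-1) * sin x)) => //.
  by move=> x _; rewrite mulN1r.
by apply: CnM => //; exact: Cn_cst.
Qed.

Lemma sm_sin : sm [set: R] sin. Proof. by move=> n; case: (sm_sin_cos n). Qed.
Lemma sm_cos : sm [set: R] cos. Proof. by move=> n; case: (sm_sin_cos n). Qed.

Lemma sm_sqrt : sm [set x : R | 0 < x] Num.sqrt.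
Proof.
have o0 : open [set x : R | 0 < x] by exact: open_gt.
apply: (@sm_bootstrap _ _ _ (fun x => (2 * Num.sqrt x)^-1)) => //.
move=> n h; apply: (Cn_comp1 o0 _ sm_inv).
  by move=> x /= x0; rewrite mulf_neq0// gt_eqF// sqrtr_gt0.
by apply: CnM => //; exact: Cn_cst.
Qed.

Lemma sm_asin : sm [set x : R | -1 < x < 1] asin.
Proof.
have o1 : open [set x : R | -1 < x < 1].
  have -> : [set x : R | -1 < x < 1] = [set x | -1 < x] `&` [set x | x < 1].
    by apply/seteqP; split => x /=; [move=> /andP[] | move=> [-> ->]].
  by apply: openI; [exact: open_gt | exact: open_lt].
apply: (@sm_bootstrap _ _ _ (fun x => (Num.sqrt (1 - x ^+ 2))^-1)) => //.
move=> n _; move: n.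
apply: (@sm_comp1 _ _ _ (fun x => x^-1)) sm_inv _ => // [x /= /andP[x1 x2]|].
  by rewrite gt_eqF// sqrtr_gt0; nra.
apply: (@sm_comp1 _ _ _ Num.sqrt) sm_sqrt _ => // [x /= /andP[x1 x2]|]; first by nra.
by apply: smB => //; [exact: sm_cst | apply: smX => //; exact: sm_id1].
Qed.

(* Polynomial multiples of [exp (- 1/t)] in the variable [1/t] are stable under derivation. *)
Definition flat (p : {poly R}) (t : R) : R :=
  if 0 < t then p.[t^-1] * expR (- t^-1) else 0.

Lemma exp_dominates_monomial k : exists2 C : R, 0 <= C &
  forall z : R, 0 <= z -> z ^+ k <= C * expR z.
Proof.
case: k => [|k].
  by exists 1 => // z z0; rewrite expr0 mul1r -expR0 ler_expR.
exists (k.+1%:R ^+ k.+1); first by rewrite exprn_ge0.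
move=> z z0; have k0 : (0 : R) < k.+1%:R by rewrite ltr0n.
(* Each of the [k + 1] factors [exp (z / (k + 1))] is at least [z / (k + 1)], which explains the
   constant. *)
have -> : expR z = expR (z / k.+1%:R) ^+ k.+1.
  by rewrite -expRM_natl mulrC divfK// gt_eqF.
rewrite -exprMn lerXn2r ?nnegrE ?mulr_ge0 ?expR_ge0//.
rewrite mulrC -ler_pdivrMr//.
by apply: le_trans (expR_ge1Dx _); rewrite lerDr.
Qed.

Lemma exp_dominates_poly (p : {poly R}) : exists2 C : R, 0 <= C &
  forall z : R, 0 <= z -> `|p.[z]| <= C * expR z.
Proof.
have H (n : nat) (c : nat -> R) : exists2 C : R, 0 <= C &
    forall z : R, 0 <= z -> `|\sum_(i < n) c i * z ^+ i| <= C * expR z.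
  elim: n => [|n [C C0 IH]].
    by exists 0 => // z _; rewrite big_ord0 normr0 mul0r.
  have [B B0 hB] := exp_dominates_monomial n.
  exists (C + `|c n| * B); first by rewrite addr_ge0// mulr_ge0.
  move=> z z0; rewrite big_ord_recr /= mulrDl (le_trans (ler_normD _ _))//.
  rewrite lerD ?IH// normrM -mulrA ler_wpM2l//.
  by rewrite ger0_norm ?exprn_ge0// hB.
have [C C0 hC] := H (size p) (fun i => p`_i).
by exists C => // z z0; rewrite horner_coef hC.
Qed.

(** A quadratic bound forces the difference quotient at 0 to vanish in the limit. It is the
    domination of ['X^2 * p] by the exponential, evaluated at [1/t]. *)
Lemma flat_small (p : {poly R}) : exists C : R, forall t, `|flat p t| <= C * t ^+ 2.
Proof.
have [C C0 hC] := exp_dominates_poly ('X^2 * p).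
exists C => t; rewrite /flat; case: ltP => t0; last first.
  by rewrite normr0 mulr_ge0// sqr_ge0.
have z0 : 0 <= t^-1 by rewrite invr_ge0 ltW.
have E : `|('X^2 * p).[t^-1]| = t^-1 ^+ 2 * `|p.[t^-1]|.
  by rewrite hornerM hornerXn normrM ger0_norm// exprn_ge0.
have := hC _ z0; rewrite E => h.
have Ee : `|expR (- t^-1)| = (expR t^-1)^-1.
  by rewrite expRN ger0_norm// invr_ge0 expR_ge0.
rewrite normrM Ee ler_pdivrMr ?expR_gt0//.
have -> : `|p.[t^-1]| = t ^+ 2 * (t^-1 ^+ 2 * `|p.[t^-1]|).
  by field; rewrite gt_eqF.
rewrite (_ : C * _ * _ = t ^+ 2 * (C * expR t^-1)); last by ring.
by rewrite ler_wpM2l// sqr_ge0.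
Qed.

(** With [s = 1/t], differentiating [p(s) exp (- s)] produces the factor [ds/dt = - s^2], hence the
    polynomial [s^2 (p - p')]. At [t = 0] the quadratic bound of [flat_small] takes over. *)
Lemma is_derive_flat (p : {poly R}) (t : R) :
  is_derive t 1 (flat p) (flat ('X^2 * (p - p^`())) t).
Proof.
have [t0|t0|->] := ltgtP t 0.
- have -> : flat ('X^2 * (p - p^`())) t = 0 by rewrite /flat ltNge (ltW t0).
  apply: (@near_eq_is_derive _ _ _ (fun=> 0)).
  near=> s; rewrite /flat ltNge.
  have -> // : s <= 0 by apply: ltW; near: s; exact: lt_nbhsl.
- have tn0 : t != 0 by rewrite gt_eqF.
  have d1 : is_derive t 1 (fun s : R => s^-1) (- t ^- 2).
    have := @is_deriveV R id t 1 1 tn0 (is_derive_id t (1 : R)).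
    by rewrite [_ *: 1]mulr1.
  have d2 : is_derive t^-1 1 (horner p) p^`().[t^-1].
    apply: DeriveDef; first exact: derivable_horner.
    by rewrite derivE derive1E.
  have d3 := is_derive_comp1 d2 d1.
  have d4 : is_derive t 1 (fun s : R => - s^-1) (t ^- 2).
    by have := is_deriveN d1; rewrite opprK.
  have d5 := @is_derive_comp1 _ _ _ (fun s : R => - s^-1) _ _ _ _ (is_derive_expR (- t^-1)) d4.
  have d6 := is_deriveM d3 d5.
  apply: (@near_eq_is_derive _ _ _ ((fun s => p.[s^-1]) * (fun s => expR (- s^-1)))).
    near=> s; rewrite /flat.
    by have -> // : 0 < s by near: s; exact: lt_nbhsr.
  apply: is_derive_eq d6 _.
  rewrite /flat t0 hornerM hornerXn hornerD hornerN exprVn /=.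
  by rewrite /GRing.scale /=; ring.
- have -> : flat ('X^2 * (p - p^`())) 0 = 0 by rewrite /flat ltxx.
  have [C hC] := flat_small p.
  have c : (fun h : R => h^-1 *: ((flat p \o shift 0) (h *: 1) - flat p 0)) @ 0^' --> (0 : R).
    apply/cvgrPdist_le => /= e e0; near=> h.
    have h0 : h != 0 by near: h; exact: nbhs_dnbhs_neq.
    rewrite sub0r normrN addr0 [h *: 1]mulr1 {2}/flat ltxx subr0 normrM normfV.
    rewrite mulrC ler_pdivrMr ?normr_gt0//.
    apply: le_trans (hC h) _.
    rewrite -[h ^+ 2]ger0_norm ?sqr_ge0// normrX expr2 mulrA ler_wpM2r//.
    have C1 : 0 < `|C| + 1 by rewrite ltr_wpDl.
    have : `|h| <= e / (`|C| + 1).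
      by near: h; apply: dnbhs0_le; rewrite divr_gt0.
    rewrite ler_pdivlMr// => H; apply: le_trans H.
    rewrite mulrC ler_wpM2l// (le_trans (ler_norm _))// lerDl//.
  apply: DeriveDef; last exact: cvg_lim c.
  by apply/cvg_ex; exists 0.
Unshelve. all: by end_near. Qed.

Lemma sm_flat (p : {poly R}) : sm [set: R] (flat p).
Proof.
move=> n; elim: n p => [|n IH] p.
  split => // x _; apply/differentiable_continuous/derivable1_diffP.
  by case: (is_derive_flat p x).
apply: Cn_step (IH _); first exact: openT.
by move=> x _; exact: is_derive_flat.
Qed.

End ElementarySmooth.

(** * Cutoff functions *)

Section Bumps.
Variable R : realType.
Implicit Types t : R.

(** Smooth substitute for [max(0, t)]: it vanishes for [t <= 0], lies between [t - 1] and [t] for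
    [t >= 0], and its slope [dramp] stays in [[0, 1]] and is at least [exp (- 1)] from [t = 1] on.
    The slope bound 1 later keeps the slope of [chi] below [pi]. *)
Definition ramp t : R := t * flat 1 t.
Definition dramp t : R := flat (1 + 'X) t.
Definition bstep t : R := flat 1 t / (flat 1 t + flat 1 (1 - t)).

Lemma flat1_gt0 t : 0 < t -> 0 < flat 1 t.
Proof. by move=> t0; rewrite /flat t0 hornerC mul1r expR_gt0. Qed.

Lemma flat_eq0 (p : {poly R}) t : t <= 0 -> flat p t = 0.
Proof. by move=> t0; rewrite /flat ltNge t0. Qed.

Lemma flat1_ge0 t : 0 <= flat 1 t.
Proof. by have [t0|t0] := ltP 0 t; [exact/ltW/flat1_gt0 | rewrite flat_eq0]. Qed.

Lemma ramp_eq0 t : t <= 0 -> ramp t = 0.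
Proof. by move=> t0; rewrite /ramp flat_eq0// mulr0. Qed.

Lemma dramp_eq0 t : t <= 0 -> dramp t = 0.
Proof. exact: flat_eq0. Qed.

Lemma is_derive_ramp t : is_derive t 1 ramp (dramp t).
Proof.
have d1 := is_derive_flat (1 : {poly R}) t.
have d2 := is_deriveM (is_derive_id t (1 : R)) d1.
apply: is_derive_eq d2 _.
rewrite /dramp /flat; case: ltP => t0 /=; last by rewrite /GRing.scale /= mulr0 mul0r addr0.
rewrite !(hornerM, hornerXn, hornerD, hornerN, hornerC, hornerX, derivC) /GRing.scale /=.
by field; rewrite gt_eqF.
Qed.

Lemma dramp_ge0 t : 0 <= dramp t.
Proof.
rewrite /dramp /flat; case: ltP => // t0.
by rewrite hornerD hornerC hornerX mulr_ge0 ?expR_ge0// addr_ge0// invr_ge0 ltW.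
Qed.

(** This is [1 + z <= exp z] at [z = 1/t]. *)
Lemma dramp_le1 t : dramp t <= 1.
Proof.
rewrite /dramp /flat; case: ltP => // t0.
rewrite hornerD hornerC hornerX expRN ler_pdivrMr ?expR_gt0// mul1r.
by apply: expR_ge1Dx.
Qed.

Lemma dramp_lb t : 1 <= t -> expR (-1) <= dramp t.
Proof.
move=> t1; have t0 : 0 < t by apply: lt_le_trans t1.
rewrite /dramp /flat t0 hornerD hornerC hornerX -[leLHS]mul1r.
rewrite ler_pM ?expR_ge0 ?lerDl ?invr_ge0 ?(ltW t0)// ler_expR lerN2.
by rewrite invf_le1.
Qed.

Lemma ramp_ge0 t : 0 <= ramp t.
Proof.
have [t0|t0] := ltP 0 t; last by rewrite ramp_eq0.
by rewrite mulr_ge0 ?flat1_ge0// ltW.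
Qed.

Lemma ramp_le t : 0 <= t -> ramp t <= t.
Proof.
rewrite le_eqVlt => /predU1P[<-|t0]; first by rewrite ramp_eq0.
rewrite /ramp ger_pMr// /flat t0 hornerC mul1r -expR0 ler_expR.
by rewrite oppr_le0 invr_ge0 ltW.
Qed.

Lemma ramp_ge t : t - 1 <= ramp t.
Proof.
have [t0|t0] := ltP 0 t; last first.
  by rewrite ramp_eq0// subr_le0 (le_trans t0).
rewrite /ramp /flat t0 hornerC mul1r.
have -> : t - 1 = t * (1 + - t^-1) by field; rewrite gt_eqF.
by rewrite ler_pM2l// expR_ge1Dx.
Qed.

Lemma sm_ramp : sm [set: R] ramp.
Proof.
by apply: smM; [exact: openT | apply: sm_id1; exact: openT | exact: sm_flat].
Qed.

Lemma sm_dramp : sm [set: R] dramp.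
Proof. exact: sm_flat. Qed.

Lemma bstep_den t : 0 < flat 1 t + flat 1 (1 - t).
Proof.
have [t0|t0] := ltP 0 t; first by rewrite ltr_pwDl ?flat1_gt0 ?flat1_ge0.
by rewrite ltr_wpDl ?flat1_ge0// flat1_gt0// subr_gt0 (le_lt_trans t0).
Qed.

Lemma bstep0 t : t <= 0 -> bstep t = 0.
Proof. by move=> t0; rewrite /bstep flat_eq0// mul0r. Qed.

Lemma bstep1 t : 1 <= t -> bstep t = 1.
Proof.
move=> t1; rewrite /bstep [flat 1 (1 - t)]flat_eq0 ?subr_le0// addr0 divff// gt_eqF//.
by rewrite flat1_gt0// (lt_le_trans _ t1).
Qed.

Lemma bstep_ge0 t : 0 <= bstep t.
Proof. by rewrite divr_ge0 ?flat1_ge0// ltW// bstep_den. Qed.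

Lemma bstep_le1 t : bstep t <= 1.
Proof. by rewrite ler_pdivrMr ?bstep_den// mul1r lerDl flat1_ge0. Qed.

Lemma sm_bstep : sm [set: R] bstep.
Proof.
have oT := @openT R; apply: smM => //; first exact: sm_flat.
apply: (@sm_comp1 _ _ _ (fun x => x^-1)) (@sm_inv R) _ => //.
  by move=> x _ /=; rewrite gt_eqF// bstep_den.
apply: smD => //; first exact: sm_flat.
apply: (@sm_comp1 _ _ setT (flat 1)) => //; first exact: sm_flat.
by apply: smB => //; [exact: sm_cst | exact: sm_id1].
Qed.

End Bumps.

(** * Kepler's equation *)

Section Kepler.
Variable R : realType.
Implicit Types (a b c d x : R).

Lemma norm_sin_le x : `|sin x| <= `|x|.
Proof.
wlog x0 : x / 0 <= x.
  move=> H; have [/H//|/ltW x0] := leP 0 x.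
  by rewrite -normrN -sinN -[leRHS]normrN H// oppr_ge0.
have [] := @MVT_segment R sin cos 0 x x0.
  exact/continuous_subspaceT/continuous_sin.
move=> t _; rewrite sin0 !subr0 => ->.
by rewrite normrM ler_piMl// cos_max.
Qed.

(* With [a = k sin (2 phi)] and [b = k cos (2 phi)] the zeros of [kepF a b] are the solutions
   of Kepler's equation [d + k sin (2 (phi + d)) = 0]. *)
Definition kepF a b d : R := d + a * cos (2 * d) + b * sin (2 * d).

Lemma kepF_diff a b d d' : kepF a b d - kepF a b d' =
  (d - d') - 2 * sin (d - d') * (a * sin (d + d') - b * cos (d + d')).
Proof.
rewrite /kepF.
have -> : 2 * d = (d + d') + (d - d') by ring.
have -> : 2 * d' = (d + d') - (d - d') by ring.
set s := d + d'; set t := d - d'.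
by rewrite cosB sinB cosD sinD /t; ring.
Qed.

(** Cauchy-Schwarz, read off from Lagrange's identity. *)
Lemma unit_combination_le a b c s m : 0 <= m -> a ^+ 2 + b ^+ 2 <= m ^+ 2 ->
  c ^+ 2 + s ^+ 2 = 1 -> `|a * s - b * c| <= m.
Proof.
move=> m0 ab cs; have h := sqr_ge0 (a * c + b * s).
have : (a * s - b * c) ^+ 2 <= m ^+ 2.
  have -> : (a * s - b * c) ^+ 2 =
    (a ^+ 2 + b ^+ 2) * (c ^+ 2 + s ^+ 2) - (a * c + b * s) ^+ 2 by ring.
  by rewrite cs; lra.
by set q := a * s - _ => hq; rewrite ler_norml; apply/andP; split; nra.
Qed.

(** Sum-to-product turns the trigonometric part of the difference into [2 sin (d - d')] times a
    combination bounded by [m]. For [m < 1/2] this yields uniqueness of the solution of Kepler's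
    equation and, in [kep_lip], its Lipschitz dependence on [a] and [b]. *)
Lemma kepF_mono a b d d' m : 0 <= m -> a ^+ 2 + b ^+ 2 <= m ^+ 2 ->
  (1 - 2 * m) * `|d - d'| <= `|kepF a b d - kepF a b d'|.
Proof.
move=> m0 ab; rewrite kepF_diff.
have h1 := unit_combination_le m0 ab (cos2Dsin2 (d + d')).
set q := a * _ - _ in h1 *.
have h2 := norm_sin_le (d - d').
have h3 : `|2 * sin (d - d') * q| <= 2 * m * `|d - d'|.
  rewrite !normrM (ger0_norm (_ : 0 <= 2))//.
  have := ler_pM (normr_ge0 _) (normr_ge0 _) h2 h1; lra.
have := lerB_normD (d - d') (- (2 * sin (d - d') * q)).
by rewrite normrN; lra.
Qed.

Lemma kep_exists a b : a ^+ 2 + b ^+ 2 < 4^-1 -> exists d, kepF a b d = 0.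
Proof.
move=> ab.
have m (x : R) : `|a * cos (2 * x) + b * sin (2 * x)| <= 2^-1.
  have := @unit_combination_le a (- b) (sin (2 * x)) (cos (2 * x)) 2^-1.
  rewrite mulNr opprK; apply => //; last by rewrite addrC cos2Dsin2.
  by rewrite sqrrN; lra.
have c : continuous (kepF a b).
  move=> x; apply: (sm_cont (U := setT)) => //.
  have oT := @openT R; have s2 : sm setT (fun d => 2 * d).
    by apply: smM => //; [exact: sm_cst | exact: sm_id1].
  apply: smD => //; first apply: smD => //; first exact: sm_id1.
    apply: smM => //; first exact: sm_cst.
    by apply: (sm_comp1 _ _ (@sm_cos R)).
  apply: smM => //; first exact: sm_cst.
  by apply: (sm_comp1 _ _ (@sm_sin R)).
(* The trigonometric part is at most [1/2] in absolute value, so [kepF] changes sign between [-1]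
   and [1]. *)
have [] := @IVT R (kepF a b) (-1) 1 0.
- lra.
- exact: continuous_subspaceT.
- have := m (-1); have := m 1; rewrite /kepF !ler_norml => /andP[h1 h2] /andP[h3 h4].
  by rewrite ge_min le_max; apply/andP; split; apply/orP; [left | right]; lra.
by move=> d _ dE; exists d.
Qed.

Definition kep a b : R := xget 0 [set d | kepF a b d = 0].

Lemma kepP a b : a ^+ 2 + b ^+ 2 < 4^-1 -> kepF a b (kep a b) = 0.
Proof. by move=> /kep_exists[d dE]; rewrite /kep; case: xgetP => // /(_ d). Qed.

Lemma kep_modulus a b : a ^+ 2 + b ^+ 2 < 4^-1 ->
  exists2 m, 0 <= m < 2^-1 & a ^+ 2 + b ^+ 2 <= m ^+ 2.
Proof.
move=> ab; exists (Num.sqrt (a ^+ 2 + b ^+ 2)); last first.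
  by rewrite sqr_sqrtr// addr_ge0// sqr_ge0.
rewrite sqrtr_ge0 /=; have := sqrtr_ge0 (a ^+ 2 + b ^+ 2).
have := sqr_sqrtr (addr_ge0 (sqr_ge0 a) (sqr_ge0 b)).
by set q := Num.sqrt _ => hq q0; nra.
Qed.

Lemma kep_den_gt0 a b d : a ^+ 2 + b ^+ 2 < 4^-1 ->
  0 < 1 - 2 * (a * sin (2 * d)) + 2 * (b * cos (2 * d)).
Proof.
move=> /kep_modulus[m /andP[m0 m1] ab].
have := unit_combination_le m0 ab (cos2Dsin2 (2 * d)).
by rewrite ler_norml => /andP[]; lra.
Qed.

Lemma kep_lip a b a' b' m : 0 <= m -> a ^+ 2 + b ^+ 2 <= m ^+ 2 -> m < 2^-1 ->
  a' ^+ 2 + b' ^+ 2 < 4^-1 ->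
  (1 - 2 * m) * `|kep a' b' - kep a b| <= `|a' - a| + `|b' - b|.
Proof.
move=> m0 abm m1 ab'.
have ab : a ^+ 2 + b ^+ 2 < 4^-1 by nra.
have := kepF_mono (kep a' b') (kep a b) m0 abm; rewrite (kepP ab) subr0.
have -> : kepF a b (kep a' b') = kepF a b (kep a' b') - kepF a' b' (kep a' b').
  by rewrite (kepP ab') subr0.
move=> /le_trans; apply; rewrite /kepF.
set c := cos _; set s := sin _.
have -> : kep a' b' + a * c + b * s - (kep a' b' + a' * c + b' * s) =
  - ((a' - a) * c) - (b' - b) * s by ring.
rewrite (le_trans (ler_normB _ _))// normrN !normrM lerD//.
  by rewrite ler_piMr// cos_max.
by rewrite ler_piMr// sin_max.
Qed.

End Kepler.

Section KeplerSmooth.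
Variable R : realType.

Lemma kep_cvg (T : topologicalType) (A B : T -> R) (t : T) :
  {for t, continuous A} -> {for t, continuous B} ->
  A t ^+ 2 + B t ^+ 2 < 4^-1 -> {for t, continuous (fun y => kep (A y) (B y))}.
Proof.
move=> cA cB ab; have [m /andP[m0 m1] abm] := kep_modulus ab.
have n0 : 0 < 1 - 2 * m by lra.
apply/cvgrPdist_le => e e0.
have e1 : 0 < e * (1 - 2 * m) / 2 by rewrite divr_gt0// mulr_gt0.
have nA : \forall y \near t, `|A t - A y| <= e * (1 - 2 * m) / 2.
  by move/cvgrPdist_le : cA; apply.
have nB : \forall y \near t, `|B t - B y| <= e * (1 - 2 * m) / 2.
  by move/cvgrPdist_le : cB; apply.
have nAB : \forall y \near t, A y ^+ 2 + B y ^+ 2 < 4^-1.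
  have cc : (fun y => A y ^+ 2 + B y ^+ 2) @ t --> A t ^+ 2 + B t ^+ 2.
    by apply: cvgD; rewrite expr2; under eq_fun do rewrite expr2; apply: cvgM.
  by apply: (cvgr_lt _ cc).
near=> y.
have h := @kep_lip R (A t) (B t) (A y) (B y) m m0 abm m1 (near nAB y _).
rewrite distrC -(@ler_pM2l _ (1 - 2 * m))//; apply: le_trans (h _) _ => //.
rewrite distrC (distrC (B y)).
have hA : `|A t - A y| <= e * (1 - 2 * m) / 2 by near: y.
have hB : `|B t - B y| <= e * (1 - 2 * m) / 2 by near: y.
lra.
Unshelve. all: by end_near. Qed.

Let num (a' b' d : R) := a' * cos (2 * d) + b' * sin (2 * d).
Let den (a b d : R) := 1 - 2 * (a * sin (2 * d)) + 2 * (b * cos (2 * d)).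

(** Implicit differentiation through Caratheodory slopes: the increments of [A], [B], [cos (2 d)]
    and [sin (2 d)] are written as a slope, continuous at the base point, times an increment.
    Continuity of [d] comes from [kep_cvg], and [kep_den_gt0] allows the division. *)
Lemma is_derive_kep1 (A B : R -> R) (t a' b' : R) :
  is_derive t 1 A a' -> is_derive t 1 B b' -> A t ^+ 2 + B t ^+ 2 < 4^-1 ->
  is_derive t 1 (fun y => kep (A y) (B y))
    (- num a' b' (kep (A t) (B t)) / den (A t) (B t) (kep (A t) (B t))).
Proof.
move=> dA dB ab; set d := fun y => kep (A y) (B y); set d0 := kep _ _.
have cA : {for t, continuous A}.
  by apply/differentiable_continuous/derivable1_diffP; case: dA.
have cB : {for t, continuous B}.
  by apply/differentiable_continuous/derivable1_diffP; case: dB.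
have cd : {for t, continuous d} by exact: kep_cvg.
have [gA [gAE cgA gA0]] := (is_derive1_caratheodory _ _ _).1 dA.
have [gB [gBE cgB gB0]] := (is_derive1_caratheodory _ _ _).1 dB.
have d2 : is_derive d0 1 (fun s : R => 2 * s) 2.
  have := @is_deriveM _ _ (cst 2) id d0 1 _ _ (is_derive_cst _ _ _) (is_derive_id _ _).
  by rewrite /= scaler0 addr0 [_ *: 1]mulr1.
have dc := is_derive_comp1 (is_derive_cos (2 * d0)) d2.
have ds := is_derive_comp1 (is_derive_sin (2 * d0)) d2.
have [gc [gcE cgc gc0]] := (is_derive1_caratheodory _ _ _).1 dc.
have [gs [gsE cgs gs0]] := (is_derive1_caratheodory _ _ _).1 ds.
pose N z := gA z * cos (2 * d0) + gB z * sin (2 * d0).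
pose D z := 1 + A z * gc (d z) + B z * gs (d z).
have D0 : D t = den (A t) (B t) d0 by rewrite /D /den gc0 gs0; ring.
have D0n : D t != 0 by rewrite D0 gt_eqF// kep_den_gt0.
have cD : {for t, continuous D}.
  apply: cvgD; first apply: cvgD; first exact: cvg_cst.
    by apply: cvgM => //; apply: continuous_comp.
  by apply: cvgM => //; apply: continuous_comp.
have cN : {for t, continuous N}.
  by apply: cvgD; apply: cvgM => //; exact: cvg_cst.
have nAB : \forall y \near t, A y ^+ 2 + B y ^+ 2 < 4^-1.
  have cc : (fun y => A y ^+ 2 + B y ^+ 2) @ t --> A t ^+ 2 + B t ^+ 2.
    by apply: cvgD; rewrite expr2; under eq_fun do rewrite expr2; apply: cvgM.
  by apply: (cvgr_lt _ cc).
have nD : \forall y \near t, D y != 0.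
  exact: (cvgr_neq0 _ cD).
(* Kepler's equation at [z] minus that at [t], with the slopes inserted, is linear in the increment
   of [d]; its coefficient [D z] stays nonzero near [t]. *)
have E z : A z ^+ 2 + B z ^+ 2 < 4^-1 -> (d z - d0) * D z = - (N z * (z - t)).
  move=> abz; have h1 := kepP abz; have h0 := kepP ab.
  rewrite /kepF -/(d z) in h1; rewrite /kepF -/d0 in h0.
  have := gAE z; have := gBE z; have := gcE (d z); have := gsE (d z).
  rewrite /N /D => e1 e2 e3 e4.
  have -> : (d z - d0) * (1 + A z * gc (d z) + B z * gs (d z)) =
    (d z - d0) + A z * (gc (d z) * (d z - d0)) + B z * (gs (d z) * (d z - d0)) by ring.
  have -> : (gA z * cos (2 * d0) + gB z * sin (2 * d0)) * (z - t) =
    (gA z * (z - t)) * cos (2 * d0) + (gB z * (z - t)) * sin (2 * d0) by ring.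
  by rewrite -e1 -e2 -e3 -e4; apply/eqP; rewrite -subr_eq0; apply/eqP; move: h1 h0; set u := cos (2 * d z); set w := sin (2 * d z); set u0 := cos _; set w0 := sin _; lra.
pose g z := if z == t then - N t / D t else (d z - d0) / (z - t).
apply/is_derive1_caratheodory; exists g; split.
- move=> z; rewrite /g; case: eqP => [->|/eqP zt]; first by rewrite !subrr mulr0.
  by rewrite divfK// subr_eq0.
- have c : (fun z => - N z / D z) @ t --> - N t / D t.
    by apply: cvgM; [exact: cvgN | exact: cvgV].
  rewrite /prop_for /continuous_at {2}/g eqxx; apply: cvg_trans c.
  apply: near_eq_cvg; near=> z; rewrite /g; case: eqP => [-> //|/eqP zt].
  have Dz : D z != 0 by near: z.
  have Ez := E z (near nAB z _).
  have zt0 : z - t != 0 by rewrite subr_eq0.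
  apply: (mulIf Dz); rewrite divfK//; apply: (mulIf zt0).
  rewrite mulrAC divfK// Ez//; ring.
- by rewrite /g eqxx D0 /N gA0 gB0.
Unshelve. all: by end_near. Qed.

Lemma is_derive_kep (V : normedModType R) (A B : V -> R) (x v : V) (a' b' : R) :
  is_derive x v A a' -> is_derive x v B b' -> A x ^+ 2 + B x ^+ 2 < 4^-1 ->
  is_derive x v (fun y => kep (A y) (B y))
    (- num a' b' (kep (A x) (B x)) / den (A x) (B x) (kep (A x) (B x))).
Proof.
move=> [hA EA] [hB EB] ab.
have lA : is_derive (0 : R) 1 (fun h : R => A (h *: v + x)) a'.
  by apply: DeriveDef; [exact: ((derivable1P A x v).1 hA) | rewrite derive_line].
have lB : is_derive (0 : R) 1 (fun h : R => B (h *: v + x)) b'.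
  by apply: DeriveDef; [exact: ((derivable1P B x v).1 hB) | rewrite derive_line].
have := is_derive_kep1 lA lB; rewrite /= scale0r add0r => /(_ ab)[h1 h2].
apply: DeriveDef; first exact: ((derivable1P (fun y => kep (A y) (B y)) x v).2 h1).
by rewrite -derive_line.
Qed.

(** A bootstrap: every directional derivative of [d] is a smooth expression in [d], [A], [B] and the
    derivatives of [A] and [B]. *)
Lemma sm_kep (V : normedModType R) (U : set V) (A B : V -> R) : open U ->
  (forall x, U x -> A x ^+ 2 + B x ^+ 2 < 4^-1) ->
  sm U A -> sm U B -> sm U (fun y => kep (A y) (B y)).
Proof.
move=> oU ab sA sB; pose d y := kep (A y) (B y).
have c x : U x -> {for x, continuous d}.
  by move=> Ux; apply: kep_cvg; [exact: sm_cont sA Ux | exact: sm_cont sB Ux | exact: ab].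
have dd x v : U x -> is_derive x v d
    (- num ('D_v A x) ('D_v B x) (d x) / den (A x) (B x) (d x)).
  move=> Ux; apply: is_derive_kep; last exact: ab.
  - by apply: derivableP; exact: sm_derivable sA Ux.
  - by apply: derivableP; exact: sm_derivable sB Ux.
elim=> [|n IH]; first by split.
split => //; split => [x v Ux|v]; first by case: (dd x v Ux).
apply: (@Cn_eq _ _ _ _ _ (fun x => (-1) * num ('D_v A x) ('D_v B x) (d x)
    * (den (A x) (B x) (d x))^-1)) => //.
  by move=> x Ux; case: (dd x v Ux) => _ ->; rewrite mulN1r.
have s2 : Cn n U (fun x => 2 * d x) by apply: CnM => //; exact: Cn_cst.
have sc : Cn n U (fun x => cos (2 * d x)) by apply: (Cn_comp1 oU _ (@sm_cos R)).
have ss : Cn n U (fun x => sin (2 * d x)) by apply: (Cn_comp1 oU _ (@sm_sin R)).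
apply: CnM => //.
  apply: CnM => //; first exact: Cn_cst.
  by apply: CnD => //; apply: CnM => //; apply: sm_derive.
apply: (Cn_comp1 (g := fun x => x^-1) oU _ (@sm_inv R)).
  by move=> x Ux /=; rewrite gt_eqF// kep_den_gt0// ab.
apply: CnD => //.
  apply: (@Cn_eq _ _ _ _ _ (fun x => 1 + (-2) * (A x * sin (2 * d x)))) => //.
    by move=> x _; rewrite mulNr.
  apply: CnD => //; first exact: Cn_cst.
  by apply: CnM => //; [exact: Cn_cst | apply: CnM].
by apply: CnM => //; [exact: Cn_cst | apply: CnM].
Qed.

End KeplerSmooth.

(** * Opening the puncture to a slit *)

Section DeriveRules.
Variables (R : realType) (V : normedModType R).
Implicit Types (f g : V -> R) (x v : V).

Lemma is_deriveDf f g x v (f' g' : R) : is_derive x v f f' -> is_derive x v g g' ->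
  is_derive x v (fun y => f y + g y) (f' + g').
Proof. by move=> df dg; exact: is_deriveD. Qed.

Lemma is_deriveBf f g x v (f' g' : R) : is_derive x v f f' -> is_derive x v g g' ->
  is_derive x v (fun y => f y - g y) (f' - g').
Proof. by move=> df dg; exact: is_deriveB. Qed.

Lemma is_deriveNf f x v (f' : R) : is_derive x v f f' ->
  is_derive x v (fun y => - f y) (- f').
Proof. by move=> df; exact: is_deriveN. Qed.

Lemma is_deriveMf f g x v (f' g' : R) : is_derive x v f f' -> is_derive x v g g' ->
  is_derive x v (fun y => f y * g y) (f x * g' + g x * f').
Proof. by move=> df dg; exact: is_deriveM. Qed.

Lemma is_derive_cstf (c : R) x v : is_derive x v (fun=> c) 0.
Proof. exact: is_derive_cst. Qed.

Lemma is_deriveVf f x v (f' : R) : is_derive x v f f' -> f x != 0 ->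
  is_derive x v (fun y => (f y)^-1) (- (f x) ^- 2 * f').
Proof.
move=> [df <-] fx; apply: DeriveDef; first exact: derivableV.
by rewrite deriveV.
Qed.

Lemma is_derive_sqrtf f x v (f' : R) : is_derive x v f f' -> 0 < f x ->
  is_derive x v (fun y => Num.sqrt (f y)) (f' / (2 * Num.sqrt (f x))).
Proof.
move=> df fx; apply: is_derive_eq.
  by apply: is_derive_comp1 df; exact: is_derive1_sqrt.
by rewrite mulrC.
Qed.

Lemma is_derive_compf f x v (f' : R) (g : R -> R) (g' : R) :
  is_derive x v f f' -> is_derive (f x) 1 g g' ->
  is_derive x v (fun y => g (f y)) (g' * f').
Proof. by move=> df dg; exact: is_derive_comp1. Qed.

End DeriveRules.

Section Slit.
Variable R : realType.
Implicit Types (x y t r : R).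

(** From [exp z = (exp (z/2))^2 >= (1 + z/2)^2]. The constant 4 bounds the slope of [flat 1], and
    the factor [1/8] in [slitG] turns it into a derivative of [slitG] that is at least [1/2]. *)
Lemma flatX2_le4 t : flat 'X^2 t <= 4.
Proof.
rewrite /flat; case: ltP => // t0; rewrite hornerXn expRN.
rewrite ler_pdivrMr ?expR_gt0//; set z := t^-1.
have z0 : 0 < z by rewrite invr_gt0.
have -> : z = 2%:R * (z / 2) by field.
rewrite expRM_natl; have := expR_ge1Dx (z / 2).
by set q := expR _ => h; nra.
Qed.

Lemma flatX2_ge0 t : 0 <= flat 'X^2 t.
Proof.
by rewrite /flat; case: ltP => // t0; rewrite hornerXn mulr_ge0 ?expR_ge0// sqr_ge0.
Qed.

Lemma is_derive_flat1 t : is_derive t 1 (flat 1) (flat 'X^2 t).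
Proof.
have := is_derive_flat (1 : {poly R}) t.
by rewrite -polyC1 derivC subr0 polyC1 mulr1.
Qed.

Lemma flat1_mono t t' : t <= t' -> flat 1 t <= flat 1 t' <= flat 1 t + 4 * (t' - t).
Proof.
move=> tt'; have [] := @MVT_segment R (flat 1) (flat 'X^2) t t' tt'.
- by move=> z _; exact: is_derive_flat1.
- by apply: continuous_subspaceT => z; exact: (sm_cont (@sm_flat R 1) (U := setT)).
move=> z _ E; have := flatX2_le4 z; have := flatX2_ge0 z.
set q := flat _ z in E * => q0 q4.
have d0 : 0 <= t' - t by rewrite subr_ge0.
have e1 : 0 <= q * (t' - t) by rewrite mulr_ge0.
have e2 : q * (t' - t) <= 4 * (t' - t) by rewrite ler_wpM2r.
by apply/andP; split; lra.
Qed.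

(* In polar coordinates [rho = x^2 + y^2], [phi] the map
     [X = sqrt (G rho) cos (phi + d)], [Y = rho / sqrt (G rho) sin (phi + d)]
   preserves area when [d + K rho * sin (2 (phi + d)) = 0], [2 K = rho G' / G - 1].
   As [G 0 > 0] it opens the puncture to the slit [|X| <= sqrt (G 0)], [Y = 0]. *)
Definition slitG r : R := r + flat 1 (16^-1 - r) / 8.
Definition slitdG r : R := 1 - flat 'X^2 (16^-1 - r) / 8.
Definition slitK r : R := (r * slitdG r / slitG r - 1) / 2.

Lemma slitG_ge r : r <= slitG r.
Proof. by rewrite lerDl divr_ge0// flat1_ge0. Qed.

Lemma slitG_gt0 r : 0 < r -> 0 < slitG r.
Proof. by move=> r0; exact: lt_le_trans (slitG_ge r). Qed.

Lemma slitG_id r : 16^-1 <= r -> slitG r = r.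
Proof. by move=> h; rewrite /slitG flat_eq0 ?subr_le0// mul0r addr0. Qed.

Lemma slitK_id r : 16^-1 <= r -> slitK r = 0.
Proof.
move=> h; have r0 : r != 0 by rewrite gt_eqF// (lt_le_trans _ h)// invr_gt0.
by rewrite /slitK /slitdG slitG_id// flat_eq0 ?subr_le0// mul0r subr0 mulr1 divff// subrr mul0r.
Qed.

Lemma slitG_lt r r' : r < r' -> slitG r < slitG r'.
Proof.
move=> rr'; have /flat1_mono/andP[] : 16^-1 - r' <= 16^-1 - r by rewrite lerD2l lerN2 ltW.
by rewrite /slitG; lra.
Qed.

(** The square roots of [slitG] and of this ratio are the semi-axes of the ellipse onto which a
    circle is mapped; with both of them increasing, the ellipses are nested. *)
Lemma slitG_ratio_lt r r' : 0 < r -> r < r' -> r ^+ 2 / slitG r < r' ^+ 2 / slitG r'.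
Proof.
move=> r0 rr'; have r0' := lt_trans r0 rr'.
rewrite ltr_pdivrMr ?slitG_gt0// mulrAC ltr_pdivlMr ?slitG_gt0//.
have /flat1_mono/andP[+ _] : 16^-1 - r' <= 16^-1 - r by rewrite lerD2l lerN2 ltW.
have := flat1_ge0 (16^-1 - r); have := flat1_ge0 (16^-1 - r').
rewrite /slitG; set B := flat 1 (_ - r); set B' := flat 1 (_ - r') => h1 h2 h3.
have e1 : 0 < r * r' * (r' - r) by rewrite !mulr_gt0// subr_gt0.
have e2 : r ^+ 2 * B' <= r' ^+ 2 * B by rewrite ler_pM ?sqr_ge0// lerXn2r ?nnegrE ?ltW.
by move: e1 e2; lra.
Qed.

Lemma slitdG_bounds r : 2^-1 <= slitdG r <= 1.
Proof.
have := flatX2_le4 (16^-1 - r); have := flatX2_ge0 (16^-1 - r).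
by rewrite /slitdG; set q := flat _ _; lra.
Qed.

(** [K] is the amplitude in Kepler's equation, and [|K| < 1/2] is the condition under which that
    equation is solved above. *)
Lemma slitK_bound r : 0 < r -> - 2^-1 < slitK r <= 0.
Proof.
move=> r0; have G0 := slitG_gt0 r0; have Gr := slitG_ge r.
have /andP[d1 d2] := slitdG_bounds r.
have h1 : 0 < r * slitdG r / slitG r by rewrite divr_gt0// mulr_gt0//; lra.
have h2 : r * slitdG r / slitG r <= 1 by rewrite ler_pdivrMr// mul1r; nra.
by rewrite /slitK; apply/andP; split; lra.
Qed.

Lemma is_derive_slitG r : is_derive r 1 slitG (slitdG r).
Proof.
have d1 := is_deriveBf (is_derive_cstf (16^-1 : R) r (1 : R)) (is_derive_id r (1 : R)).
have d2 := is_deriveMf (is_derive_compf d1 (is_derive_flat1 (16^-1 - r))) (is_derive_cstf (8^-1 : R) r (1 : R)).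
apply: (is_derive_eq (is_deriveDf (is_derive_id r (1 : R)) d2)).
by rewrite /slitdG /=; ring.
Qed.

Lemma sm_slitG : sm [set: R] slitG.
Proof.
have oT := @openT R; apply: smD => //; first exact: sm_id1.
apply: smM => //; last exact: sm_cst.
apply: (@sm_comp1 _ _ setT (flat 1)) => //; first exact: sm_flat.
by apply: smB => //; [exact: sm_cst | exact: sm_id1].
Qed.

Lemma sm_slitK : sm [set r : R | 0 < r] slitK.
Proof.
have o0 : open [set x : R | 0 < x] by exact: open_gt.
have sG : sm [set r : R | 0 < r] slitG by apply: sm_sub (@subsetT _ _) sm_slitG.
apply: smM => //; last exact: sm_cst.
apply: smB => //; last exact: sm_cst.
apply: smM => //; last first.
  apply: (@sm_comp1 _ _ _ (fun x => x^-1)) (@sm_inv R) _ => //.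
  by move=> r /= r0; rewrite gt_eqF// slitG_gt0.
apply: smM => //; first exact: sm_id1.
apply: smB => //; first exact: sm_cst.
apply: smM => //; last exact: sm_cst.
apply: (@sm_comp1 _ _ setT (flat 'X^2)) => //; first exact: sm_flat.
by apply: smB => //; [exact: sm_cst | exact: sm_id1].
Qed.

Definition rho x y : R := x ^+ 2 + y ^+ 2.
(** The two quotients are [sin (2 phi)] and [cos (2 phi)] for the polar angle [phi], and [slitc],
    [slits] below are [cos (phi + d)] and [sin (phi + d)]. Writing them in [x] and [y] avoids
    choosing a branch of the angle. *)
Definition slitA x y : R := slitK (rho x y) * (2 * x * y / rho x y).
Definition slitB x y : R := slitK (rho x y) * ((x ^+ 2 - y ^+ 2) / rho x y).
Definition slitD x y : R := kep (slitA x y) (slitB x y).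
Definition slitc x y : R :=
  (x * cos (slitD x y) - y * sin (slitD x y)) / Num.sqrt (rho x y).
Definition slits x y : R :=
  (y * cos (slitD x y) + x * sin (slitD x y)) / Num.sqrt (rho x y).
Definition slitX x y : R := Num.sqrt (slitG (rho x y)) * slitc x y.
Definition slitY x y : R := rho x y / Num.sqrt (slitG (rho x y)) * slits x y.

Lemma slitAB x y : 0 < rho x y -> slitA x y ^+ 2 + slitB x y ^+ 2 < 4^-1.
Proof.
move=> r0; have -> : slitA x y ^+ 2 + slitB x y ^+ 2 = slitK (rho x y) ^+ 2.
  rewrite /slitA /slitB; have : rho x y != 0 by rewrite gt_eqF.
  by set K := slitK _; rewrite /rho => h; field.
by have /andP[] := slitK_bound r0; nra.
Qed.

Lemma slit_cs1 x y : 0 < rho x y -> slitc x y ^+ 2 + slits x y ^+ 2 = 1.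
Proof.
move=> r0; have r1 : Num.sqrt (rho x y) != 0 by rewrite gt_eqF// sqrtr_gt0.
have r2 := sqr_sqrtr (ltW r0).
rewrite /slitc /slits; have := cos2Dsin2 (slitD x y).
set c := cos _; set s := sin _ => cs.
rewrite !expr_div_n r2.
have -> : (x * c - y * s) ^+ 2 / rho x y + (y * c + x * s) ^+ 2 / rho x y =
  (x ^+ 2 + y ^+ 2) * (c ^+ 2 + s ^+ 2) / rho x y by field; rewrite gt_eqF.
by rewrite cs mulr1 divff// gt_eqF.
Qed.

Lemma slit_double x y : 0 < rho x y ->
  2 * (slitc x y * slits x y) = 2 * x * y / rho x y * cos (2 * slitD x y)
    + (x ^+ 2 - y ^+ 2) / rho x y * sin (2 * slitD x y) /\
  slitc x y ^+ 2 - slits x y ^+ 2 = (x ^+ 2 - y ^+ 2) / rho x y * cos (2 * slitD x y)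
    - 2 * x * y / rho x y * sin (2 * slitD x y).
Proof.
move=> r0; have r1 : Num.sqrt (rho x y) != 0 by rewrite gt_eqF// sqrtr_gt0.
have r2 := sqr_sqrtr (ltW r0).
have r3 : rho x y != 0 by rewrite gt_eqF.
have -> : 2 * slitD x y = slitD x y + slitD x y by ring.
rewrite cosD sinD /slitc /slits -!expr2.
set c := cos _; set s := sin _; set q := Num.sqrt _ in r1 r2 *.
by rewrite -r2; split; field.
Qed.

(** Kepler's equation seen from the image: [d] is determined by [rho] and the new angle [phi + d],
    so the rotation can be undone. *)
Lemma slitDE x y : 0 < rho x y ->
  slitD x y = - (slitK (rho x y) * (2 * (slitc x y * slits x y))).
Proof.
move=> r0; have [-> _] := slit_double r0.
have := kepP (slitAB r0); rewrite /kepF -/(slitD x y) {1}/slitA {1}/slitB => h.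
by apply/eqP; rewrite -subr_eq0; apply/eqP; rewrite -{}h; ring.
Qed.

Lemma slit_id x y : 16^-1 <= rho x y -> slitX x y = x /\ slitY x y = y.
Proof.
move=> h; have r0 : 0 < rho x y by apply: lt_le_trans h; rewrite invr_gt0.
have q0 : Num.sqrt (rho x y) != 0 by rewrite gt_eqF// sqrtr_gt0.
have d0 : slitD x y = 0 by rewrite slitDE// slitK_id// mul0r oppr0.
rewrite /slitX /slitY /slitc /slits d0 cos0 sin0 slitG_id// !mulr1 !mulr0 subr0 addr0.
split; first by field.
by rewrite -[X in X / _](sqr_sqrtr (ltW r0)); field.
Qed.

Lemma slit_ellipse x y : 0 < rho x y ->
  slitX x y ^+ 2 / slitG (rho x y) + slitY x y ^+ 2 / (rho x y ^+ 2 / slitG (rho x y)) = 1.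
Proof.
move=> r0; have G0 := slitG_gt0 r0; have g2 := sqr_sqrtr (ltW G0).
have g1 : Num.sqrt (slitG (rho x y)) != 0 by rewrite gt_eqF// sqrtr_gt0.
rewrite -(slit_cs1 r0) /slitX /slitY; set q := Num.sqrt _ in g1 g2 *.
rewrite -g2; field; rewrite g1 gt_eqF//.
Qed.

(** Circles go to disjoint nested ellipses, so equal images have equal [rho]. Then the new angles
    agree, hence [d] agrees by [slitDE], and rotating back by [d] recovers the point. *)
Lemma slit_inj x y x' y' : 0 < rho x y -> 0 < rho x' y' ->
  slitX x y = slitX x' y' -> slitY x y = slitY x' y' -> x = x' /\ y = y'.
Proof.
move=> r0 r0' EX EY.
have hlt a b a' b' : 0 < rho a b -> 0 < rho a' b' -> slitX a b = slitX a' b' ->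
    slitY a b = slitY a' b' -> ~ rho a b < rho a' b'.
  move=> p0 p0' eX eY lt.
  have e1 := slit_ellipse p0; have e2 := slit_ellipse p0'.
  rewrite eX eY in e1.
  have g1 : (slitG (rho a' b'))^-1 < (slitG (rho a b))^-1.
    by rewrite ltf_pV2 ?posrE ?slitG_gt0// slitG_lt.
  have g2 : (rho a' b' ^+ 2 / slitG (rho a' b'))^-1 < (rho a b ^+ 2 / slitG (rho a b))^-1.
    by rewrite ltf_pV2 ?posrE ?divr_gt0 ?exprn_gt0 ?slitG_gt0// slitG_ratio_lt.
  move: e1 e2 g1 g2.
  set A := (slitG (rho a b))^-1; set A' := (slitG (rho a' b'))^-1.
  set B := (_ / _)^-1; set B' := (_ / _)^-1.
  set u := slitX _ _; set w := slitY _ _ => e1 e2 g1 g2.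
  have u0 := sqr_ge0 u; have w0 := sqr_ge0 w.
  have k1 : u ^+ 2 * A' <= u ^+ 2 * A by rewrite ler_wpM2l// ltW.
  have k2 : w ^+ 2 * B' <= w ^+ 2 * B by rewrite ler_wpM2l// ltW.
  have k3 : u ^+ 2 * A' = u ^+ 2 * A by lra.
  have k4 : w ^+ 2 * B' = w ^+ 2 * B by lra.
  have z u' p q : p < q -> u' ^+ 2 * p = u' ^+ 2 * q -> u' ^+ 2 = 0 :> R.
    move=> pq E; apply/eqP; apply: contraT => z0.
    by move: (mulfI z0 E) pq => ->; rewrite ltxx.
  by move: e2; rewrite (z _ _ _ g1 k3) (z _ _ _ g2 k4) !mul0r; lra.
have Er : rho x y = rho x' y'.
  by apply/eqP; rewrite eq_le !leNgt; apply/andP; split; apply/negP; exact: hlt.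
have G0 := slitG_gt0 r0.
have g1 : Num.sqrt (slitG (rho x y)) != 0 by rewrite gt_eqF// sqrtr_gt0.
have Ec : slitc x y = slitc x' y'.
  by move: EX; rewrite /slitX -Er => /(mulfI g1).
have Es : slits x y = slits x' y'.
  by move: EY; rewrite /slitY -Er => /mulfI; apply; rewrite mulf_neq0 ?invr_eq0// gt_eqF.
have Ed : slitD x y = slitD x' y' by rewrite !slitDE// Ec Es Er.
have q1 : Num.sqrt (rho x y) != 0 by rewrite gt_eqF// sqrtr_gt0.
move: Ec Es; rewrite /slitc /slits -Ed -Er => /(divIf q1) e1 /(divIf q1) e2.
have := cos2Dsin2 (slitD x y); move: e1 e2; set c := cos _; set s := sin _ => e1 e2 cs.
have -> : x = (c ^+ 2 + s ^+ 2) * x by rewrite cs mul1r.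
have -> : y = (c ^+ 2 + s ^+ 2) * y by rewrite cs mul1r.
split.
  have -> : (c ^+ 2 + s ^+ 2) * x = c * (x * c - y * s) + s * (y * c + x * s) by ring.
  by rewrite e1 e2 -[RHS]mul1r -cs; ring.
have -> : (c ^+ 2 + s ^+ 2) * y = c * (y * c + x * s) - s * (x * c - y * s) by ring.
by rewrite e1 e2 -[RHS]mul1r -cs; ring.
Qed.

Lemma slitX_sqr_le x y : 0 < rho x y -> slitX x y ^+ 2 <= slitG (rho x y).
Proof.
move=> r0; have := slit_cs1 r0; have := sqr_ge0 (slits x y).
have -> : slitX x y ^+ 2 = slitG (rho x y) * slitc x y ^+ 2.
  by rewrite /slitX exprMn sqr_sqrtr// ltW// slitG_gt0.
by have := slitG_gt0 r0; set g := slitG _; nra.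
Qed.

Lemma slitY_sqr_le x y : 0 < rho x y -> slitY x y ^+ 2 <= rho x y.
Proof.
move=> r0; have := slit_cs1 r0; have := sqr_ge0 (slitc x y).
have G0 := slitG_gt0 r0.
have -> : slitY x y ^+ 2 = rho x y ^+ 2 / slitG (rho x y) * slits x y ^+ 2.
  by rewrite /slitY exprMn expr_div_n sqr_sqrtr// ltW.
move=> h1 h2.
have h3 : rho x y ^+ 2 / slitG (rho x y) <= rho x y.
  by rewrite ler_pdivrMr// expr2 ler_pM2l// slitG_ge.
have h4 : 0 <= rho x y ^+ 2 / slitG (rho x y) by rewrite divr_ge0 ?sqr_ge0// ltW.
by nra.
Qed.

Lemma slit_avoid x y : 0 < rho x y -> slitY x y = 0 -> slitG 0 < slitX x y ^+ 2.
Proof.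
move=> r0 E; have G0 := slitG_gt0 r0.
have g1 : Num.sqrt (slitG (rho x y)) != 0 by rewrite gt_eqF// sqrtr_gt0.
have s0 : slits x y = 0.
  apply/eqP; move/eqP: E; rewrite /slitY mulf_eq0 => /orP[|//].
  by rewrite mulf_eq0 invr_eq0 (negbTE g1) gt_eqF.
have := slit_cs1 r0; rewrite s0 expr0n addr0 => c1.
by rewrite /slitX exprMn c1 mulr1 sqr_sqrtr ?ltW// slitG_lt.
Qed.

End Slit.

Section SlitCalculus.
Variables (R : realType) (V : normedModType R).
Implicit Types (f g : V -> R) (U : set V).

Lemma sm_quotient U f g : open U -> sm U f -> sm U g ->
  (forall p, U p -> g p != 0) -> sm U (fun p => f p / g p).
Proof.
move=> oU sf sg g0; apply: smM => //.
by apply: (@sm_comp1 _ _ _ (fun x => x^-1)) (@sm_inv R) _.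
Qed.

Lemma sm_sqrtf U f : open U -> sm U f -> (forall p, U p -> 0 < f p) ->
  sm U (fun p => Num.sqrt (f p)).
Proof. by move=> oU sf f0; apply: (@sm_comp1 _ _ _ Num.sqrt) (@sm_sqrt R) _. Qed.

Lemma sm_cosf U f : open U -> sm U f -> sm U (fun p => cos (f p)).
Proof. by move=> oU sf; apply: (sm_comp1 oU _ (@sm_cos R)). Qed.

Lemma sm_sinf U f : open U -> sm U f -> sm U (fun p => sin (f p)).
Proof. by move=> oU sf; apply: (sm_comp1 oU _ (@sm_sin R)). Qed.

Section OnU.
Variables (U : set V) (f g : V -> R).
Hypotheses (oU : open U) (sf : sm U f) (sg : sm U g).
Hypothesis pos : forall p, U p -> 0 < rho (f p) (g p).

Lemma sm_rho : sm U (fun p => rho (f p) (g p)).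
Proof. by apply: smD => //; exact: smX. Qed.

Lemma sm_slitD : sm U (fun p => slitD (f p) (g p)).
Proof.
have sr := sm_rho.
have sK : sm U (fun p => slitK (rho (f p) (g p))).
  by apply: (@sm_comp1 _ _ _ (@slitK R)) (@sm_slitK R) _.
have rn p : U p -> rho (f p) (g p) != 0 by move=> Up; rewrite gt_eqF// pos.
apply: sm_kep => //.
- by move=> p Up; apply: slitAB; exact: pos.
- apply: smM => //; apply: sm_quotient => //.
  by apply: smM => //; apply: smM => //; exact: sm_cst.
- apply: smM => //; apply: sm_quotient => //.
  by apply: smB => //; exact: smX.
Qed.

Lemma sm_slitX : sm U (fun p => slitX (f p) (g p)).
Proof.
have sd := sm_slitD; have sr := sm_rho.
have sG : sm U (fun p => slitG (rho (f p) (g p))).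
  by apply: (@sm_comp1 _ _ setT (@slitG R)) => //; exact: sm_slitG.
apply: smM => //.
  by apply: sm_sqrtf => // p Up; apply: slitG_gt0; exact: pos.
apply: sm_quotient => //; last first.
- by move=> p Up; rewrite gt_eqF// sqrtr_gt0 pos.
- exact: sm_sqrtf.
- by apply: smB => //; apply: smM => //; [exact: sm_cosf | exact: sm_sinf].
Qed.

Lemma sm_slitY : sm U (fun p => slitY (f p) (g p)).
Proof.
have sd := sm_slitD; have sr := sm_rho.
have sG : sm U (fun p => slitG (rho (f p) (g p))).
  by apply: (@sm_comp1 _ _ setT (@slitG R)) => //; exact: sm_slitG.
apply: smM => //.
  apply: sm_quotient => //.
    by apply: sm_sqrtf => // p Up; apply: slitG_gt0; exact: pos.
  by move=> p Up; rewrite gt_eqF// sqrtr_gt0 slitG_gt0// pos.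
apply: sm_quotient => //; last first.
- by move=> p Up; rewrite gt_eqF// sqrtr_gt0 pos.
- exact: sm_sqrtf.
- by apply: smD => //; apply: smM => //; [exact: sm_cosf | exact: sm_sinf].
Qed.

End OnU.

(* [T / rho] is the differential of the polar angle and [N] half that of [rho]. *)
Lemma is_derive_slit f g (p v : V) (f' g' : R) :
  is_derive p v f f' -> is_derive p v g g' -> 0 < rho (f p) (g p) ->
  let x := f p in let y := g p in let r := rho x y in
  let N := x * f' + y * g' in let T := x * g' - y * f' in
  let c := slitc x y in let s := slits x y in
  let q := Num.sqrt (slitG r) in
  let th := (T / r - 2 * 'D_1 (@slitK R) r * N * (2 * (c * s))) / (1 + 2 * slitK r * (c ^+ 2 - s ^+ 2)) in
  [/\ 0 < 1 + 2 * slitK r * (c ^+ 2 - s ^+ 2),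
    is_derive p v (fun p => slitX (f p) (g p)) (slitdG r * N / q * c - q * s * th) &
    is_derive p v (fun p => slitY (f p) (g p))
      ((2 * N / q - r * slitdG r * N / (slitG r * q)) * s + r / q * c * th)].
Proof.
move=> df dg r0 x y r N T c s q th.
have rn0 : r != 0 by rewrite gt_eqF.
have G0 := slitG_gt0 r0.
have q0 : q != 0 by rewrite gt_eqF// sqrtr_gt0.
have q2 : q ^+ 2 = slitG r by rewrite sqr_sqrtr// ltW.
have w0 : Num.sqrt r != 0 by rewrite gt_eqF// sqrtr_gt0.
have w2 : Num.sqrt r ^+ 2 = r by rewrite sqr_sqrtr// ltW.
have [e1 e2] := slit_double r0.
rewrite -/x -/y -/c -/s -/r in e1 e2.
have den0 : 0 < 1 + 2 * slitK r * (c ^+ 2 - s ^+ 2).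
  have := kep_den_gt0 (slitD x y) (slitAB r0); rewrite /slitA /slitB.
  rewrite -/r e2; set C := cos _; set S := sin _.
  suff -> : 1 - 2 * (slitK r * (2 * x * y / r) * S) +
    2 * (slitK r * ((x ^+ 2 - y ^+ 2) / r) * C) =
    1 + 2 * slitK r * ((x ^+ 2 - y ^+ 2) / r * C - 2 * x * y / r * S) by [].
  by ring.
have dr : is_derive p v (fun p => rho (f p) (g p)) (2 * N).
  apply: (is_derive_eq (is_deriveDf (is_deriveMf df df) (is_deriveMf dg dg))).
  by rewrite -/x -/y /N; ring.
have dK : is_derive p v (fun p => slitK (rho (f p) (g p))) ('D_1 (@slitK R) r * (2 * N)).
  apply: (is_derive_compf dr); apply: derivableP.
  by apply: sm_derivable (@sm_slitK R) _.
have dc0 (k : R) := is_derive_cstf k p v.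
have rV := is_deriveVf dr rn0.
have dS2 : is_derive p v (fun p => 2 * f p * g p / rho (f p) (g p))
    (2 * ((x ^+ 2 - y ^+ 2) / r) * (T / r)).
  apply: (is_derive_eq (is_deriveMf (is_deriveMf (is_deriveMf (dc0 2) df) dg) rV)).
  rewrite -/x -/y -/r /N /T; have rE : x ^+ 2 + y ^+ 2 = r by [].
  by rewrite -rE in rn0 *; field.
have dC2 : is_derive p v (fun p => (f p ^+ 2 - g p ^+ 2) / rho (f p) (g p))
    (- 2 * (2 * x * y / r) * (T / r)).
  apply: (is_derive_eq (is_deriveMf (is_deriveBf (is_deriveMf df df) (is_deriveMf dg dg)) rV)).
  rewrite -/x -/y -/r /N /T; have rE : x ^+ 2 + y ^+ 2 = r by [].
  by rewrite -rE in rn0 *; field.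
have dA := is_deriveMf dK dS2.
have dB := is_deriveMf dK dC2.
have := is_derive_kep dA dB (slitAB r0).
rewrite -/(slitA x y) -/(slitB x y) -/(slitD x y) -/r -/x -/y.
set dl := slitD x y.
set dd := (X in is_derive _ _ _ X) => dD.
(* [th] is the differential of [phi + d], obtained by differentiating
   [d + K(rho) sin (2 (phi + d)) = 0]; its denominator is [1 + 2 K cos (2 (phi + d))]. *)
have ddE : T / r + dd = th.
  rewrite /dd /th.
  have -> : 1 - 2 * (slitA x y * sin (2 * dl)) + 2 * (slitB x y * cos (2 * dl)) =
    1 + 2 * slitK r * (c ^+ 2 - s ^+ 2).
    by rewrite /slitA /slitB -/r e2 -/dl; ring.
  have dn : 1 + 2 * slitK r * (c ^+ 2 - s ^+ 2) != 0 by rewrite gt_eqF.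
  apply: (mulIf dn); rewrite [RHS]divfK// mulrDl divfK//.
  rewrite e1 e2 -/dl; set C := cos _; set S := sin _.
  by rewrite -/r; field.
have dcos := is_derive_compf dD (is_derive_cos dl).
have dsin := is_derive_compf dD (is_derive_sin dl).
have dw := is_deriveVf (is_derive_sqrtf dr r0) w0.
have dcc : is_derive p v (fun p => slitc (f p) (g p)) (- s * th).
  apply: (is_derive_eq (is_deriveMf (is_deriveBf (is_deriveMf df dcos) (is_deriveMf dg dsin)) dw)).
  rewrite -ddE /s /slits -/dl -/x -/y -/r; set C := cos _; set S := sin _.
  set w := Num.sqrt r in w0 w2 *; rewrite /N /T.
  have key : w ^+ 2 * (C * f' - S * g') =
      (x * C - y * S) * (x * f' + y * g') - (y * C + x * S) * (x * g' - y * f').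
    by rewrite w2 /r /rho; ring.
  rewrite -w2; transitivity ((w ^+ 2 * (C * f' - S * g') -
    (x * C - y * S) * (x * f' + y * g')) / w ^+ 3 - (y * C + x * S) / w * dd).
    by field.
  by rewrite key; field.
have dss : is_derive p v (fun p => slits (f p) (g p)) (c * th).
  apply: (is_derive_eq (is_deriveMf (is_deriveDf (is_deriveMf dg dcos) (is_deriveMf df dsin)) dw)).
  rewrite -ddE /c /slitc -/dl -/x -/y -/r; set C := cos _; set S := sin _.
  set w := Num.sqrt r in w0 w2 *; rewrite /N /T.
  have key : w ^+ 2 * (C * g' + S * f') =
      (y * C + x * S) * (x * f' + y * g') + (x * C - y * S) * (x * g' - y * f').
    by rewrite w2 /r /rho; ring.
  rewrite -w2; transitivity ((w ^+ 2 * (C * g' + S * f') -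
    (y * C + x * S) * (x * f' + y * g')) / w ^+ 3 + (x * C - y * S) / w * dd).
    by field.
  by rewrite key; field.
have dG := is_derive_compf dr (is_derive_slitG r).
have dq := is_derive_sqrtf dG G0.
split => //.
  apply: (is_derive_eq (is_deriveMf dq dcc)).
  by rewrite -/x -/y -/r -/q -/c -/s; field.
apply: (is_derive_eq (is_deriveMf (is_deriveMf dr (is_deriveVf dq q0)) dss)).
by rewrite -/x -/y -/r -/q -/c -/s -q2; field.
Qed.

End SlitCalculus.

Section SmoothTactic.
Variables (R : realType) (V : normedModType R).

Lemma smVf (U : set V) (f : V -> R) : open U -> sm U f ->
  (forall p, U p -> f p != 0) -> sm U (fun p => (f p)^-1).
Proof.
by move=> oU sf f0; apply: (@sm_comp1 _ _ _ (fun x => x^-1)) (@sm_inv R) _.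
Qed.

Lemma sm_compT (U : set V) (g : R -> R) (f : V -> R) : open U -> sm [set: R] g ->
  sm U f -> sm U (fun p => g (f p)).
Proof. by move=> oU sg sf; apply: (sm_comp1 oU _ sg). Qed.

End SmoothTactic.

Ltac smooth_tac := repeat
  lazymatch goal with
  | H : sm ?U ?f |- sm ?U ?f => exact H
  | |- open _ => assumption
  | |- sm _ (fun p => (@?f p + @?g p)%R) => refine (smD (f := f) (g := g) _ _ _)
  | |- sm _ (fun p => (- @?f p)%R) => refine (smN (f := f) _ _)
  | |- sm _ (fun p => (@?f p * @?g p)%R) => refine (smM (f := f) (g := g) _ _ _)
  | |- sm _ (fun p => (@?f p)^-1%R) => first [exact: sm_cst | refine (smVf (f := f) _ _ _)]
  | |- sm _ (fun p => (@?f p ^+ _)%R) => refine (smX (f := f) _ _ _)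
  | |- sm _ (fun p => Num.sqrt (@?f p)) => first [exact: sm_cst | refine (sm_sqrtf (f := f) _ _ _)]
  | |- sm _ (fun p => cos (@?f p)) => refine (sm_cosf (f := f) _ _)
  | |- sm _ (fun p => sin (@?f p)) => refine (sm_sinf (f := f) _ _)
  | |- sm _ (fun p => ramp (@?f p)) => refine (sm_compT (f := f) _ (@sm_ramp _) _)
  | |- sm _ (fun p => dramp (@?f p)) => refine (sm_compT (f := f) _ (@sm_dramp _) _)
  | |- sm _ (fun p => bstep (@?f p)) => refine (sm_compT (f := f) _ (@sm_bstep _) _)
  | |- sm _ _ => exact: sm_cst
  end.

(** * Profile functions *)

Section Profiles.
Variable R : realType.
Implicit Types (e t X Q I : R).

(* [e] is the area of the torus. [P0] maps the cell [|X| <= 1/2] onto a full turn, with slope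
   [lam] off the slit; where its slope [dP0] is at least [slope_lb] the conjugate variable
   [Q0 = e (Y +- 1/2) / dP0] is at most [Clay * e]. [Qa] is where the band leaves the ring, [2 q0] the
   period in [Q] of the band, [I0] the action of the ring, [Lu] the width of the fibre,
   [ac] the admissible slope of the lift [chi], which is supported in [[Ib, It]]. *)
Definition slit_end : R := Num.sqrt (slitG 0).
Definition slope_lb : R := expR (-1) ^+ 2.
Definition Clay : R := slope_lb^-1 + 2 + 4 * pi / slit_end.
Definition good e := [/\ 0 < e, 4 * e < slit_end & (Clay + 2) * e < 1].

Definition rampe e t : R := e * ramp (t / e).
Definition drampe e t : R := dramp (t / e).
Definition Tt e : R := 2 * slit_end - e.
Definition TT e : R := rampe e (Tt e).
(** A smoothed clamp of [X + slit_end] to [[0, TT e]]. [Tt e] falls short of the slit length by [e],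
    the largest loss of the inner [rampe], so that the upper plateau is reached by the end of the
    slit. [m1] and [m2] are built in the same way. *)
Definition tau e X : R := TT e - rampe e (Tt e - rampe e (X + slit_end)).
Definition dtau e X : R := drampe e (Tt e - rampe e (X + slit_end)) * drampe e (X + slit_end).
(** The margin below [pi] consists of the angular half-width [Clay * e] of the legs, of [e] for the
    width of the drop at angle [pi], and of a spare [e]. *)
Definition ac e : R := pi - (Clay + 2) * e.
Definition Lu e : R := pi * (1 + e) / 2.
(** The length on which slope [ac e] climbs to height [Lu e], plus [e] for the loss in [rampe]; thus
    the plateau value [ac e * mx e] of [chi] is at least [Lu e]. *)
Definition Tp e : R := Lu e / ac e + e.
Definition mx e : R := rampe e (Tp e).
(** The offsets are matched: [It e = I0 e + Qa e - e] and [Ib e = I0 e - Qa e + e], so [chi]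
    vanishes on the last [e] of each leg, where ring and band have to agree. [q0 e] leaves a width
    [2 * e] in which [kf] turns, and the [4 * e] in [I0 e] keeps the dropped band at positive
    action. *)
Definition Qa e : R := Tp e + (Clay + 2) * e.
Definition q0 e : R := Qa e + e.
Definition I0 e : R := Qa e + 4 * e.
Definition Ib e : R := I0 e - (Clay + 1) * e - Tp e.
Definition It e : R := I0 e + (Clay + 1) * e + Tp e.
(** Where the slope of [P0] is [lam e], a unit step in [Y] changes [Q] by [e / lam e], which is the
    period [2 * q0 e]. [Mm e] is then fixed by a total increase [2 pi] of [P0] over the cell. *)
Definition lam e : R := e / (2 * q0 e).
Definition Mm e : R := (2 * pi - lam e) / TT e.
Definition P0 e X : R := lam e * (X + 2^-1) + Mm e * tau e X.
Definition dP0 e X : R := lam e + Mm e * dtau e X.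
Definition kf e Q : R := 2 * pi * bstep ((Q - Qa e) / (2 * e)).
Definition hf e t : R := 2 * q0 e * bstep ((t - pi + e) / (2 * e)).
Definition m1 e I : R := mx e - rampe e (Tp e - rampe e (I - Ib e)).
Definition m2 e I : R := mx e - rampe e (Tp e - rampe e (It e - I)).
Definition chi e I : R := ac e * (m1 e I + m2 e I - mx e).
Definition dm1 e I : R := drampe e (Tp e - rampe e (I - Ib e)) * drampe e (I - Ib e).
Definition dm2 e I : R := drampe e (Tp e - rampe e (It e - I)) * drampe e (It e - I).
Definition dchi e I : R := ac e * (dm1 e I - dm2 e I).

Lemma slit_end_gt0 : 0 < slit_end.
Proof.
by rewrite sqrtr_gt0 /slitG add0r subr0 divr_gt0// flat1_gt0// invr_gt0.
Qed.

Lemma slit_end_sqr : slit_end ^+ 2 = slitG 0.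
Proof.
by rewrite sqr_sqrtr// /slitG add0r divr_ge0// flat1_ge0.
Qed.

Lemma slit_end_lt : slit_end < 2^-1.
Proof.
have h := slit_end_gt0; have := slit_end_sqr; rewrite /slitG add0r subr0.
have : flat 1 (16^-1 : R) <= 1.
  by rewrite /flat; case: ltP => // _; rewrite hornerC mul1r -expR0 ler_expR oppr_le0 invr_ge0.
by nra.
Qed.

Lemma slope_lb_gt0 : 0 < slope_lb. Proof. by rewrite exprn_gt0// expR_gt0. Qed.

Lemma Clay_gt2 : 2 < Clay.
Proof.
rewrite /Clay; have := slope_lb_gt0; rewrite -invr_gt0.
have : 0 < 4 * pi / slit_end by rewrite divr_gt0 ?mulr_gt0 ?pi_gt0 ?slit_end_gt0.
by lra.
Qed.

Section Good.
Variable e : R.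
Hypothesis ge : good e.

Lemma e_gt0 : 0 < e. Proof. by case: ge. Qed.
Lemma e_neq0 : e != 0. Proof. by rewrite gt_eqF// e_gt0. Qed.

Lemma e_lt4 : e < 4^-1.
Proof. by case: ge => e0 _ h; have := Clay_gt2; nra. Qed.

Lemma Clay_e : Clay * e < 1 - 2 * e.
Proof. by case: ge => e0 _ h; lra. Qed.

Lemma ac_gt1 : 1 < ac e.
Proof. by case: ge => e0 _ h; rewrite /ac; have := pi_ge2 R; lra. Qed.

Lemma ac_lt : ac e < pi.
Proof. by case: ge => e0 _ h; rewrite /ac; have := Clay_gt2; nra. Qed.

Lemma TpE : ac e * (Tp e - e) = Lu e.
Proof. by rewrite /Tp addrK mulrC divfK// gt_eqF//; have := ac_gt1; lra. Qed.

Lemma Tp_gt : 2^-1 < Tp e.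
Proof.
have := TpE; have := ac_gt1; have := ac_lt; have := e_gt0; have := pi_gt0 R.
by rewrite /Lu; nra.
Qed.

Lemma Tp_le : Tp e <= 2^-1 + (2 * (Clay + 2) + 1) * e.
Proof.
have h := TpE; have a1 := ac_gt1; have e0 := e_gt0; have p2 := pi_ge2 R.
have := Clay_gt2; have [_ _ he] := ge; move: h; rewrite /Lu /ac in a1 *.
set d := (Clay + 2) * e in he a1 * => h C2; have de : 4 * e < d by rewrite /d; nra.
rewrite mulrDl -mulrA -/d mul1r addrA -lerBlDr.
suff : (pi - d) * (Tp e - e) <= (pi - d) * (2^-1 + 2 * d) by rewrite ler_pM2l//; lra.
by rewrite h; nra.
Qed.

Lemma Qa_gt : 2^-1 < Qa e.
Proof. by rewrite /Qa; have := Tp_gt; have := Clay_gt2; have := e_gt0; nra. Qed.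

Lemma lam_gt0 : 0 < lam e.
Proof. by rewrite /lam divr_gt0 ?e_gt0// mulr_gt0// /q0; have := Qa_gt; have := e_gt0; lra. Qed.

Lemma lam_le : lam e <= e.
Proof.
rewrite /lam ler_pdivrMr; last by rewrite mulr_gt0// /q0; have := Qa_gt; have := e_gt0; lra.
by rewrite ler_peMr// ?(ltW e_gt0)// /q0; have := Qa_gt; have := e_gt0; lra.
Qed.

Lemma Tt_gt : slit_end < Tt e.
Proof. by case: ge => e0 h _; rewrite /Tt; have := slit_end_gt0; lra. Qed.

Lemma rampe_eq0 t : t <= 0 -> rampe e t = 0.
Proof. by move=> h; rewrite /rampe ramp_eq0 ?mulr0// pmulr_lle0 ?invr_gt0 ?e_gt0. Qed.

Lemma drampe_eq0 t : t <= 0 -> drampe e t = 0.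
Proof. by move=> h; rewrite /drampe dramp_eq0// pmulr_lle0 ?invr_gt0 ?e_gt0. Qed.

Lemma rampe_ge0 t : 0 <= rampe e t.
Proof. by rewrite mulr_ge0 ?ramp_ge0// ltW// e_gt0. Qed.

Lemma rampe_le t : 0 <= t -> rampe e t <= t.
Proof.
move=> t0; rewrite /rampe mulrC -ler_pdivlMr ?e_gt0// ramp_le// divr_ge0//.
by rewrite ltW// e_gt0.
Qed.

Lemma rampe_ge t : t - e <= rampe e t.
Proof.
rewrite /rampe mulrC -ler_pdivrMr ?e_gt0// mulrBl divff ?e_neq0//.
exact: ramp_ge.
Qed.

Lemma drampe01 t : 0 <= drampe e t <= 1.
Proof. by rewrite dramp_ge0 dramp_le1. Qed.

Lemma drampe_lb t : e <= t -> expR (-1) <= drampe e t.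
Proof. by move=> h; apply: dramp_lb; rewrite ler_pdivlMr ?e_gt0// mul1r. Qed.

Lemma is_derive_rampe t : is_derive t 1 (rampe e) (drampe e t).
Proof.
have d1 := is_deriveMf (is_derive_id t (1 : R)) (is_derive_cstf (e^-1 : R) t (1 : R)).
have d2 := is_deriveMf (is_derive_cstf (e : R) t (1 : R)) (is_derive_compf d1 (is_derive_ramp (t / e))).
by apply: (is_derive_eq d2); rewrite /drampe /=; field; exact: e_neq0.
Qed.

Lemma rampe_mono t t' : t <= t' -> 0 <= rampe e t' - rampe e t <= t' - t.
Proof.
move=> tt'; have [] := @MVT_segment R (rampe e) (drampe e) t t' tt'.
- by move=> z _; exact: is_derive_rampe.
- apply: continuous_subspaceT => z; apply/differentiable_continuous/derivable1_diffP.
  by case: (is_derive_rampe z).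
move=> z _ ->; have /andP[z0 z1] := drampe01 z.
have d0 : 0 <= t' - t by rewrite subr_ge0.
by rewrite mulr_ge0//= ler_piMl.
Qed.

Lemma TT_bounds : slit_end < TT e < 1.
Proof.
have h := rampe_ge (Tt e); have h' := @rampe_le (Tt e); have h1 := Tt_gt.
case: ge => e0 h2 _; have h3 := slit_end_gt0; have h4 := slit_end_lt; rewrite /TT.
move: h h' h1; rewrite /Tt => h h' h1; apply/andP; split; first lra.
by apply: le_lt_trans (h' _) _; lra.
Qed.

Lemma MmE : lam e + Mm e * TT e = 2 * pi.
Proof.
by rewrite /Mm divfK ?gt_eqF//; [ring | have := TT_bounds; have := slit_end_gt0; lra].
Qed.

Lemma Mm_gt1 : 1 < Mm e.
Proof.
have := MmE; have /andP[] := TT_bounds; have := slit_end_gt0; have := lam_le.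
by have := e_lt4; have := pi_ge2 R; nra.
Qed.

Lemma Mm_le : Mm e <= 2 * pi / slit_end.
Proof.
rewrite ler_pdivlMr ?slit_end_gt0//; have := MmE; have := Mm_gt1.
by have /andP[] := TT_bounds; have := lam_gt0; nra.
Qed.

Lemma is_derive_tau X : is_derive X 1 (tau e) (dtau e X).
Proof.
have d0 := is_derive_cstf (Tt e) X (1 : R).
have d0' := is_derive_cstf (TT e) X (1 : R).
have d1 := is_deriveDf (is_derive_id X (1 : R)) (is_derive_cstf slit_end X (1 : R)).
have d2 := is_derive_compf d1 (is_derive_rampe (X + slit_end)).
have d3 := is_derive_compf (is_deriveBf d0 d2) (is_derive_rampe _).
by apply: (is_derive_eq (is_deriveBf d0' d3)); rewrite /dtau /=; ring.
Qed.

Lemma is_derive_P0 X : is_derive X 1 (P0 e) (dP0 e X).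
Proof.
have d1 := is_deriveDf (is_derive_id X (1 : R)) (is_derive_cstf 2^-1 X (1 : R)).
have d2 := is_deriveMf (is_derive_cstf (lam e) X (1 : R)) d1.
have d3 := is_deriveMf (is_derive_cstf (Mm e) X (1 : R)) (is_derive_tau X).
by apply: (is_derive_eq (is_deriveDf d2 d3)); rewrite /dP0 /=; ring.
Qed.

Lemma is_derive_chi I : is_derive I 1 (chi e) (dchi e I).
Proof.
have c k := is_derive_cstf k I (1 : R).
have a1 := is_derive_compf (is_deriveBf (is_derive_id I (1 : R)) (c (Ib e))) (is_derive_rampe _).
have a2 := is_deriveBf (c (mx e)) (is_derive_compf (is_deriveBf (c (Tp e)) a1) (is_derive_rampe _)).
have b1 := is_derive_compf (is_deriveBf (c (It e)) (is_derive_id I (1 : R))) (is_derive_rampe _).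
have b2 := is_deriveBf (c (mx e)) (is_derive_compf (is_deriveBf (c (Tp e)) b1) (is_derive_rampe _)).
apply: (is_derive_eq (is_deriveMf (c (ac e)) (is_deriveBf (is_deriveDf a2 b2) (c (mx e))))).
by rewrite /dchi /dm1 /dm2 /=; ring.
Qed.

Lemma dtau_ge0 X : 0 <= dtau e X.
Proof. by rewrite mulr_ge0//; case/andP: (drampe01 (X + slit_end)); case/andP: (drampe01 (Tt e - rampe e (X + slit_end))). Qed.

Lemma dP0_gt0 X : 0 < dP0 e X.
Proof.
by rewrite ltr_pwDl ?lam_gt0// mulr_ge0 ?dtau_ge0//; have := Mm_gt1; lra.
Qed.

Lemma tau_left X : X <= - slit_end -> tau e X = 0 /\ dtau e X = 0.
Proof.
move=> h; have h0 : X + slit_end <= 0 by lra.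
by rewrite /tau /dtau (rampe_eq0 h0) (drampe_eq0 h0) mulr0 subr0 subrr.
Qed.

Lemma tau_right X : slit_end <= X -> tau e X = TT e /\ dtau e X = 0.
Proof.
move=> h; have h0 : Tt e - rampe e (X + slit_end) <= 0.
  by have := rampe_ge (X + slit_end); rewrite /Tt; lra.
by rewrite /tau /dtau (rampe_eq0 h0) (drampe_eq0 h0) mul0r subr0.
Qed.

Lemma tau_bounds X : 0 <= tau e X <= TT e.
Proof.
have f0 := rampe_ge0 (X + slit_end).
have /rampe_mono/andP[h _] : Tt e - rampe e (X + slit_end) <= Tt e by lra.
by rewrite /tau h /= gerBl rampe_ge0.
Qed.

(** [P0] recentred so as to be near 0 at both vertical edges of the cell. The jump at [X = 0] lies
    in the steep zone, away from the band ([Phat_small]). *)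
Definition Phat X : R := if X < 0 then P0 e X else P0 e X - 2 * pi.

(** The source of the thin crossing pieces: in the steep zone [Q0] will be [O(e)], and elsewhere [P]
    has hardly left its end value, which gives the narrow legs and band. The slope is small only
    while [tau] is within [2 * e] of 0 or within [e] of [TT e]. *)
Lemma layer_dichotomy X : -(3 / 4) <= X <= 3 / 4 ->
  slope_lb <= dtau e X \/ `|Phat X| <= Clay * e.
Proof.
move=> /andP[X1 X2]; have e0 := e_gt0; have [_ es _] := ge.
have s0 := slit_end_gt0; have t0 := rampe_ge0 (X + slit_end).
have l0 := lam_gt0; have ll := lam_le; have M1 := Mm_gt1; have M2 := Mm_le.
have k0 := slope_lb_gt0.
have CE : Clay * e = slope_lb^-1 * e + 2 * e + 2 * (2 * pi / slit_end) * e.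
  by rewrite /Clay; field; rewrite gt_eqF// gt_eqF.
have k1 : 0 < slope_lb^-1 * e by rewrite mulr_gt0// invr_gt0.
have /andP[tb1 tb2] := tau_bounds X.
have lb t t' : e <= t -> e <= t' -> slope_lb <= drampe e t * drampe e t'.
  move=> /drampe_lb h /drampe_lb h'; rewrite /slope_lb expr2.
  by rewrite ler_pM// ?expR_ge0.
have pe : Mm e * e <= 2 * pi / slit_end * e by rewrite ler_pM2r.
rewrite /Phat; case: ltP => X0.
  have [h|h] := ltP (X + slit_end) e; last first.
    left; apply: lb => //.
    have := @rampe_le (X + slit_end); rewrite /Tt; lra.
  right.
  have f1 : rampe e (X + slit_end) <= e.
    by have [z|z] := leP 0 (X + slit_end); [have := rampe_le z; lra | rewrite rampe_eq0; lra].
  have t2 : tau e X <= 2 * e.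
    have := rampe_ge (Tt e - rampe e (X + slit_end)); have := @rampe_le (Tt e).
    by have := Tt_gt; rewrite /tau /TT; lra.
  have p1 : 0 <= Mm e * tau e X by rewrite mulr_ge0//; lra.
  have p2 : Mm e * tau e X <= 2 * (Mm e * e) by nra.
  by rewrite ler_norml /P0; apply/andP; split; nra.
have [h|h] := ltP (Tt e - rampe e (X + slit_end)) e; last first.
  by left; apply: lb => //; lra.
right.
have -> : P0 e X - 2 * pi = lam e * (X - 2^-1) - Mm e * (TT e - tau e X).
  by rewrite -MmE /P0; field.
have t2 : TT e - tau e X <= e.
  rewrite /tau subKr.
  by have [z|z] := leP 0 (Tt e - rampe e (X + slit_end)); [have := rampe_le z; lra | rewrite rampe_eq0; lra].
have p1 : 0 <= Mm e * (TT e - tau e X) by rewrite mulr_ge0//; lra.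
have p2 : Mm e * (TT e - tau e X) <= Mm e * e by rewrite ler_pM2l//; lra.
by rewrite ler_norml; apply/andP; split; nra.
Qed.

End Good.
End Profiles.

Section ProfileBounds.
Variables (R : realType) (e : R).
Hypothesis ge : good e.
Implicit Types (t X Q I : R).

Let e0 : 0 < e := e_gt0 ge.
Let C2 : 2 < Clay R := @Clay_gt2 R.

Let Ce : 0 < Clay R * e.
Proof. by rewrite mulr_gt0//; move: C2; lra. Qed.

Lemma m1_max I : Ib e + Tp e + e <= I -> m1 e I = mx e /\ dm1 e I = 0.
Proof.
move=> h; have h0 : Tp e - rampe e (I - Ib e) <= 0.
  by have := rampe_ge ge (I - Ib e); lra.
by rewrite /m1 /dm1 (rampe_eq0 ge h0) (drampe_eq0 ge h0) subr0 mul0r.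
Qed.

Lemma m2_max I : I <= It e - Tp e - e -> m2 e I = mx e /\ dm2 e I = 0.
Proof.
move=> h; have h0 : Tp e - rampe e (It e - I) <= 0.
  by have := rampe_ge ge (It e - I); lra.
by rewrite /m2 /dm2 (rampe_eq0 ge h0) (drampe_eq0 ge h0) subr0 mul0r.
Qed.

Lemma chi_high I : It e <= I -> chi e I = 0 /\ dchi e I = 0.
Proof.
move=> h; have h0 : It e - I <= 0 by lra.
have [m1E dm1E] : m1 e I = mx e /\ dm1 e I = 0.
  by apply: m1_max; have := Tp_gt ge; move: h Ce e0; rewrite /It /Ib; lra.
by rewrite /chi /dchi m1E dm1E /m2 /dm2 (rampe_eq0 ge h0) (drampe_eq0 ge h0)
  subr0 -/(mx e) subrr addr0 subrr mulr0 sub0r mulr0 oppr0 mulr0.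
Qed.

Lemma chi_low I : I <= Ib e -> chi e I = 0 /\ dchi e I = 0.
Proof.
move=> h; have h0 : I - Ib e <= 0 by lra.
have [m2E dm2E] : m2 e I = mx e /\ dm2 e I = 0.
  by apply: m2_max; have := Tp_gt ge; move: h Ce e0; rewrite /It /Ib; lra.
by rewrite /chi /dchi m2E dm2E /m1 /dm1 (rampe_eq0 ge h0) (drampe_eq0 ge h0)
  subr0 -/(mx e) subrr add0r subrr mulr0 mulr0 subr0 mulr0.
Qed.

Lemma chi_ring I : `|I - I0 e| <= Clay R * e -> Lu e <= chi e I.
Proof.
rewrite ler_norml => /andP[h1 h2].
have [m1E _] : m1 e I = mx e /\ dm1 e I = 0.
  by apply: m1_max; move: Ce e0; rewrite /Ib; lra.
have [m2E _] : m2 e I = mx e /\ dm2 e I = 0.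
  by apply: m2_max; move: Ce e0; rewrite /It; lra.
rewrite /chi m1E m2E addrK -(TpE ge) ler_pM2l; last by have := ac_gt1 ge; lra.
by rewrite /mx; exact: rampe_ge.
Qed.

Lemma dchi_le I : `|dchi e I| <= ac e.
Proof.
have H (a b c d : R) : 0 <= a <= 1 -> 0 <= b <= 1 -> 0 <= c <= 1 -> 0 <= d <= 1 ->
    `|a * b - c * d| <= 1.
  move=> /andP[a1 a2] /andP[b1 b2] /andP[c1 c2] /andP[d1 d2].
  have p1 : 0 <= a * b by rewrite mulr_ge0.
  have p2 : a * b <= 1 by rewrite mulr_ile1.
  have p3 : 0 <= c * d by rewrite mulr_ge0.
  have p4 : c * d <= 1 by rewrite mulr_ile1.
  by rewrite ler_norml; apply/andP; split; lra.
have a0 : 0 <= ac e := ltW (lt_trans ltr01 (ac_gt1 ge)).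
rewrite /dchi normrM (ger0_norm a0); apply: ler_piMr => //.
by apply: H; exact: drampe01.
Qed.

Lemma cap_bounds t : 0 <= mx e - rampe e (Tp e - rampe e t) <= Num.max 0 t.
Proof.
have f0 := rampe_ge0 ge t.
have /(rampe_mono ge)/andP[h h'] : Tp e - rampe e t <= Tp e by lra.
rewrite /mx h /=; apply: (le_trans h'); rewrite opprB addrC subrK.
rewrite le_max; have [t0|t0] := leP 0 t; first by rewrite (rampe_le ge t0) orbT.
by rewrite rampe_eq0 ?lexx// ltW.
Qed.

Lemma chi_ge0 I : 0 <= chi e I.
Proof.
rewrite mulr_ge0//; first by have := ac_gt1 ge; lra.
have /andP[h1 _] := cap_bounds (I - Ib e); have /andP[h2 _] := cap_bounds (It e - I).
have [h|h] := leP (I0 e) I.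
  have [-> _] : m1 e I = mx e /\ dm1 e I = 0 by apply: m1_max; move: Ce e0; rewrite /Ib; lra.
  rewrite addrAC subrr add0r; exact: h2.
have [-> _] : m2 e I = mx e /\ dm2 e I = 0 by apply: m2_max; move: Ce e0; rewrite /It; lra.
rewrite addrK; exact: h1.
Qed.

(** Since [ac e < pi], going down from [It e] gains in [u] at most [pi] times the action lost, so
    the lift does not raise the bound on [2 I + 2 u / pi]. *)
Lemma chi_le I : I <= It e -> chi e I <= ac e * (It e - I).
Proof.
move=> h; rewrite /chi ler_pM2l; last by have := ac_gt1 ge; lra.
have /andP[_ h2] := cap_bounds (It e - I); rewrite -/(m2 e I) in h2.
have h1 : m1 e I <= mx e by rewrite /m1 gerBl rampe_ge0.
by move: h2; rewrite max_r; lra.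
Qed.

Lemma kf_low Q : Q <= Qa e -> kf e Q = 0.
Proof.
by move=> h; rewrite /kf bstep0 ?mulr0// pmulr_lle0 ?invr_gt0 ?mulr_gt0// subr_le0.
Qed.

Lemma kf_high Q : Qa e + 2 * e <= Q -> kf e Q = 2 * pi.
Proof.
by move=> h; rewrite /kf bstep1 ?mulr1// ler_pdivlMr ?mulr_gt0// mul1r; move: h; lra.
Qed.

Lemma kf_bounds Q : 0 <= kf e Q <= 2 * pi.
Proof.
have p0 : (0 : R) <= 2 * pi by rewrite mulr_ge0// pi_ge0.
rewrite /kf mulr_ge0 ?bstep_ge0//= ler_piMr// bstep_le1//.
Qed.

Lemma q0_gt : 2^-1 < q0 e.
Proof. by rewrite /q0; have := Qa_gt ge; move: e0; lra. Qed.

Lemma hf_low t : t <= pi - e -> hf e t = 0.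
Proof.
by move=> h; rewrite /hf bstep0 ?mulr0// pmulr_lle0 ?invr_gt0 ?mulr_gt0//; move: h; lra.
Qed.

Lemma hf_high t : pi + e <= t -> hf e t = 2 * q0 e.
Proof.
by move=> h; rewrite /hf bstep1 ?mulr1// ler_pdivlMr ?mulr_gt0// mul1r; move: h; lra.
Qed.

Lemma hf_bounds t : 0 <= hf e t <= 2 * q0 e.
Proof.
have p0 : (0 : R) <= 2 * q0 e by have := q0_gt; lra.
by rewrite /hf mulr_ge0 ?bstep_ge0//= ler_piMr// bstep_le1.
Qed.

Lemma hf_eq0 t : 0 < hf e t -> pi - e < t.
Proof. by move=> h; rewrite ltNge; apply/negP => /hf_low E; move: h; rewrite E ltxx. Qed.

Lemma hf_eq1 t : hf e t < 2 * q0 e -> t < pi + e.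
Proof. by move=> h; rewrite ltNge; apply/negP => /hf_high E; move: h; rewrite E ltxx. Qed.

End ProfileBounds.

(** * The fibre disc *)

Section Fibre.
Variable R : realType.
Implicit Types (e z w x a b : R).

(* [(uf, vf)] is an area-preserving map from the unit disc into [(0, Lu) x (-1, 1)]; [uf] is
   the primitive of the half-height [duf] of a slightly larger disc. *)
Definition arcseg x : R := asin x + x * Num.sqrt (1 - x ^+ 2).
Definition wd e z : R := z / Num.sqrt (1 + e).
Definition uf e z : R := (1 + e) / 2 * arcseg (wd e z) + Lu e / 2.
Definition duf e z : R := Num.sqrt (1 + e) * Num.sqrt (1 - wd e z ^+ 2).
Definition vf e z w : R := w / duf e z.

(** For [b = pi / 2 - asin y] the square root is [sin b], and [y sin b < sin b <= b] is the upper
    bound; the lower one follows by oddness. *)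
Lemma arcseg_lt x : -1 < x < 1 -> - (pi / 2) < arcseg x < pi / 2.
Proof.
have H y : -1 < y < 1 -> arcseg y < pi / 2.
  move=> /andP[y1 y2]; have yb : -1 <= y <= 1 by rewrite !ltW.
  set b := pi / 2 - asin y.
  have sb : sin b = Num.sqrt (1 - y ^+ 2) by rewrite /b sinB sin_pihalf cos_pihalf mul1r mul0r subr0 cos_asin.
  have sb0 : 0 < sin b by rewrite sb sqrtr_gt0; nra.
  have b0 : 0 < b.
    by rewrite /b subr_gt0; apply: asin_ltpi2; rewrite ltW.
  have := norm_sin_le b; rewrite (gtr0_norm sb0) (gtr0_norm b0) => h.
  rewrite /arcseg -sb; have : y * sin b < sin b by rewrite gtr_pMl.
  by move: h; rewrite {2}/b; lra.
have odd y : -1 < y < 1 -> arcseg (- y) = - arcseg y.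
  move=> /andP[y1 y2]; rewrite /arcseg sqrrN mulNr opprD; congr (_ + _).
  have yb : -1 <= y <= 1 by rewrite !ltW.
  rewrite -[LHS]sinK; last first.
    by rewrite in_itv/= asin_geNpi2 ?asin_lepi2//; lra.
  rewrite asinK ?in_itv/=; last lra.
  rewrite -[X in - X](asinK (x := y)) ?in_itv//= -sinN sinK// in_itv/=.
  by have := asin_geNpi2 yb; have := asin_lepi2 yb; lra.
move=> h; rewrite H// andbT; have h' : -1 < - x < 1 by move: h; lra.
by have := H _ h'; rewrite odd//; lra.
Qed.

Lemma is_derive_arcseg x : -1 < x < 1 -> is_derive x 1 arcseg (2 * Num.sqrt (1 - x ^+ 2)).
Proof.
move=> h; have h0 : 0 < 1 - x ^+ 2 by move: h => /andP[]; nra.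
have q0 : Num.sqrt (1 - x ^+ 2) != 0 by rewrite gt_eqF// sqrtr_gt0.
have d1 := is_deriveBf (is_derive_cstf 1 x (1 : R)) (is_deriveMf (is_derive_id x (1 : R)) (is_derive_id x (1 : R))).
have d2 := is_derive_sqrtf d1 h0.
have d3 := is_deriveDf (is_derive1_asin h) (is_deriveMf (is_derive_id x (1 : R)) d2).
apply: (is_derive_eq d3) => /=; rewrite -expr2.
have q2 := sqr_sqrtr (ltW h0); set q := Num.sqrt _ in q0 q2 *.
rewrite !mulr1; apply: (mulIf q0).
have -> : (q^-1 + (x * ((0 - (x + x)) / (2 * q)) + q)) * q = 1 - x ^+ 2 + q ^+ 2 by field.
by rewrite q2 -mulrA -expr2 q2; ring.
Qed.

Lemma wd_lt e z : 0 < e -> -1 < z < 1 -> -1 < wd e z < 1.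
Proof.
move=> e0 /andP[z1 z2]; have w0 : 0 < Num.sqrt (1 + e) by rewrite sqrtr_gt0; lra.
have w1 : 1 < Num.sqrt (1 + e).
  by have := sqr_sqrtr (ltW (_ : 0 < 1 + e)) ; move: w0; set q := Num.sqrt _ => q0 /(_ ltac:(lra)); nra.
by rewrite /wd ltr_pdivlMr// ltr_pdivrMr//; apply/andP; split; lra.
Qed.

Lemma is_derive_uf e z : 0 < e -> -1 < z < 1 -> is_derive z 1 (uf e) (duf e z).
Proof.
move=> e0 hz; have w0 : 0 < Num.sqrt (1 + e) by rewrite sqrtr_gt0; lra.
have c k := is_derive_cstf k z (1 : R).
have d1 := is_deriveMf (is_derive_id z (1 : R)) (c (Num.sqrt (1 + e))^-1).
have d2 := is_derive_compf d1 (is_derive_arcseg (wd_lt e0 hz)).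
apply: (is_derive_eq (is_deriveDf (is_deriveMf (c ((1 + e) / 2)) d2) (c (Lu e / 2)))).
rewrite /duf; set q := Num.sqrt (1 + e) in w0 *; set r := Num.sqrt _.
have q2 : q ^+ 2 = 1 + e by rewrite sqr_sqrtr; lra.
by rewrite -q2; field; rewrite gt_eqF.
Qed.

Lemma duf_gt0 e z : 0 < e -> -1 < z < 1 -> 0 < duf e z.
Proof.
move=> e0 /(wd_lt e0)/andP[h1 h2]; rewrite mulr_gt0// sqrtr_gt0; first lra.
by nra.
Qed.

Lemma duf_sqr e z : 0 < e -> -1 < z < 1 -> duf e z ^+ 2 = 1 + e - z ^+ 2.
Proof.
move=> e0 h; have /andP[h1 h2] := wd_lt e0 h.
rewrite /duf exprMn sqr_sqrtr; last lra.
rewrite sqr_sqrtr; last by nra.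
rewrite /wd expr_div_n sqr_sqrtr; last lra.
by field; rewrite gt_eqF//; lra.
Qed.

Lemma uf_bounds e z : 0 < e -> -1 < z < 1 -> 0 < uf e z < Lu e.
Proof.
move=> e0 /(wd_lt e0)/arcseg_lt; rewrite /uf /Lu; set a := arcseg _ => /andP[h1 h2].
by have p0 := pi_gt0 R; apply/andP; split; nra.
Qed.

Lemma vf_bounds e z w : 0 < e -> z ^+ 2 + w ^+ 2 < 1 -> -1 < vf e z w < 1.
Proof.
move=> e0 h; have hz : -1 < z < 1 by apply/andP; split; nra.
have d0 := duf_gt0 e0 hz; have d2 := duf_sqr e0 hz.
by rewrite /vf ltr_pdivlMr// ltr_pdivrMr//; apply/andP; split; nra.
Qed.

Lemma uf_inj e z z' : 0 < e -> -1 < z < 1 -> -1 < z' < 1 -> uf e z = uf e z' -> z = z'.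
Proof.
move=> e0; have H a b : -1 < a < 1 -> -1 < b < 1 -> uf e a = uf e b -> ~ a < b.
  move=> ha hb E ab.
  have hI t : a <= t <= b -> -1 < t < 1 by move: ha hb => /andP[? ?] /andP[? ?] /andP[? ?]; lra.
  have [] := @MVT R (uf e) (duf e) a b ab.
  - move=> t; rewrite in_itv/= => /andP[t1 t2]; apply: is_derive_uf => //.
    by apply: hI; rewrite !ltW.
  - apply: derivable_within_continuous => t; rewrite in_itv/= => ht.
    by have [] := is_derive_uf e0 (hI t ht).
  move=> t; rewrite in_itv/= => /andP[t1 t2].
  rewrite E subrr => /esym/eqP; rewrite mulf_eq0 => /orP[] h.
    have ht : -1 < t < 1 by apply: hI; rewrite !ltW.
    by have := duf_gt0 e0 ht; rewrite (eqP h) ltxx.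
  by move: h; rewrite subr_eq0 gt_eqF.
move=> hz hz' E; have [/(H _ _ hz hz' E)//|/(H _ _ hz' hz (esym E))//|//] := ltgtP z z'.
Qed.

(** The hypotheses give [cos (a - b) = 1], while [cos d = 1 - 2 sin^2 (d / 2)] is below 1 for
    [0 < d < 2 pi]. *)
Lemma trig_inj a b : cos a = cos b -> sin a = sin b -> `|a - b| < 2 * pi -> a = b.
Proof.
move=> ec es; have c1 : cos (a - b) = 1 by rewrite cosB ec es -!expr2 cos2Dsin2.
have H (d : R) : cos d = 1 -> 0 < d -> d < 2 * pi -> False.
  move=> cd d0 d1; have := sin_gt0_pi (x := d / 2).
  move/(_ ltac:(lra)); have := cosD (d / 2) (d / 2).
  rewrite -splitr cd; have := cos2Dsin2 (d / 2).
  by set s := sin _; set c := cos _; nra.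
rewrite ltr_norml => /andP[h1 h2].
have [h|h|/eqP] := ltgtP (a - b) 0; last by rewrite subr_eq0 => /eqP.
- have cN : cos (- (a - b)) = 1 by rewrite cosN.
  have n0 : 0 < - (a - b) by lra.
  have n1 : - (a - b) < 2 * pi by lra.
  by have := H _ cN n0 n1.
- by have := H _ c1 h h2.
Qed.

Lemma polar_inj (I I' a b : R) : 0 < I -> 0 < I' ->
  Num.sqrt I * cos a = Num.sqrt I' * cos b -> Num.sqrt I * sin a = Num.sqrt I' * sin b ->
  [/\ I = I', cos a = cos b & sin a = sin b].
Proof.
move=> i0 i0' h1 h2.
have E : I = I'.
  rewrite -[LHS]mulr1 -[RHS]mulr1 -{1}(cos2Dsin2 a) -(cos2Dsin2 b).
  rewrite -[in LHS](sqr_sqrtr (ltW i0)) -[in RHS](sqr_sqrtr (ltW i0')).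
  by rewrite !mulrDr -!exprMn h1 h2.
have q : Num.sqrt I != 0 by rewrite gt_eqF// sqrtr_gt0.
by rewrite -E in h1 h2; split => //; [exact: mulfI h1 | exact: mulfI h2].
Qed.

End Fibre.

(** * The ring and the band *)

Section Rows.
Variables (R : realType) (V : normedModType R).

Lemma row_continuous m (F : V -> 'rV[R]_m) (p : V) :
  (forall i, {for p, continuous (fun p => F p ord0 i)}) -> {for p, continuous F}.
Proof.
move=> h; apply/cvgrPdist_le => /= e e0; near=> t.
rewrite [leLHS]/Num.Def.normr/= mx_normrE (bigmax_le _ (ltW e0))//= => i _.
rewrite !mxE /=; move: i; near: t; apply: filter_forall => /= -[i j].
by rewrite ord1 /=; have /cvgrPdist_le := h j; apply.
Unshelve. all: by end_near. Qed.

Lemma Cn_row n m (U : set V) (F : V -> 'rV[R]_m) : open U ->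
  (forall i, Cn n U (fun p => F p ord0 i)) -> Cn n U F.
Proof.
move=> oU; elim: n F => [|n IH] F h.
  split => // p Up; apply: row_continuous => i; exact: Cn_cont (h i) Up.
have d p v : U p -> derivable F p v.
  move=> Up; apply/derivable_mxP => i j; rewrite ord1.
  by have [_ [dj _]] := h j; exact: dj.
split; first by move=> p Up; apply: row_continuous => i; exact: Cn_cont (h i) Up.
split => // v; apply: IH => i.
apply: (@Cn_eq _ _ _ _ _ ('D_v (fun p => F p ord0 i))) => //.
  by move=> p Up; rewrite (derive_mx (d p v Up)) mxE.
by have [_ [_ hD]] := h i; exact: hD.
Qed.

Lemma sm_row m (U : set V) (F : V -> 'rV[R]_m) : open U ->
  (forall i, sm U (fun p => F p ord0 i)) -> sm U F.
Proof. by move=> oU h n; apply: Cn_row => // i; exact: h. Qed.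

Lemma is_derive_row m (F : V -> 'rV[R]_m) (p v : V) (D : 'rV[R]_m) :
  (forall i, is_derive p v (fun p => F p ord0 i) (D ord0 i)) -> is_derive p v F D.
Proof.
move=> h; have d : derivable F p v.
  by apply/derivable_mxP => i j; rewrite ord1; case: (h j).
apply: DeriveDef => //; rewrite derive_mx//; apply/rowP => j; rewrite !mxE.
by case: (h j).
Qed.

End Rows.

Section Charts.
Variable R : realType.
Implicit Types (e ph I u v P Q X Y : R).

Definition mk4 (a b c d : R) : 'rV[R]_4 :=
  \row_(i < 4) (if i == c0 then a else if i == c1 then b else if i == c2 then c else d).

Lemma mk4E a b c d : [/\ mk4 a b c d ord0 c0 = a, mk4 a b c d ord0 c1 = b,
  mk4 a b c d ord0 c2 = c & mk4 a b c d ord0 c3 = d].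
Proof. by split; rewrite mxE. Qed.

Lemma omega4_mk4 a b c d a' b' c' d' :
  omega4 (mk4 a b c d) (mk4 a' b' c' d') = a * b' - b * a' + c * d' - d * c'.
Proof.
rewrite /omega4; have [-> -> -> ->] := mk4E a b c d.
by have [-> -> -> ->] := mk4E a' b' c' d'.
Qed.

Lemma sqnorm4_mk4 a b c d : sqnorm4 (mk4 a b c d) = a ^+ 2 + b ^+ 2 + c ^+ 2 + d ^+ 2.
Proof. by rewrite /sqnorm4 !big_ord_recr big_ord0 /= !mxE /= add0r. Qed.

Lemma mk4_inj a b c d a' b' c' d' : mk4 a b c d = mk4 a' b' c' d' ->
  [/\ a = a', b = b', c = c' & d = d'].
Proof.
move=> E; have [e1 e2 e3 e4] := mk4E a b c d; rewrite E in e1 e2 e3 e4.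
by have [f1 f2 f3 f4] := mk4E a' b' c' d'; split; congruence.
Qed.

(* [(phi, I)] and [(pi * v, u / pi)] are angle and action in the two planes. *)
Definition out ph I u v : 'rV[R]_4 :=
  mk4 (Num.sqrt (2 * I) * cos ph) (- (Num.sqrt (2 * I) * sin ph))
      (Num.sqrt (2 * u / pi) * cos (pi * v)) (Num.sqrt (2 * u / pi) * sin (pi * v)).

(* [FU] is the ring; [FB] is the band: it turns by [kf] while it leaves the ring, drops by [hf]
   back below it, and crosses it lifted by [chi] in the fibre; the term [dchi * v] in the
   angle makes the lift symplectic. *)
Definition FU e P Q u v := out P (I0 e + Q) u v.

Definition Bph e P Q : R := P + kf e Q.
Definition BI e P Q : R := I0 e + Q - hf e (Bph e P Q).
Definition FB e P Q u v :=
  out (Bph e P Q + dchi e (BI e P Q) * v) (BI e P Q) (u + chi e (BI e P Q)) v.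

Lemma sqnorm4_out ph I u v : 0 <= I -> 0 <= u ->
  sqnorm4 (out ph I u v) = 2 * I + 2 * u / pi.
Proof.
move=> I0 u0; rewrite sqnorm4_mk4 sqrrN !exprMn !sqr_sqrtr; last 2 first.
- by rewrite divr_ge0 ?mulr_ge0// pi_ge0.
- by rewrite mulr_ge0.
have c1 := cos2Dsin2 ph; have c2 := cos2Dsin2 (pi * v).
by rewrite -mulrDr c1 -addrA -mulrDr c2 !mulr1.
Qed.

(** The angle [pi * v] ranges over an open interval of length [2 pi], so [v] is recovered; [ph] is
    recovered only modulo [2 pi]. *)
Lemma out_inj ph I u v ph' I' u' v' : 0 < I -> 0 < I' -> 0 < u -> 0 < u' ->
  -1 < v < 1 -> -1 < v' < 1 -> out ph I u v = out ph' I' u' v' ->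
  [/\ I = I', u = u', v = v', cos ph = cos ph' & sin ph = sin ph'].
Proof.
move=> i0 i0' u0 u0' /andP[v1 v2] /andP[v1' v2'] /mk4_inj[e1 /oppr_inj e2 e3 e4].
have p0 := pi_gt0 R; have pn0 : pi != 0 :> R by rewrite gt_eqF.
have [] := polar_inj _ _ e1 e2; rewrite ?mulr_gt0// => /mulfI EI ec es.
have [] := polar_inj _ _ e3 e4; rewrite ?divr_gt0 ?mulr_gt0// => Eu fc fs.
have Ev : pi * v = pi * v'.
  apply: trig_inj => //; rewrite -mulrBr normrM gtr0_norm// mulrC ltr_pM2r//.
  by rewrite ltr_norml; apply/andP; split; lra.
split => //; first exact: EI.
- move: Eu => /(congr1 (fun t => t * (pi / 2))).
  have K (t : R) : 2 * t / pi * (pi / 2) = t.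
    by move: (pi : R) pn0 => c cn0; field.
  by rewrite !K.
- exact: (mulfI pn0 Ev).
Qed.

Definition dout ph I u v ph1 I1 u1 v1 : 'rV[R]_4 :=
  let q := Num.sqrt (2 * I) in let r := Num.sqrt (2 * u / pi) in
  mk4 (cos ph / q * I1 - q * sin ph * ph1) (- (sin ph / q * I1) - q * cos ph * ph1)
      (cos (pi * v) / (pi * r) * u1 - pi * r * sin (pi * v) * v1)
      (sin (pi * v) / (pi * r) * u1 + pi * r * cos (pi * v) * v1).

(** The minus sign in the second coordinate of [out] orients the first plane as [d phi /\ dI]; in
    the second plane [d(u / pi) /\ d(pi v)] is [du /\ dv]. *)
Lemma omega4_dout ph I u v ph1 I1 u1 v1 ph2 I2 u2 v2 : 0 < I -> 0 < u ->
  omega4 (dout ph I u v ph1 I1 u1 v1) (dout ph I u v ph2 I2 u2 v2) =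
  (ph1 * I2 - ph2 * I1) + (u1 * v2 - u2 * v1).
Proof.
move=> i0 u0; have p0 := pi_gt0 R; have pn0 : pi != 0 :> R by rewrite gt_eqF.
rewrite omega4_mk4.
have q0 : Num.sqrt (2 * I) != 0 by rewrite gt_eqF// sqrtr_gt0 mulr_gt0.
have r0 : Num.sqrt (2 * u / pi) != 0 by rewrite gt_eqF// sqrtr_gt0 divr_gt0// mulr_gt0.
have c1 := cos2Dsin2 ph; have c2 := cos2Dsin2 (pi * v).
rewrite -[RHS](_ : (cos ph ^+ 2 + sin ph ^+ 2) * (ph1 * I2 - ph2 * I1) +
  (cos (pi * v) ^+ 2 + sin (pi * v) ^+ 2) * (u1 * v2 - u2 * v1) = _); last first.
  by rewrite c1 c2 !mul1r.
move: q0 r0; set q := Num.sqrt _; set r := Num.sqrt _.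
set a := cos ph; set b := sin ph; set c := cos _; set d := sin _ => q0 r0.
move: (pi : R) pn0 => k kn0; by field; rewrite ?kn0 ?q0 ?r0.
Qed.

End Charts.

Section ChartCalculus.
Variables (R : realType) (V : normedModType R).
Implicit Types (e : R).

Lemma sm_mk4 (U : set V) (a b c d : V -> R) : open U ->
  sm U a -> sm U b -> sm U c -> sm U d -> sm U (fun p => mk4 (a p) (b p) (c p) (d p)).
Proof.
move=> oU sa sb sc sd; apply: sm_row => // i.
have H (f : V -> R) : sm U f -> (forall p, f p = mk4 (a p) (b p) (c p) (d p) ord0 i) ->
    sm U (fun p => mk4 (a p) (b p) (c p) (d p) ord0 i).
  by move=> sf E; apply: sm_eq sf.
case: i H => [[|[|[|[|//]]]] ilt] H.
- by apply: H sa _ => p; rewrite mxE.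
- by apply: H sb _ => p; rewrite mxE.
- by apply: H sc _ => p; rewrite mxE.
- by apply: H sd _ => p; rewrite mxE.
Qed.

Lemma is_derive_mk4 (a b c d : V -> R) (p v : V) a' b' c' d' :
  is_derive p v a a' -> is_derive p v b b' -> is_derive p v c c' -> is_derive p v d d' ->
  is_derive p v (fun p => mk4 (a p) (b p) (c p) (d p)) (mk4 a' b' c' d').
Proof.
move=> da db dc dd; apply: is_derive_row => i.
have H (f : V -> R) (f' : R) : is_derive p v f f' ->
    f = (fun p => mk4 (a p) (b p) (c p) (d p) ord0 i) -> f' = mk4 a' b' c' d' ord0 i ->
    is_derive p v (fun p => mk4 (a p) (b p) (c p) (d p) ord0 i) (mk4 a' b' c' d' ord0 i).
  by move=> sf <- <-.
case: i H => [[|[|[|[|//]]]] ilt] H.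
- by apply: H da _ _; [apply/funext => t|]; rewrite mxE.
- by apply: H db _ _; [apply/funext => t|]; rewrite mxE.
- by apply: H dc _ _; [apply/funext => t|]; rewrite mxE.
- by apply: H dd _ _; [apply/funext => t|]; rewrite mxE.
Qed.

Lemma sm_out (U : set V) (ph I u v : V -> R) : open U ->
  sm U ph -> sm U I -> sm U u -> sm U v ->
  (forall p, U p -> 0 < I p) -> (forall p, U p -> 0 < u p) ->
  sm U (fun p => out (ph p) (I p) (u p) (v p)).
Proof.
move=> oU sph sI su sv I0 u0; have p0 := pi_gt0 R; have pn0 : pi != 0 :> R by rewrite gt_eqF.
apply: sm_mk4 => //; smooth_tac => //.
- by move=> p /I0; rewrite pmulr_rgt0.
- by move=> p /I0; rewrite pmulr_rgt0.
- by move=> p /u0 h; rewrite divr_gt0// mulr_gt0.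
- by move=> p /u0 h; rewrite divr_gt0// mulr_gt0.
Qed.

Lemma is_derive_out (ph I u v : V -> R) (p w : V) ph1 I1 u1 v1 :
  is_derive p w ph ph1 -> is_derive p w I I1 -> is_derive p w u u1 -> is_derive p w v v1 ->
  0 < I p -> 0 < u p ->
  is_derive p w (fun p => out (ph p) (I p) (u p) (v p)) (dout (ph p) (I p) (u p) (v p) ph1 I1 u1 v1).
Proof.
move=> dph dI du dv i0 u0; have p0 := pi_gt0 R; have pn0 : pi != 0 :> R by rewrite gt_eqF.
have i2 : 0 < 2 * I p by rewrite mulr_gt0.
have u2 : 0 < 2 * u p / pi by rewrite divr_gt0// mulr_gt0.
have q0 : Num.sqrt (2 * I p) != 0 by rewrite gt_eqF// sqrtr_gt0.
have r0 : Num.sqrt (2 * u p / pi) != 0 by rewrite gt_eqF// sqrtr_gt0.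
have c k := is_derive_cstf k p w.
have dq := is_derive_sqrtf (is_deriveMf (c 2) dI) i2.
have dr := is_derive_sqrtf (is_deriveMf (is_deriveMf (c 2) du) (c pi^-1)) u2.
have dcos := is_derive_compf dph (is_derive_cos (ph p)).
have dsin := is_derive_compf dph (is_derive_sin (ph p)).
have dpv := is_deriveMf (c pi) dv.
have ecos := is_derive_compf dpv (is_derive_cos (pi * v p)).
have esin := is_derive_compf dpv (is_derive_sin (pi * v p)).
apply: is_derive_mk4.
- by apply: (is_derive_eq (is_deriveMf dq dcos)); field.
- by apply: (is_derive_eq (is_deriveNf (is_deriveMf dq dsin))); field.
- apply: (is_derive_eq (is_deriveMf dr ecos)); rewrite /=.
  move: (cos _) (sin _) (Num.sqrt _) r0 => k1 k2 r r0.
  by move: (pi : R) pn0 => k kn0; field; rewrite ?kn0 ?r0.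
- apply: (is_derive_eq (is_deriveMf dr esin)); rewrite /=.
  move: (cos _) (sin _) (Num.sqrt _) r0 => k1 k2 r r0.
  by move: (pi : R) pn0 => k kn0; field; rewrite ?kn0 ?r0.
Qed.

End ChartCalculus.

(** * Smoothness of the profiles jointly in the parameter and their arguments *)

Section ProfileSmooth.
Variables (R : realType) (V : normedModType R) (U : set V) (E : V -> R).
Hypotheses (oU : open U) (sE : sm U E) (gE : forall p, U p -> good (E p)).

Implicit Types (t X Q I z w P u v : V -> R).

Let E0 p : U p -> E p != 0. Proof. by move=> /gE/e_neq0. Qed.

Lemma sm_rampe t : sm U t -> sm U (fun p => rampe (E p) (t p)).
Proof. by move=> st; rewrite /rampe; smooth_tac. Qed.

Lemma sm_drampe t : sm U t -> sm U (fun p => drampe (E p) (t p)).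
Proof. by move=> st; rewrite /drampe; smooth_tac. Qed.

Lemma sm_ac : sm U (fun p => ac (E p)).
Proof. by rewrite /ac; smooth_tac. Qed.

Lemma sm_Tp : sm U (fun p => Tp (E p)).
Proof.
have h := sm_ac; rewrite /Tp /Lu; smooth_tac => p Up.
by rewrite gt_eqF// (lt_trans ltr01)// ac_gt1//; exact: gE.
Qed.

Lemma sm_Qa : sm U (fun p => Qa (E p)).
Proof. by have h := sm_Tp; rewrite /Qa; smooth_tac. Qed.

Lemma sm_q0 : sm U (fun p => q0 (E p)).
Proof. by have h := sm_Qa; rewrite /q0; smooth_tac. Qed.

Lemma sm_I0 : sm U (fun p => I0 (E p)).
Proof. by have h := sm_Qa; rewrite /I0; smooth_tac. Qed.

Lemma sm_Ib : sm U (fun p => Ib (E p)).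
Proof. by have h := sm_I0; have h' := sm_Tp; rewrite /Ib; smooth_tac. Qed.

Lemma sm_It : sm U (fun p => It (E p)).
Proof. by have h := sm_I0; have h' := sm_Tp; rewrite /It; smooth_tac. Qed.

Lemma sm_lam : sm U (fun p => lam (E p)).
Proof.
have h := sm_q0; rewrite /lam; smooth_tac => p Up.
by rewrite mulf_neq0// gt_eqF// (lt_trans _ (q0_gt (gE Up)))// invr_gt0.
Qed.

Lemma sm_Tt : sm U (fun p => Tt (E p)).
Proof. by rewrite /Tt; smooth_tac. Qed.

Lemma sm_TT : sm U (fun p => TT (E p)).
Proof. exact: sm_rampe sm_Tt. Qed.

Lemma sm_mx : sm U (fun p => mx (E p)).
Proof. exact: sm_rampe sm_Tp. Qed.

Lemma sm_Mm : sm U (fun p => Mm (E p)).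
Proof.
have h := sm_lam; have h' := sm_TT; rewrite /Mm; smooth_tac => p Up.
by have /andP[h1 _] := TT_bounds (gE Up); rewrite gt_eqF// (lt_trans (slit_end_gt0 R)).
Qed.

Lemma sm_P0 X : sm U X -> sm U (fun p => P0 (E p) (X p)).
Proof.
move=> sX; have h1 := sm_lam; have h2 := sm_Mm; have h3 := sm_Tt; have h4 := sm_TT.
have h5 : sm U (fun p => rampe (E p) (X p + slit_end R)) by apply: sm_rampe; smooth_tac.
have h6 : sm U (fun p => rampe (E p) (Tt (E p) - rampe (E p) (X p + slit_end R))).
  by apply: sm_rampe; smooth_tac.
by rewrite /P0 /tau; smooth_tac.
Qed.

Lemma sm_dP0 X : sm U X -> sm U (fun p => dP0 (E p) (X p)).
Proof.
move=> sX; have h1 := sm_lam; have h2 := sm_Mm; have h3 := sm_Tt; have h4 := sm_TT.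
have h5 : sm U (fun p => rampe (E p) (X p + slit_end R)) by apply: sm_rampe; smooth_tac.
have h6 : sm U (fun p => drampe (E p) (X p + slit_end R)) by apply: sm_drampe; smooth_tac.
have h7 : sm U (fun p => drampe (E p) (Tt (E p) - rampe (E p) (X p + slit_end R))).
  by apply: sm_drampe; smooth_tac.
by rewrite /dP0 /dtau; smooth_tac.
Qed.

Lemma sm_kf Q : sm U Q -> sm U (fun p => kf (E p) (Q p)).
Proof.
move=> sQ; have h := sm_Qa; rewrite /kf; smooth_tac => p Up.
by rewrite mulf_neq0// E0.
Qed.

Lemma sm_hf Q : sm U Q -> sm U (fun p => hf (E p) (Q p)).
Proof.
move=> sQ; have h := sm_q0; rewrite /hf; smooth_tac => p Up.
by rewrite mulf_neq0// E0.
Qed.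

Lemma sm_chi I : sm U I -> sm U (fun p => chi (E p) (I p)).
Proof.
move=> sI; have h1 := sm_ac; have h2 := sm_mx; have h3 := sm_Tp.
have h4 := sm_Ib; have h5 := sm_It.
have a1 : sm U (fun p => rampe (E p) (I p - Ib (E p))) by apply: sm_rampe; smooth_tac.
have a2 : sm U (fun p => rampe (E p) (Tp (E p) - rampe (E p) (I p - Ib (E p)))).
  by apply: sm_rampe; smooth_tac.
have b1 : sm U (fun p => rampe (E p) (It (E p) - I p)) by apply: sm_rampe; smooth_tac.
have b2 : sm U (fun p => rampe (E p) (Tp (E p) - rampe (E p) (It (E p) - I p))).
  by apply: sm_rampe; smooth_tac.
by rewrite /chi /m1 /m2; smooth_tac.
Qed.

Lemma sm_dchi I : sm U I -> sm U (fun p => dchi (E p) (I p)).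
Proof.
move=> sI; have h1 := sm_ac; have h3 := sm_Tp.
have h4 := sm_Ib; have h5 := sm_It.
have a1 : sm U (fun p => rampe (E p) (I p - Ib (E p))) by apply: sm_rampe; smooth_tac.
have a2 : sm U (fun p => drampe (E p) (Tp (E p) - rampe (E p) (I p - Ib (E p)))).
  by apply: sm_drampe; smooth_tac.
have a3 : sm U (fun p => drampe (E p) (I p - Ib (E p))) by apply: sm_drampe; smooth_tac.
have b1 : sm U (fun p => rampe (E p) (It (E p) - I p)) by apply: sm_rampe; smooth_tac.
have b2 : sm U (fun p => drampe (E p) (Tp (E p) - rampe (E p) (It (E p) - I p))).
  by apply: sm_drampe; smooth_tac.
have b3 : sm U (fun p => drampe (E p) (It (E p) - I p)) by apply: sm_drampe; smooth_tac.
by rewrite /dchi /dm1 /dm2; smooth_tac.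
Qed.

Lemma sm_duf z : sm U z -> (forall p, U p -> -1 < z p < 1) ->
  sm U (fun p => duf (E p) (z p)).
Proof.
move=> sz hz; rewrite /duf /wd; smooth_tac.
- by move=> p /gE/e_gt0; lra.
- by move=> p /gE/e_gt0; lra.
- by move=> p /gE/e_gt0 h; rewrite gt_eqF// sqrtr_gt0; lra.
- by move=> p Up; have /andP[] := wd_lt (e_gt0 (gE Up)) (hz p Up); rewrite /wd; nra.
Qed.

Lemma sm_uf z : sm U z -> (forall p, U p -> -1 < z p < 1) ->
  sm U (fun p => uf (E p) (z p)).
Proof.
move=> sz hz.
have sw : sm U (fun p => wd (E p) (z p)).
  rewrite /wd; smooth_tac; first by move=> p /gE/e_gt0; lra.
  by move=> p /gE/e_gt0 h; rewrite gt_eqF// sqrtr_gt0; lra.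
have hw p : U p -> -1 < wd (E p) (z p) < 1.
  by move=> Up; exact: wd_lt (e_gt0 (gE Up)) (hz p Up).
have sa : sm U (fun p => asin (wd (E p) (z p))).
  by apply: (@sm_comp1 _ _ _ (@asin R)) (@sm_asin R) _.
rewrite /uf /arcseg /Lu; smooth_tac.
by move=> p Up; have /andP[] := hw p Up; nra.
Qed.

Lemma sm_vf z w : sm U z -> sm U w -> (forall p, U p -> -1 < z p < 1) ->
  sm U (fun p => vf (E p) (z p) (w p)).
Proof.
move=> sz sw hz; have h := sm_duf sz hz; rewrite /vf; smooth_tac => p Up.
by rewrite gt_eqF// duf_gt0 ?hz//; exact: e_gt0 (gE Up).
Qed.

Lemma sm_FU P Q u v : sm U P -> sm U Q -> sm U u -> sm U v ->
  (forall p, U p -> 0 < I0 (E p) + Q p) -> (forall p, U p -> 0 < u p) ->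
  sm U (fun p => FU (E p) (P p) (Q p) (u p) (v p)).
Proof. by move=> sP sQ su sv hI hu; have h := sm_I0; apply: sm_out => //; smooth_tac. Qed.

(** The drop is at most [2 * q0 e], so [Q] minus the drop exceeds [- Qa e - 3 * e], while [I0 e] is
    [Qa e + 4 * e]. *)
Lemma BI_gt0 (e P Q : R) : good e -> Qa e - e < Q -> 0 < BI e P Q.
Proof.
move=> ge h; have /andP[h1 h2] := hf_bounds ge (Bph e P Q).
by have := e_gt0 ge; move: h h1 h2; rewrite /BI /I0 /q0; set t := hf _ _; lra.
Qed.

Lemma sm_FB P Q u v : sm U P -> sm U Q -> sm U u -> sm U v ->
  (forall p, U p -> Qa (E p) - E p < Q p) -> (forall p, U p -> 0 < u p) ->
  sm U (fun p => FB (E p) (P p) (Q p) (u p) (v p)).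
Proof.
move=> sP sQ su sv hQ hu; have h0 := sm_I0.
have h1 : sm U (fun p => Bph (E p) (P p) (Q p)).
  by have h := sm_kf sQ; rewrite /Bph; smooth_tac.
have h2 : sm U (fun p => BI (E p) (P p) (Q p)).
  by have h := sm_hf h1; rewrite /BI; smooth_tac.
have h3 := sm_chi h2; have h4 := sm_dchi h2.
apply: sm_out => //; smooth_tac => //.
- by move=> p Up; apply: BI_gt0; [exact: gE | exact: hQ].
- by move=> p Up; rewrite ltr_pwDl ?hu// chi_ge0//; exact: gE.
Qed.

End ProfileSmooth.

Section ChartSymplectic.
Variables (R : realType) (V : normedModType R) (e : R).
Hypothesis ge : good e.
Variables (P Q u v : V -> R) (p a b : V) (Pa Qb' ua va Pb Qa' ub vb : R).
Hypotheses (dPa : is_derive p a P Pa) (dPb : is_derive p b P Pb)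
  (dQa : is_derive p a Q Qa') (dQb : is_derive p b Q Qb')
  (dua : is_derive p a u ua) (dub : is_derive p b u ub)
  (dva : is_derive p a v va) (dvb : is_derive p b v vb).
Hypothesis u0 : 0 < u p.

Lemma FU_symplectic : 0 < I0 e + Q p ->
  omega4 ('D_a (fun p => FU e (P p) (Q p) (u p) (v p)) p)
         ('D_b (fun p => FU e (P p) (Q p) (u p) (v p)) p) =
  (Pa * Qb' - Pb * Qa') + (ua * vb - ub * va).
Proof.
move=> i0.
have d w (Pw Qw uw vw : R) : is_derive p w P Pw -> is_derive p w Q Qw ->
    is_derive p w u uw -> is_derive p w v vw ->
    'D_w (fun p => FU e (P p) (Q p) (u p) (v p)) p =
    dout (P p) (I0 e + Q p) (u p) (v p) Pw Qw uw vw.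
  move=> dP dQ du dv.
  have dI := is_deriveDf (is_derive_cstf (I0 e) p w) dQ.
  by have [_ ->] := is_derive_out dP dI du dv i0 u0; rewrite add0r.
by rewrite (d a _ _ _ _ dPa dQa dua dva) (d b _ _ _ _ dPb dQb dub dvb) omega4_dout.
Qed.

(** The turn by [kf] and the drop by [hf] are shears of the [(P, Q)] plane. For the lift,
    [chi' dI /\ dv] from the second plane cancels [chi' dv /\ dI] from the angle, and the term with
    the derivative of [dchi] is a multiple of [dI /\ dI]. *)
Lemma FB_symplectic : Qa e - e < Q p ->
  omega4 ('D_a (fun p => FB e (P p) (Q p) (u p) (v p)) p)
         ('D_b (fun p => FB e (P p) (Q p) (u p) (v p)) p) =
  (Pa * Qb' - Pb * Qa') + (ua * vb - ub * va).
Proof.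
move=> hQ; have i0 := BI_gt0 (P p) ge hQ.
set I := BI e (P p) (Q p) in i0.
have uc : 0 < u p + chi e I by rewrite ltr_pwDl// chi_ge0.
have sT (f : R -> R) : (forall (W : set R) (x : R -> R), open W -> sm W x -> sm W (fun t => f (x t))) ->
    forall t : R, is_derive t 1 f ('D_1 f t).
  move=> h t; apply: derivableP; have oT := @openT R.
  have sf : sm setT f := h setT (fun x => x) oT (sm_id1 oT).
  by apply: sm_derivable sf _.
have dk := sT (kf e) (fun W x oW sx => sm_kf oW (sm_cst W e) (fun _ _ => ge) sx).
have dh := sT (hf e) (fun W x oW sx => sm_hf oW (sm_cst W e) (fun _ _ => ge) sx).
have dd := sT (dchi e) (fun W x oW sx => sm_dchi oW (sm_cst W e) (fun _ _ => ge) sx).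
set k' := 'D_1 (kf e) (Q p); set h' := 'D_1 (hf e) (Bph e (P p) (Q p)).
set c' := dchi e I; set c'' := 'D_1 (dchi e) I.
have d w (Pw Qw uw vw : R) : is_derive p w P Pw -> is_derive p w Q Qw ->
    is_derive p w u uw -> is_derive p w v vw ->
    'D_w (fun p => FB e (P p) (Q p) (u p) (v p)) p =
    dout (Bph e (P p) (Q p) + c' * v p) I (u p + chi e I) (v p)
      (Pw + k' * Qw + c' * vw + v p * (c'' * (Qw - h' * (Pw + k' * Qw))))
      (Qw - h' * (Pw + k' * Qw)) (uw + c' * (Qw - h' * (Pw + k' * Qw))) vw.
  move=> dP dQ du dv.
  have dph := is_deriveDf dP (is_derive_compf dQ (dk (Q p))).
  have dI := is_deriveBf (is_deriveDf (is_derive_cstf (I0 e) p w) dQ) (is_derive_compf dph (dh _)).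
  have dc := is_derive_compf dI (is_derive_chi ge _).
  have ddc := is_derive_compf dI (dd _).
  have [_ ->] := is_derive_out (is_deriveDf dph (is_deriveMf ddc dv)) dI (is_deriveDf du dc) dv i0 uc.
  by rewrite add0r addrA.
rewrite (d a _ _ _ _ dPa dQa dua dva) (d b _ _ _ _ dPb dQb dub dvb) omega4_dout//.
by ring.
Qed.

End ChartSymplectic.

(** * The map on a fundamental cell *)

Section Cell.
Variable R : realType.
Implicit Types (e X Y P Q u v : R).

(** [Q = 0] sits at [Y = 1/2] and [Y = - 1/2], which the torus identifies, so [Q0] jumps at [Y = 0],
    along the slit. [Qp] adds the period [2 * q0 e] on the upper side, which removes the jump off
    the slit ([gap_Q]). *)
Definition Q0 e X Y : R := e * (if Y <= 0 then Y + 2^-1 else Y - 2^-1) / dP0 e X.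
Definition Qp e X Y : R := Q0 e X Y + (if Y <= 0 then 0 else 2 * q0 e).
Definition cell e X Y u v : 'rV[R]_4 :=
  if `|Q0 e X Y| < Qa e then FU e (P0 e X) (Q0 e X Y) u v
  else FB e (Phat e X) (Qp e X Y) u v.

Lemma out_periodic (ph I u v : R) : out (ph + 2 * pi) I u v = out ph I u v.
Proof.
have E : 2 * pi = pi *+ 2 :> R by rewrite mulr_natl.
by rewrite /out E cosD2pi sinD2pi.
Qed.

Lemma FU_P0_Phat e X Q u v : FU e (P0 e X) Q u v = FU e (Phat e X) Q u v.
Proof.
by rewrite /Phat; case: ifP => // _; rewrite /FU -[in RHS]out_periodic subrK.
Qed.

Section Good.
Variable e : R.
Hypothesis ge : good e.

Let e0 : 0 < e := e_gt0 ge.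
Let He : Clay R * e < 1 - 2 * e := Clay_e ge.
Let p2 : 2 <= pi :> R := pi_ge2 R.

(** On the last stretch of the upper leg the band has not begun to turn, its angle is too small for
    the drop, and [chi] vanishes above [It e]. *)
Lemma FB_low P Q u v : `|P| <= Clay R * e -> Qa e - e < Q <= Qa e ->
  FB e P Q u v = FU e P Q u v.
Proof.
rewrite ler_norml => /andP[P1 P2] /andP[Q1 Q2].
have E1 : Bph e P Q = P by rewrite /Bph kf_low// addr0.
have E2 : BI e P Q = I0 e + Q.
  by rewrite /BI E1 hf_low ?subr0//; move: He p2 e0 P2; lra.
have [c1 c2] : chi e (I0 e + Q) = 0 /\ dchi e (I0 e + Q) = 0.
  by apply: chi_high => //; rewrite /It; move: Q1; rewrite /Qa; lra.
by rewrite /FB E2 c1 c2 E1 mul0r !addr0.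
Qed.

(** The band has completed its turn and its drop, and [chi] vanishes below [Ib e]: it arrives on the
    lower leg. *)
Lemma FB_high P Q u v : `|P| <= Clay R * e -> 2 * q0 e - Qa e <= Q < 2 * q0 e - Qa e + e ->
  FB e P Q u v = FU e P (Q - 2 * q0 e) u v.
Proof.
rewrite ler_norml => /andP[P1 P2] /andP[Q1 Q2].
have E1 : Bph e P Q = P + 2 * pi.
  by rewrite /Bph kf_high//; move: Q1; rewrite /q0; lra.
have E2 : BI e P Q = I0 e + (Q - 2 * q0 e).
  by rewrite /BI E1 hf_high ?addrA//; move: He p2 e0 P1; lra.
have [c1 c2] : chi e (I0 e + (Q - 2 * q0 e)) = 0 /\ dchi e (I0 e + (Q - 2 * q0 e)) = 0.
  by apply: chi_low => //; rewrite /Ib; move: Q2; rewrite /Qa; lra.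
by rewrite /FB E2 c1 c2 E1 mul0r !addr0 out_periodic.
Qed.

Lemma Q0_small X Y : - (3 / 4) <= Y <= 3 / 4 -> slope_lb R <= dtau e X -> `|Q0 e X Y| <= Clay R * e.
Proof.
move=> /andP[Y1 Y2] hc; have k0 := slope_lb_gt0 R.
have d0 : slope_lb R <= dP0 e X.
  by rewrite /dP0; have := Mm_gt1 ge; have := lam_gt0 ge; nra.
have d1 : 0 < dP0 e X by apply: lt_le_trans d0.
have y1 : `|if Y <= 0 then Y + 2^-1 else Y - 2^-1| <= 1.
  by case: (leP Y 0) => h; rewrite ler_norml; apply/andP; split; lra.
have c1 : (dP0 e X)^-1 <= (slope_lb R)^-1 by rewrite lef_pV2.
rewrite /Q0 !normrM normfV (gtr0_norm d1) (gtr0_norm e0).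
set y := `|_| in y1 *; have y0 : 0 <= y by exact: normr_ge0.
apply: (@le_trans _ _ (e * 1 * (slope_lb R)^-1)).
  by rewrite ler_pM ?mulr_ge0 ?invr_ge0 ?(ltW d1) ?(ltW e0)// ler_pM2l.
rewrite mulr1 mulrC ler_pM2r// /Clay -addrA lerDl.
by rewrite addr_ge0// divr_ge0 ?mulr_ge0 ?pi_ge0 ?(ltW (slit_end_gt0 R)).
Qed.

(** Each half of the cell leaves the ring through one end only. The range [3/4] makes neighbouring
    cells overlap; the overshoot of [1/4] in [Y] amounts to at most [q0 e / 2] in [Q0], less than
    [Qa e]. *)
Lemma Q0_bound X Y : - (3 / 4) <= Y <= 3 / 4 ->
  (Y <= 0 -> - Qa e < Q0 e X Y) /\ (0 < Y -> Q0 e X Y < Qa e).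
Proof.
move=> /andP[Y1 Y2]; have l0 := lam_gt0 ge.
have d1 : lam e <= dP0 e X.
  by rewrite /dP0 lerDl mulr_ge0 ?dtau_ge0//; have := Mm_gt1 ge; lra.
have d0 : 0 < dP0 e X by apply: lt_le_trans d1.
have q0g := q0_gt ge.
have El : e = lam e * (2 * q0 e).
  by rewrite /lam divfK// mulf_neq0// gt_eqF//; apply: lt_trans q0g.
have b : e / 4 < Qa e * dP0 e X.
  have : q0 e / 2 < Qa e by have := Qa_gt ge; have := e_lt4 ge; rewrite /q0; lra.
  by move: El d1 l0 (Qa_gt ge); nra.
split=> h; rewrite /Q0.
  by rewrite h ltr_pdivlMr//; move: e0 b; nra.
by rewrite leNgt h /= ltr_pdivrMr//; move: e0 b; nra.
Qed.

Lemma Q0_lb X Y : 0 < Y -> - q0 e < Q0 e X Y.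
Proof.
move=> Y0; have l0 := lam_gt0 ge.
have d1 : lam e <= dP0 e X.
  by rewrite /dP0 lerDl mulr_ge0 ?dtau_ge0//; have := Mm_gt1 ge; lra.
have d0 : 0 < dP0 e X by apply: lt_le_trans d1.
have q0g := q0_gt ge.
have El : e = lam e * (2 * q0 e).
  by rewrite /lam divfK// mulf_neq0// gt_eqF//; apply: lt_trans q0g.
have b : e / 2 <= q0 e * dP0 e X by move: El d1 q0g; nra.
by rewrite /Q0 leNgt Y0 /= ltr_pdivlMr//; move: e0 b; nra.
Qed.

Lemma dtau_centre : slope_lb R <= dtau e 0.
Proof.
have [_ es _] := ge; have s0 := slit_end_gt0 R.
rewrite /dtau /slope_lb expr2 ler_pM ?expR_ge0//; apply: drampe_lb => //.
  have := @rampe_le R e ge (0 + slit_end R); rewrite /Tt add0r => /(_ (ltW s0)).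
  by move: e0; lra.
by rewrite add0r; move: e0; lra.
Qed.

Lemma Phat_small X Y : -(3 / 4) <= X <= 3 / 4 -> -(3 / 4) <= Y <= 3 / 4 ->
  Qa e - e < `|Q0 e X Y| -> `|Phat e X| <= Clay R * e /\ X != 0.
Proof.
move=> hX hY hQ.
have nd : ~ slope_lb R <= dtau e X.
  move=> /(Q0_small hY) h; move: hQ; rewrite /Qa; have := Tp_gt ge.
  by have := e_lt4 ge; move: h He e0; lra.
split; first by have [] := layer_dichotomy ge hX.
by apply/eqP => X0; apply: nd; rewrite X0; exact: dtau_centre.
Qed.

Lemma gap_dP0 X : slit_end R <= `|X| -> dP0 e X = lam e.
Proof.
rewrite /dP0 ler_normr => /orP[] h.
  by have [_ ->] := tau_right ge h; rewrite mulr0 addr0.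
by have [_ ->] := @tau_left R e ge X ltac:(lra); rewrite mulr0 addr0.
Qed.

Lemma gap_Q X Y : slit_end R <= `|X| -> Qp e X Y = 2 * q0 e * (Y + 2^-1).
Proof.
move=> h; have q1 := q0_gt ge; have qn : q0 e != 0 by rewrite gt_eqF//; apply: lt_trans q1.
rewrite /Qp /Q0 gap_dP0// /lam; have en := e_neq0 ge.
by case: ifP => _; field; rewrite en qn.
Qed.

End Good.
End Cell.

(** * Local normal forms of the cell map *)

Section LocalChart.
Variables (R : realType) (V : normedModType R) (W : set V) (E X Y u v : V -> R).
Hypotheses (oW : open W) (sE : sm W E) (sX : sm W X) (sY : sm W Y).
Hypothesis gE : forall p, W p -> good (E p).
Hypothesis hX : forall p, W p -> -(3 / 4) <= X p <= 3 / 4.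
Hypothesis hY : forall p, W p -> -(3 / 4) <= Y p <= 3 / 4.

Lemma open_lt_sm (f g : V -> R) : sm W f -> sm W g -> open (W `&` [set p | f p < g p]).
Proof.
move=> sf sg; rewrite openE => p [Wp fg]; rewrite /interior.
have c : {for p, continuous (fun p => g p - f p)}.
  by apply: cvgB; [exact: sm_cont sg Wp | exact: sm_cont sf Wp].
have h : \forall q \near p, 0 < g q - f q.
  by apply: (cvgr_gt _ c); rewrite subr_gt0.
near=> q; split; first by near: q; exact: open_nbhs_nbhs.
by rewrite /= -subr_gt0; near: q.
Unshelve. all: by end_near. Qed.

(* Near [p0] the cell map is one of the two charts in variables [P], [Q] with
   [dP /\ dQ = e dX /\ dY]; the shear coefficient [k] is irrelevant. *)
Definition is_chart (p0 : V) (U : set V) (P Q : V -> R) (b : bool) :=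
  [/\ [/\ open U, U p0, U `<=` W, sm U P & sm U Q],
    forall p, U p -> if b then Qa (E p) - E p < Q p else 0 < I0 (E p) + Q p,
    forall p, U p -> cell (E p) (X p) (Y p) (u p) (v p) =
      (if b then FB (E p) (P p) (Q p) (u p) (v p) else FU (E p) (P p) (Q p) (u p) (v p)) &
    forall e, E = (fun=> e) -> exists k, forall w X' Y', is_derive p0 w X X' ->
      is_derive p0 w Y Y' -> is_derive p0 w P (dP0 e (X p0) * X') /\
      is_derive p0 w Q (e / dP0 e (X p0) * Y' + k * X')].

Lemma derive_P0 c e p w X' : good e -> is_derive p w X X' ->
  is_derive p w (fun p => P0 e (X p) + c) (dP0 e (X p) * X').
Proof.
move=> ge dX; have d := is_derive_compf dX (is_derive_P0 ge (X p)).
by have := is_deriveDf d (is_derive_cstf c p w); rewrite addr0.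
Qed.

Lemma derive_Q c d e p : good e -> exists k, forall w X' Y', is_derive p w X X' ->
  is_derive p w Y Y' ->
  is_derive p w (fun p => e * (Y p + c) / dP0 e (X p) + d) (e / dP0 e (X p) * Y' + k * X').
Proof.
move=> ge; have D0 := dP0_gt0 ge (X p).
have sd : derivable (dP0 e) (X p) 1.
  have oT := @openT R.
  have : sm setT (dP0 e) := sm_dP0 oT (sm_cst setT e) (fun _ _ => ge) (sm_id1 oT).
  by move=> sf; apply: sm_derivable sf _.
exists (- (e * (Y p + c) * 'D_1 (dP0 e) (X p) / dP0 e (X p) ^+ 2)) => w X' Y' dX dY.
have cst k := is_derive_cstf k p w.
have d1 := is_deriveVf (is_derive_compf dX (derivableP sd)) (lt0r_neq0 D0).
have d2 := is_deriveMf (is_deriveMf (cst e) (is_deriveDf dY (cst c))) d1.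
apply: (is_derive_eq (is_deriveDf d2 (cst d))) => /=.
by move: (dP0 e (X p)) (derive _ _ _) D0 => D D' D0; field; rewrite gt_eqF.
Qed.

Lemma mk_chart p0 (U : set V) (c c' : R) (d : R -> R) (b : bool) :
  sm W (fun p => d (E p)) -> open U -> U p0 -> U `<=` W ->
  (let Q p := E p * (Y p + c') / dP0 (E p) (X p) + d (E p) in
   forall p, U p ->
     (if b then Qa (E p) - E p < Q p else 0 < I0 (E p) + Q p) /\
     cell (E p) (X p) (Y p) (u p) (v p) =
     (if b then FB (E p) (P0 (E p) (X p) + c) (Q p) (u p) (v p)
      else FU (E p) (P0 (E p) (X p) + c) (Q p) (u p) (v p))) ->
  exists U P Q b, is_chart p0 U P Q b.
Proof.
move=> sd oU U0 UW h; exists U, (fun p => P0 (E p) (X p) + c),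
  (fun p => E p * (Y p + c') / dP0 (E p) (X p) + d (E p)), b.
have sP := sm_P0 oW sE gE sX; have sD := sm_dP0 oW sE gE sX.
have Dn p : W p -> dP0 (E p) (X p) != 0.
  by move=> /gE ge; rewrite gt_eqF// dP0_gt0.
split.
- by split => //; apply: sm_sub UW _; smooth_tac.
- by move=> p /h[].
- by move=> p /h[].
- move=> e Ee; have ge : good e by have := gE (UW _ U0); rewrite Ee.
  have [k hk] := derive_Q c' (d e) p0 ge; exists k => w X' Y' dX dY; rewrite Ee; split.
    exact: derive_P0.
  exact: hk.
Qed.

Lemma sign_chart p0 : W p0 -> X p0 != 0 -> exists c (S : set V),
  [/\ open (W `&` S), S p0 & forall p, S p -> Phat (E p) (X p) = P0 (E p) (X p) + c].
Proof.
move=> W0; rewrite neq_lt => /orP[h|h].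
  exists 0, [set p | X p < 0]; split => //; first by apply: open_lt_sm => //; exact: sm_cst.
  by move=> p /= hp; rewrite /Phat hp addr0.
exists (- (2 * pi)), [set p | 0 < X p]; split => //.
  by apply: open_lt_sm => //; exact: sm_cst.
by move=> p /= hp; rewrite /Phat ltNge (ltW hp).
Qed.

(** Where [|Q0| < Qa] the ring chart applies. Where [|Q0| >= Qa] the band chart does, on an open set
    that reaches back into the ring by [e] thanks to [FB_low] and [FB_high]. On [Y = 0] off the slit
    the band chart applies again, [Qp] being affine in [Y] there. *)
Lemma local_chart p0 : W p0 -> Y p0 != 0 \/ slit_end R < `|X p0| ->
  exists U P Q b, is_chart p0 U P Q b.
Proof.
move=> W0 hyp.
have sc c : sm W (fun=> c : R) by exact: sm_cst.
have sP := sm_P0 oW sE gE sX; have sD := sm_dP0 oW sE gE sX.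
have Dn p : W p -> dP0 (E p) (X p) != 0.
  by move=> /gE ge; rewrite gt_eqF// dP0_gt0.
have sQa := sm_Qa oW sE gE; have sq := sm_q0 oW sE gE.
pose QA p := E p * (Y p + 2^-1) / dP0 (E p) (X p).
pose QB p := E p * (Y p - 2^-1) / dP0 (E p) (X p).
have sQA : sm W QA by rewrite /QA; smooth_tac.
have sQB : sm W QB by rewrite /QB; smooth_tac.
have I0p p : W p -> Qa (E p) < I0 (E p).
  by move=> /gE ge; rewrite /I0; have := e_gt0 ge; lra.
have sb (S T : set V) : (W `&` S) `&` T `<=` W by move=> p [[]].
have [Yn|Yp|Y0] := ltgtP (Y p0) 0.
- have QE p : Y p < 0 -> Q0 (E p) (X p) (Y p) = QA p.
    by move=> h; rewrite /Q0 (ltW h).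
  have QpE p : Y p < 0 -> Qp (E p) (X p) (Y p) = QA p.
    by move=> h; rewrite /Qp QE// (ltW h) addr0.
  have [hU|hB] := ltP `|QA p0| (Qa (E p0)).
    apply: (@mk_chart p0 ((W `&` [set p | Y p < 0]) `&`
      ((W `&` [set p | QA p < Qa (E p)]) `&` (W `&` [set p | - QA p < Qa (E p)])))
      0 2^-1 (fun=> 0) false) => //.
    + by apply: openI; [|apply: openI]; apply: open_lt_sm => //; smooth_tac.
    + by move: hU; rewrite ltr_norml => /andP[h1 h2]; do !split => //=; lra.
    + move=> /= p [[Wp h] [[_ /= h1] [_ /= h2]]]; rewrite !addr0 -/(QA p).
      split; first by have := I0p p Wp; lra.
      rewrite /cell QE//.
      by have -> : `|QA p| < Qa (E p) by rewrite ltr_norml; apply/andP; split; lra.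
  have ge0 := gE W0; have ep := e_gt0 ge0.
  have [_ X0] : `|Phat (E p0) (X p0)| <= Clay R * E p0 /\ X p0 != 0.
    by apply: Phat_small (hX W0) (hY W0) _ => //; rewrite QE//; move: hB ep; lra.
  have hB' : Qa (E p0) <= QA p0.
    have [/(_ (ltW Yn)) hb _] := Q0_bound ge0 (X p0) (hY W0); rewrite QE// in hb.
    by move: hB; rewrite ler_normr => /orP[//|h]; move: h hb; lra.
  have [c [S [oS S0 hS]]] := sign_chart W0 X0.
  apply: (@mk_chart p0 ((W `&` [set p | Y p < 0]) `&`
      ((W `&` [set p | Qa (E p) - E p < QA p]) `&` (W `&` S))) c 2^-1 (fun=> 0) true) => //.
  + by apply: openI; [|apply: openI => //]; apply: open_lt_sm => //; smooth_tac.
  + by do !split => //=; move: hB' ep; lra.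
  + move=> /= p [[Wp h] [[_ /= h1] [_ Sp]]]; rewrite !addr0 -/(QA p); split => //.
    have ge := gE Wp; have epp := e_gt0 ge.
    rewrite -hS// /cell QE// QpE//; case: ltP => // hlt.
    have Q1 : QA p <= `|QA p| by exact: ler_norm.
    have [hP _] : `|Phat (E p) (X p)| <= Clay R * E p /\ X p != 0.
      by apply: Phat_small (hX Wp) (hY Wp) _ => //; rewrite QE//; lra.
    by rewrite FU_P0_Phat FB_low// h1 /=; lra.
- have QE p : 0 < Y p -> Q0 (E p) (X p) (Y p) = QB p.
    by move=> h; rewrite /Q0 leNgt h.
  have QpE p : 0 < Y p -> Qp (E p) (X p) (Y p) = QB p + 2 * q0 (E p).
    by move=> h; rewrite /Qp QE// leNgt h.
  have [hU|hB] := ltP `|QB p0| (Qa (E p0)).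
    apply: (@mk_chart p0 ((W `&` [set p | 0 < Y p]) `&`
      ((W `&` [set p | QB p < Qa (E p)]) `&` (W `&` [set p | - QB p < Qa (E p)])))
      0 (- 2^-1) (fun=> 0) false) => //.
    + by apply: openI; [|apply: openI]; apply: open_lt_sm => //; smooth_tac.
    + by move: hU; rewrite ltr_norml => /andP[h1 h2]; do !split => //=; lra.
    + move=> /= p [[Wp h] [[_ /= h1] [_ /= h2]]]; rewrite !addr0 -/(QB p).
      split; first by have := I0p p Wp; lra.
      rewrite /cell QE//.
      by have -> : `|QB p| < Qa (E p) by rewrite ltr_norml; apply/andP; split; lra.
  have ge0 := gE W0; have ep := e_gt0 ge0.
  have [_ X0] : `|Phat (E p0) (X p0)| <= Clay R * E p0 /\ X p0 != 0.
    by apply: Phat_small (hX W0) (hY W0) _ => //; rewrite QE//; move: hB ep; lra.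
  have hB' : QB p0 <= - Qa (E p0).
    have [_ /(_ Yp) hb] := Q0_bound ge0 (X p0) (hY W0); rewrite QE// in hb.
    by move: hB; rewrite ler_normr => /orP[h|h]; move: h hb; lra.
  have [c [S [oS S0 hS]]] := sign_chart W0 X0.
  apply: (@mk_chart p0 ((W `&` [set p | 0 < Y p]) `&`
      ((W `&` [set p | QB p < - Qa (E p) + E p]) `&` (W `&` S))) c (- 2^-1)
      (fun e => 2 * q0 e) true) => //.
  + by smooth_tac.
  + by apply: openI; [|apply: openI => //]; apply: open_lt_sm => //; smooth_tac.
  + by do !split => //=; move: hB' ep; lra.
  + move=> /= p [[Wp h] [[_ /= h1] [_ Sp]]]; rewrite -/(QB p).
    have ge := gE Wp; have epp := e_gt0 ge.
    have hb := Q0_lb ge (X p) h; rewrite QE// in hb.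
    split; first by rewrite /q0 in hb *; move: epp; lra.
    rewrite -hS// /cell QE// QpE//; case: ltP => // hlt.
    have Q1 : - QB p <= `|QB p| by rewrite -normrN; exact: ler_norm.
    have [hP _] : `|Phat (E p) (X p)| <= Clay R * E p /\ X p != 0.
      by apply: Phat_small (hX Wp) (hY Wp) _ => //; rewrite QE//; lra.
    by rewrite FU_P0_Phat FB_high ?addrK//; apply/andP; split; lra.
- have hg : slit_end R < `|X p0| by case: hyp => //; rewrite Y0 eqxx.
  have X0 : X p0 != 0.
    by apply: contraTneq hg => ->; rewrite normr0 -leNgt ltW// slit_end_gt0.
  have [c [S [oS S0 hS]]] := sign_chart W0 X0.
  have ge0 := gE W0; have ep := e_gt0 ge0.
  (* The two conditions on [Y] keep [Qp] farther than [Qa] from both ends of its period [[0, 2 q0]],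
     so the ring branch of [cell] does not occur. *)
  apply: (@mk_chart p0 ((W `&` [set p | (slit_end R) ^+ 2 < X p ^+ 2]) `&`
      ((W `&` [set p | Qa (E p) < 2 * q0 (E p) * (2^-1 - Y p)]) `&`
      ((W `&` [set p | Qa (E p) < 2 * q0 (E p) * (2^-1 + Y p)]) `&` (W `&` S))))
      c 2^-1 (fun=> 0) true) => //.
  + by apply: openI; [|apply: openI; [|apply: openI => //]]; apply: open_lt_sm => //; smooth_tac.
  + have s0 := slit_end_gt0 R; do !split => //=.
    * by move: hg; rewrite -[X p0 ^+ 2]real_normK ?num_real// => hg; nra.
    * by rewrite Y0 subr0 /q0; lra.
    * by rewrite Y0 addr0 /q0; lra.
  + move=> /= p [[Wp h] [[_ /= h1] [[_ /= h2] [_ Sp]]]]; rewrite !addr0.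
    have ge := gE Wp; have epp := e_gt0 ge.
    have hp : slit_end R <= `|X p|.
      move: h; rewrite -[X p ^+ 2]real_normK ?num_real//.
      by have := normr_ge0 (X p); have := slit_end_gt0 R; nra.
    have GE : E p * (Y p + 2^-1) / dP0 (E p) (X p) = Qp (E p) (X p) (Y p).
      rewrite gap_Q// gap_dP0// /lam; have q1 := q0_gt ge.
      have qn : q0 (E p) != 0 by rewrite gt_eqF//; apply: lt_trans q1.
      by have en := e_neq0 ge; field; rewrite en qn.
    rewrite GE; split; first by rewrite gap_Q// (addrC (Y p)); lra.
    rewrite -hS// /cell; case: ltP => // hlt; exfalso.
    have := gap_Q ge (Y p) hp; rewrite /Qp; case: ifP => y0 Eq.
      by move: hlt; rewrite ltr_norml => /andP[_]; move: Eq h2; rewrite addr0 => ->; lra.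
    by move: hlt; rewrite ltr_norml => /andP[+ _]; move: Eq h1; lra.
Qed.

End LocalChart.

Section CellCalculus.
Variables (R : realType) (V : normedModType R) (W : set V) (E X Y u v : V -> R).
Hypotheses (oW : open W) (sE : sm W E) (sX : sm W X) (sY : sm W Y).
Hypotheses (su : sm W u) (sv : sm W v).
Hypothesis gE : forall p, W p -> good (E p).
Hypothesis hX : forall p, W p -> -(3 / 4) <= X p <= 3 / 4.
Hypothesis hY : forall p, W p -> -(3 / 4) <= Y p <= 3 / 4.
Hypothesis u0 : forall p, W p -> 0 < u p.
Hypothesis hS : forall p, W p -> Y p != 0 \/ slit_end R < `|X p|.

Lemma sm_cell : sm W (fun p => cell (E p) (X p) (Y p) (u p) (v p)).
Proof.
apply: sm_local => p Wp.
have [U [P [Q [b [[oU Up UW sP sQ] side agree _]]]]] :=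
  @local_chart R V W E X Y u v oW sE sX sY gE hX hY p Wp (hS Wp).
exists U => //.
have sE' := sm_sub UW sE; have su' := sm_sub UW su; have sv' := sm_sub UW sv.
have gE' q : U q -> good (E q) by move=> /UW/gE.
have u0' q : U q -> 0 < u q by move=> /UW/u0.
apply: (sm_eq oU (fun q Uq => esym (agree q Uq))).
by case: b side {agree} => side; [apply: sm_FB | apply: sm_FU].
Qed.

Lemma cell_symplectic (e : R) p a b Xa Xb Ya Yb ua ub va vb : E = (fun=> e) -> W p ->
  is_derive p a X Xa -> is_derive p b X Xb -> is_derive p a Y Ya -> is_derive p b Y Yb ->
  is_derive p a u ua -> is_derive p b u ub -> is_derive p a v va -> is_derive p b v vb ->
  let F p := cell (E p) (X p) (Y p) (u p) (v p) in
  omega4 ('D_a F p) ('D_b F p) = e * (Xa * Yb - Xb * Ya) + (ua * vb - ub * va).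
Proof.
move=> Ee Wp dXa dXb dYa dYb dua dub dva dvb F.
have [U [P [Q [c [[oU Up UW sP sQ] side agree der]]]]] :=
  @local_chart R V W E X Y u v oW sE sX sY gE hX hY p Wp (hS Wp).
have ge : good e by have := gE Wp; rewrite Ee.
have [k hk] := der _ Ee; have [dPa dQa] := hk _ _ _ dXa dYa; have [dPb dQb] := hk _ _ _ dXb dYb.
have D0 := dP0_gt0 ge (X p).
have nE G : (forall q, U q -> F q = G q) -> forall w, 'D_w F p = 'D_w G p.
  move=> FG w; apply: near_eq_derive; near=> q; apply: FG; near: q.
  exact: open_nbhs_nbhs.
have Up0 := u0 Wp.
(* In [dP /\ dQ] the shear term [k] cancels and the slope [dP0] cancels its inverse. *)
have -> : e * (Xa * Yb - Xb * Ya) + (ua * vb - ub * va) =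
  (dP0 e (X p) * Xa * (e / dP0 e (X p) * Yb + k * Xb) -
   dP0 e (X p) * Xb * (e / dP0 e (X p) * Ya + k * Xa)) + (ua * vb - ub * va).
  by field; rewrite gt_eqF.
case: c side agree => side agree.
  have hF := nE (fun p => FB e (P p) (Q p) (u p) (v p)).
  rewrite !hF; try by move=> q Uq; rewrite /F (agree q Uq) Ee.
  have h : Qa e - e < Q p by have := side p Up; rewrite Ee.
  exact: (FB_symplectic ge dPa dPb dQa dQb dua dub dva dvb Up0 h).
have hF := nE (fun p => FU e (P p) (Q p) (u p) (v p)).
rewrite !hF; try by move=> q Uq; rewrite /F (agree q Uq) Ee.
have h : 0 < I0 e + Q p by have := side p Up; rewrite Ee.
exact: (FU_symplectic dPa dPb dQa dQb dua dub dva dvb Up0 h).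
Unshelve. all: by end_near. Qed.

End CellCalculus.

(** * The map on the punctured torus *)

Section TorusMap.
Variable R : realType.
Implicit Types (e x y z w : R).

(** Keeps the slit away from the strips [|x| >= 1/4] on which neighbouring cells are compared;
    [exp 16 >= 17] is enough. *)
Lemma slit_end_lt4 : slit_end R < 4^-1.
Proof.
have h := slit_end_gt0 R; have := slit_end_sqr R; rewrite /slitG add0r subr0.
have : flat 1 (16^-1 : R) <= 17^-1.
  rewrite /flat; case: ltP => // _; rewrite hornerC mul1r invrK expRN lef_pV2 ?posrE ?expR_gt0//.
  by have := expR_ge1Dx (16 : R); lra.
by nra.
Qed.

Lemma gap_P0 e x : good e -> x <= - slit_end R -> slit_end R <= x + 1 -> P0 e (x + 1) = P0 e x + 2 * pi.
Proof.
move=> ge h1 h2; have [t1 _] := tau_left ge h1; have [t2 _] := tau_right ge h2.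
by rewrite /P0 t1 t2 -(MmE ge); ring.
Qed.

(** [x] and [x + 1] lie off the slit on opposite sides: [P0] gains [2 pi], which [out] does not see,
    and the recentred [Phat] does not change. *)
Lemma cell_shiftX e x y u v : good e -> -(3 / 4) <= x <= -(1 / 4) ->
  cell e (x + 1) y u v = cell e x y u v.
Proof.
move=> ge /andP[x1 x2]; have s4 := slit_end_lt4; have s0 := slit_end_gt0 R.
have h1 : x <= - slit_end R by lra.
have h2 : slit_end R <= x + 1 by lra.
have n1 : slit_end R <= `|x| by rewrite ler_normr; apply/orP; right; lra.
have n2 : slit_end R <= `|x + 1| by rewrite ler_normr h2.
have x3 : x < 0 by lra.
have x4 : (x + 1 < 0) = false by apply/negbTE; rewrite -leNgt; lra.
have EP := gap_P0 ge h1 h2.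
have ED : dP0 e (x + 1) = dP0 e x by rewrite (gap_dP0 ge n1) (gap_dP0 ge n2).
have EQ : Q0 e (x + 1) y = Q0 e x y by rewrite /Q0 ED.
have EPh : Phat e (x + 1) = Phat e x.
  by rewrite /Phat EP x4 x3 addrK.
by rewrite /cell /Qp EQ EPh /FU EP out_periodic.
Qed.

(** [Q0] takes the same value at both points, and the one-sided bounds of [Q0_bound], one from each
    point, place that value on the ring. *)
Lemma cell_shiftY e x y u v : good e -> -(3 / 4) <= y <= -(1 / 4) ->
  cell e x (y + 1) u v = cell e x y u v.
Proof.
move=> ge /andP[y1 y2].
have EQ : Q0 e x (y + 1) = Q0 e x y.
  rewrite /Q0; have -> : (y + 1 <= 0) = false by apply/negbTE; rewrite -ltNge; lra.
  have -> : y <= 0 by lra.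
  by congr (_ * _ / _); lra.
have hY : -(3 / 4) <= y <= 3 / 4 by lra.
have hY' : -(3 / 4) <= y + 1 <= 3 / 4 by lra.
have [/(_ ltac:(lra)) h1 _] := Q0_bound ge x hY.
have [_ /(_ ltac:(lra)) h2] := Q0_bound ge x hY'.
have h : `|Q0 e x y| < Qa e by rewrite ltr_norml h1 -EQ.
by rewrite /cell EQ h.
Qed.

Definition cell_map e x y z w := cell e (slitX x y) (slitY x y) (uf e z) (vf e z w).

Lemma rho_ge (x y : R) : 1 / 4 <= `|x| \/ 1 / 4 <= `|y| -> 16^-1 <= rho x y.
Proof.
have H (t : R) : 1 / 4 <= `|t| -> 16^-1 <= t ^+ 2.
  by move=> h; rewrite -real_normK ?num_real//; nra.
by case=> /H h; rewrite /rho; [have := sqr_ge0 y | have := sqr_ge0 x]; lra.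
Qed.

Lemma H0_shiftX e x y z w : good e -> -(3 / 4) <= x <= -(1 / 4) ->
  cell_map e (x + 1) y z w = cell_map e x y z w.
Proof.
move=> ge /andP[x1 x2].
have n1 : 1 / 4 <= `|x| by rewrite ler0_norm; lra.
have n2 : 1 / 4 <= `|x + 1| by rewrite ger0_norm; lra.
have [a1 a2] := slit_id (rho_ge (or_introl n1) : 16^-1 <= rho x y).
have [b1 b2] := slit_id (rho_ge (or_introl n2) : 16^-1 <= rho (x + 1) y).
by rewrite /cell_map a1 a2 b1 b2 cell_shiftX//; lra.
Qed.

Lemma H0_shiftY e x y z w : good e -> -(3 / 4) <= y <= -(1 / 4) ->
  cell_map e x (y + 1) z w = cell_map e x y z w.
Proof.
move=> ge /andP[y1 y2].
have n1 : 1 / 4 <= `|y| by rewrite ler0_norm; lra.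
have n2 : 1 / 4 <= `|y + 1| by rewrite ger0_norm; lra.
have [a1 a2] := slit_id (rho_ge (or_intror n1) : 16^-1 <= rho x y).
have [b1 b2] := slit_id (rho_ge (or_intror n2) : 16^-1 <= rho x (y + 1)).
by rewrite /cell_map a1 a2 b1 b2 cell_shiftY//; lra.
Qed.

Definition nearest x : int := Num.floor (x + 2^-1).
Definition torus_map e x y z w := cell_map e (x - (nearest x)%:~R) (y - (nearest y)%:~R) z w.

Lemma nearest_bounds x : - 2^-1 <= x - (nearest x)%:~R < 2^-1.
Proof.
have := floor_le (x + 2^-1); have := floorD1_gt (x + 2^-1); rewrite -/(nearest x).
by rewrite intrD /=; lra.
Qed.

Lemma rd_cases x (n : int) : -(3 / 4) < x - n%:~R < 3 / 4 ->
  [\/ nearest x = n, nearest x = n - 1 | nearest x = n + 1].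
Proof.
move=> /andP[h1 h2]; have /andP[r1 r2] := nearest_bounds x.
have l1 : (n%:~R : R) - (nearest x)%:~R < (2 : int)%:~R by rewrite /=; lra.
have l2 : (nearest x)%:~R - (n%:~R : R) < (2 : int)%:~R by rewrite /=; lra.
rewrite -intrB ltr_int in l1; rewrite -intrB ltr_int in l2.
have [E|[E|E]] : nearest x = n \/ nearest x = n - 1 \/ nearest x = n + 1 by lia.
- by constructor 1.
- by constructor 2.
- by constructor 3.
Qed.

(** [nearest] jumps at half-integers. Independence of the representative within distance [3/4] is
    what makes the map smooth there. *)
Lemma torus_map_local e x y z w (n m : int) : good e -> -(3 / 4) < x - n%:~R < 3 / 4 ->
  -(3 / 4) < y - m%:~R < 3 / 4 -> torus_map e x y z w = cell_map e (x - n%:~R) (y - m%:~R) z w.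
Proof.
move=> ge hx hy; rewrite /torus_map.
have Hx t : cell_map e (x - (nearest x)%:~R) t z w = cell_map e (x - n%:~R) t z w.
  have /andP[r1 r2] := nearest_bounds x; have /andP[h1 h2] := hx.
  have [E|E|E] := rd_cases hx; first by rewrite E.
    have E' : x - (nearest x)%:~R = (x - n%:~R) + 1 by rewrite E intrD /=; ring.
    by rewrite E' H0_shiftX//; rewrite E' in r1 r2; lra.
  have E' : x - n%:~R = (x - (nearest x)%:~R) + 1 by rewrite E intrD /=; ring.
  by rewrite E' H0_shiftX//; rewrite E' in h1 h2; lra.
have Hy t : cell_map e t (y - (nearest y)%:~R) z w = cell_map e t (y - m%:~R) z w.
  have /andP[r1 r2] := nearest_bounds y; have /andP[h1 h2] := hy.
  have [E|E|E] := rd_cases hy; first by rewrite E.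
    have E' : y - (nearest y)%:~R = (y - m%:~R) + 1 by rewrite E intrD /=; ring.
    by rewrite E' H0_shiftY//; rewrite E' in r1 r2; lra.
  have E' : y - m%:~R = (y - (nearest y)%:~R) + 1 by rewrite E intrD /=; ring.
  by rewrite E' H0_shiftY//; rewrite E' in h1 h2; lra.
by rewrite Hx Hy.
Qed.

Lemma torus_map_periodic e x y z w (n m : int) : good e ->
  torus_map e (x + n%:~R) (y + m%:~R) z w = torus_map e x y z w.
Proof.
move=> ge.
have sh (t : R) (k : int) : t + k%:~R - (nearest t + k)%:~R = t - (nearest t)%:~R by rewrite intrD; ring.
have hb (t : R) (k : int) : -(3 / 4) < t + k%:~R - (nearest t + k)%:~R < 3 / 4.
  by rewrite sh; have := nearest_bounds t; lra.
by rewrite (torus_map_local z w ge (hb x n) (hb y m)) !sh.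
Qed.

Definition nonlat x y := ~ exists m n : int, x = m%:~R /\ y = n%:~R.

Lemma nonlat_rho x y (n m : int) : nonlat x y -> 0 < rho (x - n%:~R) (y - m%:~R).
Proof.
move=> h; rewrite lt0r /rho addr_ge0 ?sqr_ge0// andbT paddr_eq0 ?sqr_ge0//.
rewrite !sqrf_eq0 !subr_eq0; apply/negP => /andP[/eqP hx /eqP hy].
by apply: h; exists n, m.
Qed.

Lemma slit_cell_bounds x y : 0 < rho x y -> -(3 / 4) <= x <= 3 / 4 -> -(3 / 4) <= y <= 3 / 4 ->
  (-(3 / 4) <= slitX x y <= 3 / 4) /\ (-(3 / 4) <= slitY x y <= 3 / 4).
Proof.
move=> r0 hx hy; have [h|h] := leP 16^-1 (rho x y); first by have [-> ->] := slit_id h.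
have h1 := slitX_sqr_le r0; have h2 := slitY_sqr_le r0.
have h3 := slitG_lt h; rewrite (slitG_id (lexx _)) in h3.
have K (t : R) : t ^+ 2 < 16^-1 -> -(3 / 4) <= t <= 3 / 4.
  by move=> ht; apply/andP; split; nra.
by split; apply: K; [exact: le_lt_trans h1 h3 | exact: le_lt_trans h2 h].
Qed.

Lemma slit_gap x y : 0 < rho x y -> slitY x y != 0 \/ slit_end R < `|slitX x y|.
Proof.
move=> r0; have [h|] := eqVneq (slitY x y) 0; last by left.
right; have := slit_avoid r0 h; rewrite -slit_end_sqr -[slitX x y ^+ 2]real_normK ?num_real//.
by have := slit_end_gt0 R; have := normr_ge0 (slitX x y); nra.
Qed.

End TorusMap.

(** Area preservation: with [G' = (1 + 2 K) G / rho] the wedge acquires the numerator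
    [(c^2 + s^2) + 2 K (c^2 - s^2)], which equals the denominator of [th] because
    [c^2 + s^2 = 1]. *)
Lemma slit_wedge (R : realType) (x y f1 g1 f2 g2 : R) : 0 < rho x y ->
  let r := rho x y in let c := slitc x y in let s := slits x y in
  let q := Num.sqrt (slitG r) in
  let th f g := ((x * g - y * f) / r - 2 * 'D_1 (@slitK R) r * (x * f + y * g) * (2 * (c * s)))
    / (1 + 2 * slitK r * (c ^+ 2 - s ^+ 2)) in
  let A f g := slitdG r * (x * f + y * g) / q * c - q * s * th f g in
  let B f g := (2 * (x * f + y * g) / q - r * slitdG r * (x * f + y * g) / (slitG r * q)) * s
    + r / q * c * th f g in
  A f1 g1 * B f2 g2 - A f2 g2 * B f1 g1 = f1 * g2 - f2 * g1.
Proof.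
move=> r0 r c s q th A B.
have cs : c ^+ 2 + s ^+ 2 = 1 := slit_cs1 r0.
have G0 := slitG_gt0 r0; rewrite -/r in G0.
have q0 : q != 0 by rewrite gt_eqF// sqrtr_gt0.
have q2 : q ^+ 2 = slitG r by rewrite sqr_sqrtr// ltW.
have rn0 : r != 0 by rewrite gt_eqF.
have /andP[k1 k2] := slitK_bound r0; rewrite -/r in k1 k2.
have dn : 1 + 2 * slitK r * (c ^+ 2 - s ^+ 2) != 0.
  have c2 := sqr_ge0 c; have s2 := sqr_ge0 s.
  by rewrite gt_eqF//; move: cs c2 s2 k1 k2; set K := slitK r; set C := c ^+ 2; set S := s ^+ 2; nra.
have dGE : slitdG r = (1 + 2 * slitK r) * q ^+ 2 / r.
  by rewrite q2 /slitK; field; rewrite rn0 gt_eqF.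
have rE : r = x ^+ 2 + y ^+ 2 by [].
rewrite /A /B /th -q2 dGE; move: (derive _ _ _) (slitK r) dn => D K dn.
have -> : f1 * g2 - f2 * g1 = ((c ^+ 2 + s ^+ 2) + 2 * K * (c ^+ 2 - s ^+ 2)) /
    (1 + 2 * K * (c ^+ 2 - s ^+ 2)) * ((x ^+ 2 + y ^+ 2) * (f1 * g2 - f2 * g1)) / r.
  by rewrite cs divff// mul1r -rE mulrAC divff// mul1r.
clear q2 dGE G0 cs rE k1 k2 A B th; move: r c s q dn q0 rn0 r0 => r c s q dn q0 rn0 r0.
by field; rewrite ?dn ?q0 ?rn0.
Qed.

Section TorusCalculus.
Variables (R : realType) (V : normedModType R) (W : set V) (E x y z w : V -> R).
Hypotheses (oW : open W) (sE : sm W E) (sx : sm W x) (sy : sm W y).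
Hypotheses (sz : sm W z) (sw : sm W w).
Hypothesis gE : forall p, W p -> good (E p).
Hypothesis hl : forall p, W p -> nonlat (x p) (y p).
Hypothesis hz : forall p, W p -> z p ^+ 2 + w p ^+ 2 < 1.

Let F p := torus_map (E p) (x p) (y p) (z p) (w p).

Let nb (n m : int) := W `&` [set p | -(3 / 4) < x p - n%:~R] `&` (W `&` [set p | x p - n%:~R < 3 / 4])
  `&` (W `&` [set p | -(3 / 4) < y p - m%:~R] `&` (W `&` [set p | y p - m%:~R < 3 / 4])).

Let open_nb n m : open (nb n m).
Proof.
by apply: openI; apply: openI; apply: open_lt_sm => //; smooth_tac.
Qed.

Let nbW n m : nb n m `<=` W. Proof. by move=> p [[[]]]. Qed.

Let nb_rd p : W p -> nb (nearest (x p)) (nearest (y p)) p.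
Proof.
by move=> Wp; have := nearest_bounds (x p); have := nearest_bounds (y p); do !split => //=; lra.
Qed.

Let nbF n m p : nb n m p ->
  F p = cell (E p) (slitX (x p - n%:~R) (y p - m%:~R)) (slitY (x p - n%:~R) (y p - m%:~R))
    (uf (E p) (z p)) (vf (E p) (z p) (w p)).
Proof.
move=> [[[Wp /= h1] [_ /= h2]] [[_ /= h3] [_ /= h4]]].
by rewrite /F (@torus_map_local _ _ _ _ _ _ n m (gE Wp)) ?h1 ?h2 ?h3 ?h4.
Qed.

Let zb p : W p -> -1 < z p < 1.
Proof. by move=> /hz h; have h2 := sqr_ge0 (w p); apply/andP; split; nra. Qed.

Let nbX n m p : nb n m p ->
  let X := slitX (x p - n%:~R) (y p - m%:~R) in let Y := slitY (x p - n%:~R) (y p - m%:~R) in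
  [/\ -(3 / 4) <= X <= 3 / 4, -(3 / 4) <= Y <= 3 / 4 & Y != 0 \/ slit_end R < `|X|].
Proof.
move=> [[[Wp /= h1] [_ /= h2]] [[_ /= h3] [_ /= h4]]].
have r0 := nonlat_rho n m (hl Wp).
have b1 : -(3 / 4) <= x p - n%:~R <= 3 / 4 by rewrite !ltW.
have b2 : -(3 / 4) <= y p - m%:~R <= 3 / 4 by rewrite !ltW.
have [a b] := slit_cell_bounds r0 b1 b2.
by split => //; exact: slit_gap.
Qed.

Let sms n m : sm (nb n m) (fun p => slitX (x p - n%:~R) (y p - m%:~R)) /\
  sm (nb n m) (fun p => slitY (x p - n%:~R) (y p - m%:~R)).
Proof.
have s1 : sm (nb n m) (fun p => x p - n%:~R) by apply: sm_sub (@nbW n m) _; smooth_tac.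
have s2 : sm (nb n m) (fun p => y p - m%:~R) by apply: sm_sub (@nbW n m) _; smooth_tac.
have r0 p : nb n m p -> 0 < rho (x p - n%:~R) (y p - m%:~R).
  by move=> /nbW/hl; exact: nonlat_rho.
by split; [apply: sm_slitX | apply: sm_slitY].
Qed.

Lemma sm_torus_map : sm W F.
Proof.
apply: sm_local => p Wp; exists (nb (nearest (x p)) (nearest (y p))); first exact: nb_rd.
set n := nearest (x p); set m := nearest (y p); have [s1 s2] := sms n m.
apply: (sm_eq (open_nb n m) (fun q h => esym (nbF h))).
have sE' := sm_sub (@nbW n m) sE.
have gE' q : nb n m q -> good (E q) by move=> /nbW/gE.
apply: sm_cell => //.
- apply: sm_uf => //; first exact: sm_sub (@nbW n m) sz.
  by move=> q /nbW/zb.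
- apply: sm_vf => //; [exact: sm_sub (@nbW n m) sz | exact: sm_sub (@nbW n m) sw |].
  by move=> q /nbW/zb.
- by move=> q /nbX[].
- by move=> q /nbX[].
- move=> q h; have /andP[//] := uf_bounds (e_gt0 (gE' q h)) (zb (nbW h)).
- by move=> q /nbX[].
Qed.

Lemma torus_map_symplectic (e : R) p a b xa xb ya yb za zb' wa wb : E = (fun=> e) -> W p ->
  is_derive p a x xa -> is_derive p b x xb -> is_derive p a y ya -> is_derive p b y yb ->
  is_derive p a z za -> is_derive p b z zb' -> is_derive p a w wa -> is_derive p b w wb ->
  omega4 ('D_a F p) ('D_b F p) = e * (xa * yb - xb * ya) + (za * wb - zb' * wa).
Proof.
move=> Ee Wp dxa dxb dya dyb dza dzb dwa dwb.
set n := nearest (x p); set m := nearest (y p); have [s1 s2] := sms n m.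
have ge : good e by have := gE Wp; rewrite Ee.
have e0 := e_gt0 ge; have zp := zb Wp.
have D0 := duf_gt0 e0 zp.
have nE d : 'D_d F p = 'D_d (fun p => cell (E p) (slitX (x p - n%:~R) (y p - m%:~R))
    (slitY (x p - n%:~R) (y p - m%:~R)) (uf (E p) (z p)) (vf (E p) (z p) (w p))) p.
  apply: near_eq_derive; near=> q; apply: nbF; near: q.
  by apply: open_nbhs_nbhs; split; [exact: open_nb | exact: nb_rd].
apply: etrans (f_equal2 (@omega4 R) (nE a) (nE b)) _.
have r0 := nonlat_rho n m (hl Wp).
have shift d f f' (k : R) : is_derive p d f f' -> is_derive p d (fun p => f p - k) f'.
  by move=> df; have := is_deriveBf df (is_derive_cstf k p d); rewrite subr0.
have sE' := sm_sub (@nbW n m) sE.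
have gE' q : nb n m q -> good (E q) by move=> /nbW/gE.
have du d z' : is_derive p d z z' ->
    is_derive p d (fun p => uf (E p) (z p)) (duf e (z p) * z').
  by move=> dz; rewrite Ee; exact: is_derive_compf dz (is_derive_uf e0 zp).
have ddu : is_derive (z p) 1 (duf e) ('D_1 (duf e) (z p)).
  apply: derivableP; have oI : open [set t : R | -1 < t < 1].
    have -> : [set t : R | -1 < t < 1] = [set t | -1 < t] `&` [set t | t < 1].
      by apply/seteqP; split => t /=; [move=> /andP[] | move=> [-> ->]].
    by apply: openI; [exact: open_gt | exact: open_lt].
  have s : sm [set t : R | -1 < t < 1] (duf e).
    exact: (sm_duf oI (sm_cst _ e) (fun _ _ => ge) (sm_id1 oI) (fun t h => h)).
  exact: sm_derivable s zp.
pose k := - (w p * 'D_1 (duf e) (z p) / duf e (z p) ^+ 2).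
have dv d z' w' : is_derive p d z z' -> is_derive p d w w' ->
    is_derive p d (fun p => vf (E p) (z p) (w p)) ((duf e (z p))^-1 * w' + k * z').
  move=> dz dw; rewrite Ee.
  have d1 := is_deriveVf (is_derive_compf dz ddu) (lt0r_neq0 D0).
  apply: (is_derive_eq (is_deriveMf dw d1)); rewrite /k.
  by move: (duf e (z p)) (derive _ _ _) D0 => D D' D0; field; rewrite gt_eqF.
have [den Xa Ya] := is_derive_slit (shift a _ _ n%:~R dxa) (shift a _ _ m%:~R dya) r0.
have [_ Xb Yb] := is_derive_slit (shift b _ _ n%:~R dxb) (shift b _ _ m%:~R dyb) r0.
have gX q (h : nb n m q) : -(3 / 4) <= slitX (x q - n%:~R) (y q - m%:~R) <= 3 / 4 by have [] := nbX h.
have gY q (h : nb n m q) : -(3 / 4) <= slitY (x q - n%:~R) (y q - m%:~R) <= 3 / 4 by have [] := nbX h.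
have gS q (h : nb n m q) : slitY (x q - n%:~R) (y q - m%:~R) != 0 \/ slit_end R < `|slitX (x q - n%:~R) (y q - m%:~R)| by have [] := nbX h.
have gu q (h : nb n m q) : 0 < uf (E q) (z q).
  by have /andP[] := uf_bounds (e_gt0 (gE' q h)) (zb (nbW h)).
have := @cell_symplectic R V (nb n m) E _ _ _ _ (@open_nb n m) sE' s1 s2 gE' gX gY gu gS e p a b
  _ _ _ _ _ _ _ _ Ee (nb_rd Wp) Xa Xb Ya Yb (du _ _ dza) (du _ _ dzb) (dv _ _ _ dza dwa) (dv _ _ _ dzb dwb).
move=> /= ->; congr (_ * _ + _); last first.
  by clearbody k; field; rewrite gt_eqF.
exact: (slit_wedge xa ya xb yb r0).
Unshelve. all: by end_near. Qed.

End TorusCalculus.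

(** * Injectivity and the bound *)

(* [lra] compares atoms up to conversion, so the profiles must be hidden from it. *)
Ltac opaque_lra :=
  repeat match goal with
  | H := _ |- _ => clearbody H
  end;
  repeat match goal with
  | H : is_true _ |- _ => revert H
  | H : @eq (Num.RealField.sort _) _ _ |- _ => revert H
  | H : @eq (GRing.Nmodule.sort _) _ _ |- _ => revert H
  | H : @eq (Real.sort _) _ _ |- _ => revert H
  end;
  repeat match goal with
  | |- context [Bph ?a ?b ?c] => generalize (Bph a b c)
  | |- context [BI ?a ?b ?c] => generalize (BI a b c)
  | |- context [kf ?a ?b] => generalize (kf a b)
  | |- context [hf ?a ?b] => generalize (hf a b)
  | |- context [dP0 ?a ?b] => generalize (dP0 a b)
  | |- context [Qp ?a ?b ?c] => generalize (Qp a b c)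
  | |- context [Q0 ?a ?b ?c] => generalize (Q0 a b c)
  | |- context [Phat ?a ?b] => generalize (Phat a b)
  | |- context [P0 ?a ?b] => generalize (P0 a b)
  | |- context [Qa ?a] => generalize (Qa a)
  | |- context [q0 ?a] => generalize (q0 a)
  | |- context [I0 ?a] => generalize (I0 a)
  | |- context [It ?a] => generalize (It a)
  | |- context [Tp ?a] => generalize (Tp a)
  | |- context [Lu ?a] => generalize (Lu a)
  | |- context [ac ?a] => generalize (ac a)
  | |- context [lam ?a] => generalize (lam a)
  | |- context [slit_end ?a] => generalize (slit_end a)
  | |- context [Clay ?a] => generalize (Clay a)
  | |- context [@pi ?a] => generalize (@pi a)
  end; intros; (lra || nra).

Section Injectivity.
Variables (R : realType) (e : R).
Hypothesis ge : good e.
Implicit Types (X Y P Q u v : R).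

Let e0 : 0 < e := e_gt0 ge.
Let C2 : 2 < Clay R := @Clay_gt2 R.
Let He : Clay R * e < 1 - 2 * e := Clay_e ge.
Let p2 : 2 <= pi :> R := pi_ge2 R.

Lemma P0_lt X X' : X < X' -> P0 e X < P0 e X'.
Proof.
move=> XX; have [] := @MVT R (P0 e) (dP0 e) X X' XX.
- by move=> t _; exact: is_derive_P0.
- apply: continuous_subspaceT => t; apply/differentiable_continuous/derivable1_diffP.
  by case: (is_derive_P0 ge t).
move=> t _ E; rewrite -subr_gt0 E mulr_gt0 ?dP0_gt0// subr_gt0//.
Qed.

Lemma P0_inj X X' : P0 e X = P0 e X' -> X = X'.
Proof.
by move=> E; have [/P0_lt|/P0_lt|//] := ltgtP X X'; rewrite E ltxx.
Qed.

Lemma P0_range X : - 2^-1 <= X < 2^-1 -> 0 <= P0 e X < 2 * pi.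
Proof.
move=> /andP[X1 X2]; have h1 : 2^-1 + 2^-1 = 1 :> R by lra.
have s2 := slit_end_lt R.
have [l1 _] := @tau_left R e ge (- 2^-1) ltac:(lra).
have [l2 _] := @tau_right R e ge (2^-1) ltac:(lra).
have a1 : P0 e (- 2^-1) = 0 by rewrite /P0 l1 addNr !mulr0 addr0.
have a2 : P0 e 2^-1 = 2 * pi by rewrite /P0 l2 h1 mulr1 (MmE ge).
rewrite -{1}a1 -a2 P0_lt// andbT.
by move: X1; rewrite le_eqVlt => /predU1P[->//|/P0_lt/ltW].
Qed.

Lemma Phat_inj X X' : - 2^-1 <= X < 2^-1 -> - 2^-1 <= X' < 2^-1 ->
  Phat e X = Phat e X' -> X = X'.
Proof.
move=> /P0_range/andP[a1 a2] /P0_range/andP[b1 b2]; rewrite /Phat.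
by case: ltP => _; case: ltP => _ E; apply: P0_inj; move: E a1 a2 b1 b2; opaque_lra.
Qed.

Lemma Q0_inj X Y Y' : - 2^-1 <= Y < 2^-1 -> - 2^-1 <= Y' < 2^-1 ->
  Q0 e X Y = Q0 e X Y' -> Y = Y'.
Proof.
move=> /andP[y1 y2] /andP[z1 z2]; have D0 := dP0_gt0 ge X.
have iD : (dP0 e X)^-1 != 0 by rewrite invr_eq0 gt_eqF.
move=> /(mulIf iD) /(mulfI (e_neq0 ge)).
by case: (leP Y 0) => h; case: (leP Y' 0) => h'; opaque_lra.
Qed.

Lemma Q0_ub X Y : - 2^-1 <= Y -> Y <= 0 -> Q0 e X Y <= q0 e.
Proof.
move=> Y1 Y0; have l0 := lam_gt0 ge.
have d1 : lam e <= dP0 e X.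
  by rewrite /dP0 lerDl mulr_ge0 ?dtau_ge0//; have := Mm_gt1 ge; opaque_lra.
have d0 : 0 < dP0 e X by apply: lt_le_trans d1.
have q0g := q0_gt ge.
have El : e = lam e * (2 * q0 e).
  by rewrite /lam divfK// mulf_neq0// gt_eqF//; apply: lt_trans q0g.
have b : e / 2 <= q0 e * dP0 e X by move: El d1 q0g; nra.
by rewrite /Q0 Y0 ler_pdivrMr//; move: e0 b; nra.
Qed.

Lemma branchB X Y : - 2^-1 <= X < 2^-1 -> - 2^-1 <= Y < 2^-1 -> Qa e <= `|Q0 e X Y| ->
  [/\ `|Phat e X| <= Clay R * e, Qa e <= Qp e X Y <= 2 * q0 e - Qa e & (Y <= 0) = (Qp e X Y <= q0 e)].
Proof.
move=> /andP[x1 x2] /andP[y1 y2] h.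
have hX : -(3 / 4) <= X <= 3 / 4 by opaque_lra.
have hY : -(3 / 4) <= Y <= 3 / 4 by opaque_lra.
have [hP _] : `|Phat e X| <= Clay R * e /\ X != 0.
  by apply: (Phat_small ge hX hY); move: h e0; opaque_lra.
have [b1 b2] := Q0_bound ge X hY.
move: h; rewrite ler_normr => h; split => //; rewrite /Qp; case: (leP Y 0) => Y0.
- have u1 := Q0_ub X y1 Y0; have l1 := b1 Y0; rewrite addr0.
  by move: h u1 l1 e0 => /orP[] h; rewrite /q0; opaque_lra.
- have l1 := Q0_lb ge X Y0; have u1 := b2 Y0.
  by move: h u1 l1 e0 => /orP[] h; rewrite /q0; opaque_lra.
- by have u1 := Q0_ub X y1 Y0; rewrite addr0 u1.
- by have l1 := Q0_lb ge X Y0; apply/esym/negbTE; rewrite -ltNge; opaque_lra.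
Qed.

(** Before the drop the action is at least [I0 e + Qa e], after it at most [I0 e - Qa e]. In between
    [hf] is in transition, which pins the angle near [pi]. *)
Lemma BI_middle P Q : Qa e <= Q <= 2 * q0 e - Qa e ->
  I0 e - Qa e < BI e P Q < I0 e + Qa e -> pi - e < Bph e P Q < pi + e.
Proof.
move=> /andP[q1 q2] /andP[i1 i2]; have /andP[h1 h2] := hf_bounds ge (Bph e P Q).
move: i1 i2; rewrite /BI => i1 i2; apply/andP; split.
  by apply: (hf_eq0 ge); opaque_lra.
by apply: (hf_eq1 ge); opaque_lra.
Qed.

(** If [|Q0|] is at most [Clay * e], then [chi] has lifted the band above all values of [u] on the
    ring. Otherwise the ring point is on a leg, at an angle within [Clay * e] of 0, while the band
    crosses at an angle within [e] of [pi], sheared by at most [ac e]; the margin in [ac e]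
    separates the two. *)
Lemma UB_disjoint X Y u v X' Y' u' v' :
  - 2^-1 <= X < 2^-1 -> - 2^-1 <= Y < 2^-1 -> - 2^-1 <= X' < 2^-1 -> - 2^-1 <= Y' < 2^-1 ->
  0 < u < Lu e -> 0 < u' < Lu e -> -1 < v < 1 -> -1 < v' < 1 ->
  `|Q0 e X Y| < Qa e -> Qa e <= `|Q0 e X' Y'| ->
  FU e (P0 e X) (Q0 e X Y) u v = FB e (Phat e X') (Qp e X' Y') u' v' -> False.
Proof.
move=> hX hY hX' hY' /andP[u1 u2] /andP[u1' u2'] hv hv' hU hB.
have [hP hQ _] := branchB hX' hY' hB.
move: hU; rewrite ltr_norml => /andP[U1 U2].
rewrite FU_P0_Phat /FU /FB; set I := BI e _ _.
have I1 : 0 < I by apply: (BI_gt0 _ ge); have /andP[h1 _] := hQ; move: h1 e0; opaque_lra.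
have c0 := chi_ge0 ge I.
have IU : 0 < I0 e + Q0 e X Y by move: U1; rewrite /I0; move: e0; opaque_lra.
have u0 : 0 < u' + chi e I by rewrite ltr_pwDl.
move=> /(out_inj IU I1 u1 u0 hv hv')[] EI Eu Ev ec es.
have hI : I0 e - Qa e < I < I0 e + Qa e by rewrite -EI; opaque_lra.
have /andP[ph1 ph2] := BI_middle hQ hI.
have [small|big] := leP `|Q0 e X Y| (Clay R * e).
  have := @chi_ring R e ge I; rewrite -EI addrAC subrr add0r => /(_ small).
  by rewrite EI; opaque_lra.
have nd : ~ slope_lb R <= dtau e X.
  have hY2 : -(3 / 4) <= Y <= 3 / 4 by move: hY => /andP[]; opaque_lra.
  by move=> /(Q0_small ge hY2); rewrite leNgt big.
have hX2 : -(3 / 4) <= X <= 3 / 4 by move: hX => /andP[]; opaque_lra.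
have [//|] := layer_dichotomy ge hX2; rewrite ler_norml => /andP[P1 P2].
have := dchi_le ge I; rewrite ler_norml => /andP[d1 d2].
have dv : - ac e <= dchi e I * v' <= ac e.
  by have a0 := ac_gt1 ge; move: hv' => /andP[w1 w2]; apply/andP; split; nra.
move: dv ec es; set t := dchi e I * v'; rewrite /ac => /andP[t1 t2] ec es.
set B := Bph e _ _ in ph1 ph2 ec es.
have : Phat e X = B + t.
  by apply: (trig_inj ec es); rewrite ltr_norml; apply/andP; split; move: e0; opaque_lra.
by move: e0; opaque_lra.
Qed.

Lemma trig_shift_inj (a b c : R) : cos (a + c) = cos (b + c) -> sin (a + c) = sin (b + c) ->
  a - b < 2 * pi -> b - a < 2 * pi -> a = b.
Proof.
move=> ec es h1 h2; apply: (addIr c); apply: (trig_inj ec es).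
by rewrite opprD addrACA subrr addr0 ltr_norml h1 andbT ltrNl opprB.
Qed.

(** Equal images have equal [I] and [v], so the shear [dchi * v] is a common translation of both
    angles and drops out. It remains to exclude a difference of a full turn. *)
Lemma FB_inj P Q u v P' Q' u' v' : `|P| <= Clay R * e -> `|P'| <= Clay R * e ->
  Qa e <= Q <= 2 * q0 e - Qa e -> Qa e <= Q' <= 2 * q0 e - Qa e ->
  0 < u -> 0 < u' -> -1 < v < 1 -> -1 < v' < 1 ->
  FB e P Q u v = FB e P' Q' u' v' -> [/\ P = P', Q = Q', u = u' & v = v'].
Proof.
(* Angles a full turn apart belong to one point before the drop and one after it, whose actions lie
   on opposite sides of [I0 e]. *)
have far A B A' B' : `|A| <= Clay R * e -> `|A'| <= Clay R * e ->
    Qa e <= B <= 2 * q0 e - Qa e -> Qa e <= B' <= 2 * q0 e - Qa e ->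
    BI e A B = BI e A' B' -> Bph e A' B' - Bph e A B < 2 * pi.
  rewrite !ler_norml => /andP[a1 a2] /andP[a3 a4] /andP[a5 a6] /andP[a7 a8] EB.
  have /andP[k1 k2] := kf_bounds e B; have /andP[k3 k4] := kf_bounds e B'.
  rewrite ltNge; apply/negP => far.
  have b1 : Bph e A B <= pi - e by move: far; rewrite /Bph; move: e0 He p2; opaque_lra.
  have b2 : pi + e <= Bph e A' B' by move: far; rewrite /Bph; move: e0 He p2; opaque_lra.
  move: EB; rewrite /BI (hf_low ge b1) (hf_high ge b2) => EB.
  by have := Qa_gt ge; opaque_lra.
move=> hP hP' hQ hQ' u1 u1' hv hv'.
have i0 : 0 < BI e P Q.
  by apply: (BI_gt0 _ ge); have /andP[h1 _] := hQ; move: h1 e0; opaque_lra.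
have i0' : 0 < BI e P' Q'.
  by apply: (BI_gt0 _ ge); have /andP[h1 _] := hQ'; move: h1 e0; opaque_lra.
have w0 : 0 < u + chi e (BI e P Q) by apply: ltr_pwDl u1 _; exact: chi_ge0.
have w0' : 0 < u' + chi e (BI e P' Q') by apply: ltr_pwDl u1' _; exact: chi_ge0.
move=> /(out_inj i0 i0' w0 w0' hv hv')[] EI Eu Ev ec es.
rewrite -EI -Ev in Eu ec es; have Eu' := addIr _ Eu.
have EB : Bph e P Q = Bph e P' Q'.
  have f1 := far _ _ _ _ hP hP' hQ hQ' EI; have f2 := far _ _ _ _ hP' hP hQ' hQ (esym EI).
  exact: trig_shift_inj ec es f2 f1.
have EQ : Q = Q' by move: EI; rewrite /BI EB => /addIr/addrI.
have EP : P = P' by move: EB; rewrite /Bph EQ => /addIr.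
exact: And4 EP EQ Eu' Ev.
Qed.

Lemma cell_inj X Y u v X' Y' u' v' :
  - 2^-1 <= X < 2^-1 -> - 2^-1 <= Y < 2^-1 -> - 2^-1 <= X' < 2^-1 -> - 2^-1 <= Y' < 2^-1 ->
  0 < u < Lu e -> 0 < u' < Lu e -> -1 < v < 1 -> -1 < v' < 1 ->
  cell e X Y u v = cell e X' Y' u' v' -> [/\ X = X', Y = Y', u = u' & v = v'].
Proof.
move=> hX hY hX' hY' hu hu' hv hv'; rewrite /cell.
have [u1 _] := andP hu; have [u1' _] := andP hu'.
case: ltP => b; case: ltP => b'.
- move: (b) (b'); rewrite !ltr_norml => /andP[l1 l2] /andP[l1' l2'].
  have IU : 0 < I0 e + Q0 e X Y by move: l1; rewrite /I0; move: e0; opaque_lra.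
  have IU' : 0 < I0 e + Q0 e X' Y' by move: l1'; rewrite /I0; move: e0; opaque_lra.
  rewrite /FU => /(out_inj IU IU' u1 u1' hv hv')[] EI Eu Ev ec es.
  have EP : P0 e X = P0 e X'.
    have /andP[a1 a2] := P0_range hX; have /andP[a3 a4] := P0_range hX'.
    by apply: (trig_inj ec es); rewrite ltr_norml; apply/andP; split; opaque_lra.
  have EX := P0_inj EP; split; [exact: EX | | exact: Eu | exact: Ev].
  by apply: (@Q0_inj X _ _ hY hY'); rewrite {2}EX; exact: addrI _ EI.
- by move=> /(UB_disjoint hX hY hX' hY' hu hu' hv hv' b b').
- by move=> /esym/(UB_disjoint hX' hY' hX hY hu' hu hv' hv b' b).
- have [hP hQ sQ] := branchB hX hY b; have [hP' hQ' sQ'] := branchB hX' hY' b'.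
  move=> /(FB_inj hP hP' hQ hQ' u1 u1' hv hv')[EP EQ Eu Ev].
  have EX := Phat_inj hX hX' EP; split; [exact: EX | | exact: Eu | exact: Ev].
  apply: (@Q0_inj X _ _ hY hY'); rewrite {2}EX; have := EQ; rewrite /Qp sQ sQ'.
  have -> : (Qp e X Y <= q0 e) = (Qp e X' Y' <= q0 e) by rewrite EQ.
  exact: (@addIr).
Qed.

(** The leading part is [2 (I0 + Qa) + 1], with [I0] and [Qa] both [1/2 + O(e)]. For a lifted point
    [chi_le] gives the bound [2 * It e + 1 + e]. By [Tp_le] the corrections add up to
    [12 (Clay + 2) e] and fewer than 20 further [e], absorbed into the factor 20 by [Clay > 2]. *)
Lemma cell_bound X Y u v : - 2^-1 <= X < 2^-1 -> - 2^-1 <= Y < 2^-1 ->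
  0 < u < Lu e -> sqnorm4 (cell e X Y u v) <= 3 + 20 * (Clay R + 2) * e.
Proof.
move=> hX hY /andP[u1 u2]; have p0 := pi_gt0 R.
have T := Tp_le ge; have LuE : 2 * Lu e / pi = 1 + e.
  by rewrite /Lu; move: (pi : R) p0 => c c0; field; rewrite gt_eqF.
have mono (t : R) : t <= Lu e -> 2 * t / pi <= 1 + e.
  by move=> h; rewrite -LuE ler_pM2r ?invr_gt0// ler_pM2l.
rewrite /cell; case: ltP => b.
  move: b; rewrite ltr_norml => /andP[l1 l2].
  rewrite /FU sqnorm4_out; [|by rewrite /I0; move: e0; lra|by exact: ltW].
  have := mono u (ltW u2); move: C2 e0 l2 T; rewrite /I0 /Qa.
  by set c := Clay R; set t := Tp e => C2' e0' l2 T; nra.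
have [hP hQ _] := branchB hX hY b; move: hQ => /andP[q1 q2].
rewrite /FB; set I := BI e _ _.
have i0 : 0 < I by apply: (BI_gt0 _ ge); move: q1 e0; opaque_lra.
have c0 := chi_ge0 ge I.
have /andP[h1 _] := hf_bounds ge (Bph e (Phat e X) (Qp e X Y)).
have Iub : I <= I0 e + (Qp e X Y) by rewrite /I /BI; opaque_lra.
rewrite sqnorm4_out; [|exact: ltW|by rewrite addr_ge0// ltW].
have [hI|hI] := leP (It e) I.
  have [-> _] := chi_high ge hI; rewrite addr0.
  have := mono u (ltW u2); move: C2 e0 Iub q2 T; rewrite /I0 /q0 /Qa.
  by set c := Clay R; set t := Tp e => C2' e0' Iub q2' T; nra.
have h := chi_le ge (ltW hI).
have h' : ac e * (It e - I) <= pi * (It e - I).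
  by apply: ler_wpM2r; [rewrite subr_ge0 ltW | exact: ltW (ac_lt ge)].
have : 2 * (u + chi e I) / pi <= 1 + e + 2 * (It e - I).
  have -> : 1 + e + 2 * (It e - I) = 2 * (Lu e + pi * (It e - I)) / pi.
    rewrite -LuE; move: (pi : R) p0 (Lu e) (It e - I) => c cp l d.
    by field; rewrite gt_eqF.
  rewrite ler_pM2r ?invr_gt0// ler_pM2l//; apply: lerD (ltW u2) _.
  exact: le_trans h h'.
move=> H; apply: le_trans (lerD (lexx _) H) _.
move: C2 e0 T; rewrite /It /I0 /Qa.
by set c := Clay R; set t := Tp e => C2' e0' T; nra.
Qed.

Lemma slit_half (x y : R) : 0 < rho x y -> - 2^-1 <= x < 2^-1 -> - 2^-1 <= y < 2^-1 ->
  (- 2^-1 <= slitX x y < 2^-1) /\ (- 2^-1 <= slitY x y < 2^-1).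
Proof.
move=> r0 hx hy; have [h|h] := leP 16^-1 (rho x y); first by have [-> ->] := slit_id h.
have h1 := slitX_sqr_le r0; have h2 := slitY_sqr_le r0.
have h3 := slitG_lt h; rewrite (slitG_id (lexx _)) in h3.
have K (t : R) : t ^+ 2 < 16^-1 -> - 2^-1 <= t < 2^-1.
  by move=> ht; apply/andP; split; nra.
by split; apply: K; [exact: le_lt_trans h1 h3 | exact: le_lt_trans h2 h].
Qed.

Lemma torus_map_inj (x y z w x' y' z' w' : R) : nonlat x y -> nonlat x' y' ->
  z ^+ 2 + w ^+ 2 < 1 -> z' ^+ 2 + w' ^+ 2 < 1 -> torus_map e x y z w = torus_map e x' y' z' w' ->
  exists m n : int, [/\ x' = x + m%:~R, y' = y + n%:~R, z' = z & w' = w].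
Proof.
move=> nl nl' hz hz'; rewrite /torus_map /cell_map.
have r0 := nonlat_rho (nearest x) (nearest y) nl; have r0' := nonlat_rho (nearest x') (nearest y') nl'.
have [bX bY] := slit_half r0 (nearest_bounds x) (nearest_bounds y).
have [bX' bY'] := slit_half r0' (nearest_bounds x') (nearest_bounds y').
have zb : -1 < z < 1 by have h2 := sqr_ge0 w; apply/andP; split; nra.
have zb' : -1 < z' < 1 by have h2 := sqr_ge0 w'; apply/andP; split; nra.
move=> /cell_inj[] //; rewrite ?uf_bounds ?vf_bounds//.
move=> EX EY Eu Ev; have [Ex Ey] := slit_inj r0 r0' EX EY.
have Ez := uf_inj e0 zb zb' Eu; subst z'.
have D0 := duf_gt0 e0 zb.
have Ew : w = w' by move: Ev; rewrite /vf => /divIf; apply; rewrite gt_eqF.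
exists (nearest x' - nearest x), (nearest y' - nearest y); rewrite !intrB; split => //; opaque_lra.
Qed.

Lemma torus_map_bound (x y z w : R) : nonlat x y -> z ^+ 2 + w ^+ 2 < 1 ->
  sqnorm4 (torus_map e x y z w) <= 3 + 20 * (Clay R + 2) * e.
Proof.
move=> nl hz; rewrite /torus_map /cell_map; have r0 := nonlat_rho (nearest x) (nearest y) nl.
have [bX bY] := slit_half r0 (nearest_bounds x) (nearest_bounds y).
have zb : -1 < z < 1 by have h2 := sqr_ge0 w; apply/andP; split; nra.
by apply: cell_bound => //; exact: uf_bounds.
Qed.

End Injectivity.

(** * Domains and coordinates *)

Section LinearSmooth.
Variables (R : realType) (V : normedModType R) (f : V -> R).
Hypothesis fD : forall a u v, f (a *: u + v) = a * f u + f v.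

Lemma is_derive_linear (p v : V) : is_derive p v f (f v).
Proof.
have c : (fun h : R => h^-1 *: ((f \o shift p) (h *: v) - f p)) @ 0^' --> f v.
  apply: cvg_near_cst; near=> h.
  have h0 : h != 0 by near: h; exact: nbhs_dnbhs_neq.
  by rewrite /= fD addrK /GRing.scale/= mulKf.
by apply: DeriveDef; [exact: cvgP c | exact: cvg_lim c].
Unshelve. all: by end_near. Qed.

Lemma sm_linear (U : set V) : continuous f -> sm U f.
Proof.
move=> cf [|n]; first by split => // x _; exact: cf.
split; first by move=> x _; exact: cf.
split=> [x v _|v]; first by case: (is_derive_linear x v).
suff -> : 'D_v f = (fun=> f v) by exact: sm_cst.
by apply/funext => x; have [_ ->] := is_derive_linear x v.
Qed.

End LinearSmooth.

Section Coordinates.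
Variable R : realType.

Lemma coordD n (i : 'I_n) (a : R) (u v : 'rV[R]_n) :
  (a *: u + v) ord0 i = a * u ord0 i + v ord0 i.
Proof. by rewrite !mxE. Qed.

Lemma sm_coord n (U : set 'rV[R]_n) (i : 'I_n) : sm U (fun q : 'rV[R]_n => q ord0 i).
Proof.
by apply: sm_linear; [move=> a u v; exact: coordD | exact: coord_continuous].
Qed.

Lemma is_derive_coord n (i : 'I_n) (p v : 'rV[R]_n) :
  is_derive p v (fun q : 'rV[R]_n => q ord0 i) (v ord0 i).
Proof. by apply: (is_derive_linear (f := fun q : 'rV[R]_n => q ord0 i)) => a u w; exact: coordD. Qed.

Lemma sm_fst n (U : set (R * 'rV[R]_n)) : sm U (fun q : R * 'rV[R]_n => q.1).
Proof. by apply: sm_linear => // q; exact: cvg_fst. Qed.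

Lemma sm_snd_coord n (U : set (R * 'rV[R]_n)) (i : 'I_n) :
  sm U (fun q : R * 'rV[R]_n => q.2 ord0 i).
Proof.
apply: sm_linear; first by move=> a [u1 u2] [v1 v2] /=; exact: coordD.
move=> q; apply: (continuous_comp (f := snd) (g := fun r : 'rV[R]_n => r ord0 i)).
  exact: cvg_snd.
exact: coord_continuous.
Qed.

End Coordinates.

Section OpenDomain.
Variable R : realType.

Lemma near_nonint (V : topologicalType) (f : V -> R) (p : V) : {for p, continuous f} ->
  (~ exists m : int, f p = m%:~R) -> \forall q \near p, ~ exists m : int, f q = m%:~R.
Proof.
move=> cf np; have h1 : (Num.floor (f p))%:~R < f p.
  by rewrite lt_neqAle floor_le andbT; apply/eqP => E; apply: np; exists (Num.floor (f p)).
have h2 : f p < (Num.floor (f p) + 1)%:~R by exact: floorD1_gt.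
near=> q.
have a1 : (Num.floor (f p))%:~R < f q by near: q; exact: (cvgr_gt _ cf).
have a2 : f q < (Num.floor (f p) + 1)%:~R by near: q; exact: (cvgr_lt _ cf).
move=> [m E]; move: a1 a2; rewrite E !ltr_int; lia.
Unshelve. all: by end_near. Qed.

(** A point off the lattice has a non-integer coordinate, which stays non-integer nearby. *)
Lemma open_nonlat (V : topologicalType) (x y : V -> R) : continuous x -> continuous y ->
  open [set p | nonlat (x p) (y p)].
Proof.
move=> cx cy; rewrite openE => p hp; rewrite /interior.
have [[m Em]|np] := pselect (exists m : int, x p = m%:~R).
  have np : ~ exists n : int, y p = n%:~R by move=> [n En]; apply: hp; exists m, n.
  by apply: filterS (near_nonint (cy p) np) => q h [a [b [_ E]]]; apply: h; exists b.
by apply: filterS (near_nonint (cx p) np) => q h [a [b [E _]]]; apply: h; exists a.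
Qed.

Lemma dom_nonlat (e : R) (p : 'rV[R]_4) : 0 < e -> dom e p =
  (nonlat (p ord0 c0 / Num.sqrt e) (p ord0 c1 / Num.sqrt e) /\
   (p ord0 c2) ^+ 2 + (p ord0 c3) ^+ 2 < 1).
Proof.
move=> e0; have s0 : Num.sqrt e != 0 by rewrite sqrtr_eq0 -ltNge.
have K (a b : R) : a / Num.sqrt e = b <-> a = Num.sqrt e * b.
  by split=> [<-|->]; [rewrite mulrC divfK | rewrite mulrAC divff// mul1r].
apply/propext; split=> -[h1 h2]; split=> // -[m [n []]].
  by move=> /K E1 /K E2; apply: h1; exists m, n.
by move=> E1 E2; apply: h1; exists m, n; split; apply/K.
Qed.

Lemma open_dom (e : R) : 0 < e -> open (dom e).
Proof.
move=> e0; pose s := (Num.sqrt e)^-1.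
have oT := @openT 'rV[R]_4; have sc i := @sm_coord R 4 setT i.
have cs i : continuous (fun p : 'rV[R]_4 => p ord0 i * s).
  move=> p; have : sm setT (fun p : 'rV[R]_4 => p ord0 i * s) by apply: smM => //; exact: sm_cst.
  by move=> /sm_cont; apply.
have -> : dom e = [set p : 'rV[R]_4 | nonlat (p ord0 c0 * s) (p ord0 c1 * s)] `&`
   (setT `&` [set p : 'rV[R]_4 | (p ord0 c2) ^+ 2 + (p ord0 c3) ^+ 2 < 1]).
  by rewrite setTI; apply/seteqP; split => p; rewrite dom_nonlat.
apply: openI; first exact: open_nonlat (cs _) (cs _).
by apply: open_lt_sm => //; [apply: smD => //; apply: smX | exact: sm_cst].
Qed.

End OpenDomain.

(** * Continuity of the inverse *)

Section Translate.
Variables (R : realType) (V W : normedModType R).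

Lemma continuous_subc (f : V -> W) (y : W) (x : V) :
  {for x, continuous f} -> {for x, continuous (fun q => f q - y)}.
Proof. by move=> cf; apply: cvgB => //; exact: cvg_cst. Qed.

Lemma dist_continuous (p x : V) : {for x, continuous (fun q => `|q - p|)}.
Proof. by apply: cvg_norm; apply: cvgB; [exact: cvg_id | exact: cvg_cst]. Qed.

End Translate.

Section DualBasis.
Variable R : realType.

Lemma sum4 (F : 'I_4 -> R) : \sum_(i < 4) F i = F c0 + F c1 + F c2 + F c3.
Proof.
rewrite !big_ord_recl big_ord0 addr0 !addrA.
by congr (_ + F _ + F _ + F _); [congr (F _) | ..]; apply: val_inj.
Qed.

Lemma ord4P (P : 'I_4 -> Prop) : P c0 -> P c1 -> P c2 -> P c3 -> forall i, P i.
Proof.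
move=> p0 p1 p2 p3 [[|[|[|[|//]]]] hi]; [move: p0 | move: p1 | move: p2 | move: p3];
  by congr P; apply: val_inj.
Qed.

Definition dual4 (w : 'rV[R]_4) := mk4 (w ord0 c1) (- w ord0 c0) (w ord0 c3) (- w ord0 c2).

Lemma omega4_dual4 (v w : 'rV[R]_4) : \sum_(k < 4) v ord0 k * dual4 w ord0 k = omega4 v w.
Proof.
rewrite sum4; have [-> -> -> ->] := mk4E (w ord0 c1) (- w ord0 c0) (w ord0 c3) (- w ord0 c2).
by rewrite /omega4; ring.
Qed.

Lemma omega4_delta (i j : 'I_4) (d := fun k => delta_mx 0 k : 'rV[R]_4) :
  mk4 (omega4 (d i) (d c1)) (- omega4 (d i) (d c0)) (omega4 (d i) (d c3))
    (- omega4 (d i) (d c2)) ord0 j = (i == j)%:R.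
Proof.
rewrite /d /omega4 mxE; move: j; apply: ord4P; move: i; apply: ord4P;
by rewrite !mxE /= ?mulr0 ?mulr1 ?mul0r ?subr0 ?addr0 ?add0r ?opprK ?oppr0.
Qed.

(* Preservation of [omega4] exhibits an inverse of the matrix with rows [B i]. *)
Lemma omega4_basis (B : 'I_4 -> 'rV[R]_4) (a : 'rV[R]_4) :
  (forall i j, omega4 (B i) (B j) = omega4 (delta_mx 0 i) (delta_mx 0 j)) ->
  (forall i, \sum_(k < 4) a ord0 k * B i ord0 k = 0) -> a = 0.
Proof.
move=> hB ha; pose N : 'M[R]_4 := \matrix_(k, j) mk4 (dual4 (B c1) ord0 k)
  (- dual4 (B c0) ord0 k) (dual4 (B c3) ord0 k) (- dual4 (B c2) ord0 k) ord0 j.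
have hN k : [/\ N k c0 = dual4 (B c1) ord0 k, N k c1 = - dual4 (B c0) ord0 k,
    N k c2 = dual4 (B c3) ord0 k & N k c3 = - dual4 (B c2) ord0 k].
  by split; rewrite mxE; have [] := mk4E (dual4 (B c1) ord0 k)
    (- dual4 (B c0) ord0 k) (dual4 (B c3) ord0 k) (- dual4 (B c2) ord0 k).
clearbody N; have MN : (\matrix_(i, k) B i ord0 k) *m N = 1%:M.
  apply/matrixP => i j; rewrite mxE [RHS]mxE -omega4_delta -!hB -!omega4_dual4 -!sumrN.
  set s0 := (X in mk4 X _ _ _); set s1 := (X in mk4 _ X _ _).
  set s2 := (X in mk4 _ _ X _); set s3 := (X in mk4 _ _ _ X).
  have [e0 e1 e2 e3] := mk4E s0 s1 s2 s3.
  move: j; apply: ord4P; [rewrite e0 | rewrite e1 | rewrite e2 | rewrite e3];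
    apply: eq_bigr => k _; rewrite mxE; have [h0 h1 h2 h3] := hN k;
    [by rewrite h0 | by rewrite h1 mulrN | by rewrite h2 | by rewrite h3 mulrN].
have Ma : (\matrix_(i, k) B i ord0 k) *m a^T = 0.
  apply/matrixP => i j; rewrite !mxE ord1 -[RHS](ha i); apply: eq_bigr => k _.
  by rewrite !mxE mulrC (ord1 j).
have : a^T = 0 by rewrite -[a^T]mul1mx -(mulmx1C MN) -mulmxA Ma mulmx0.
by move=> /(congr1 trmx); rewrite trmxK trmx0.
Qed.

End DualBasis.

Section LocalInverse.
Variables (R : realType) (U : set 'rV[R]_4) (f : 'rV[R]_4 -> 'rV[R]_4).
Hypothesis sf : sm U f.
Hypothesis fw : forall p, U p -> forall v w, omega4 ('D_v f p) ('D_w f p) = omega4 v w.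

Lemma sqnorm4_ge0 (v : 'rV[R]_4) : 0 <= sqnorm4 v.
Proof. by apply: sumr_ge0 => i _; exact: sqr_ge0. Qed.

Lemma sqnorm4_eq0 (v : 'rV[R]_4) : sqnorm4 v = 0 -> v = 0.
Proof.
move=> /psumr_eq0P h; apply/rowP => i; rewrite mxE.
by apply/eqP; rewrite -sqrf_eq0; apply/eqP/h => // j _; exact: sqr_ge0.
Qed.

Lemma sqnorm4D (u v : 'rV[R]_4) : sqnorm4 (u + v) <= 2 * sqnorm4 u + 2 * sqnorm4 v.
Proof.
rewrite /sqnorm4 !mulr_sumr -big_split/=; apply: ler_sum => i _; rewrite mxE.
by move: (u ord0 i) (v ord0 i) => a b; have := sqr_ge0 (a - b); nra.
Qed.

Lemma sqnorm4_le (v : 'rV[R]_4) e : `|v| < e -> sqnorm4 v <= 4 * e ^+ 2.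
Proof.
move=> h; have -> : 4 * e ^+ 2 = \sum_(i < 4) e ^+ 2 by rewrite sumr_const card_ord mulr_natl.
apply: ler_sum => i _; rewrite -[v ord0 i ^+ 2]real_normK ?num_real//.
have h1 : `|v ord0 i| <= `|v|.
  by rewrite [leRHS]/Num.Def.normr/= mx_normrE; apply: (le_bigmax _ _ (ord0, i)).
by have h2 := normr_ge0 (v ord0 i); nra.
Qed.

Lemma is_derive_coordf p v i : U p -> is_derive p v (fun q => f q ord0 i) (('D_v f p) ord0 i).
Proof.
move=> Up; have df := sm_derivable (v := v) sf Up.
have /derivable_mxP/(_ ord0 i) dfi := df.
by apply: DeriveDef => //; rewrite (derive_mx df) mxE.
Qed.

Lemma derive_local_min (V : normedModType R) (G : V -> R) (p v : V) (D : R) :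
  is_derive p v G D -> (\forall q \near p, G p <= G q) -> D = 0.
Proof.
move=> [dG <-] hm; set D' := 'D_v G p.
have c : (fun h : R => h^-1 *: ((G \o shift p) (h *: v) - G p)) @ 0^' --> D' by exact: dG.
apply/eqP/negP => /negP D0.
have n1 : \forall h \near 0^', 0 < (h^-1 *: ((G \o shift p) (h *: v) - G p)) * D'.
  apply: (cvgr_gt (D' * D')); first by apply: cvgM => //; exact: cvg_cst.
  by rewrite -expr2 exprn_even_gt0.
have n2 : \forall h \near (0 : R), G p <= G (h *: v + p).
  have cl : (fun h : R => h *: v + p) @ (0 : R) --> p.
    rewrite -[X in _ --> X]add0r -(scale0r v); apply: cvgD; last exact: cvg_cst.
    by apply: cvgZ; [exact: cvg_id | exact: cvg_cst].
  exact: cl hm.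
have /nbhs_ballP[d /= d0 hd] : \forall h \near (0 : R), h != 0 ->
    (0 < (h^-1 *: ((G \o shift p) (h *: v) - G p)) * D') /\ G p <= G (h *: v + p).
  have n1' : \forall h \near (0 : R), h != 0 -> 0 < (h^-1 *: ((G \o shift p) (h *: v) - G p)) * D' := n1.
  by apply: filterS2 n1' n2 => h a b h0; split; [exact: a | exact: b].
(* A step [d / 2] in the direction of descent makes the difference quotient times [D'] positive by
   its limit, and at most 0 by minimality. *)
have [Dn|Dp] := ltP D' 0.
  have [||q1 q2] := hd (d / 2).
  - by rewrite /ball/= sub0r normrN gtr0_norm; lra.
  - by rewrite gt_eqF// divr_gt0.
  have i0 : 0 <= (d / 2)^-1 by rewrite invr_ge0 divr_ge0 ?ltW.
  rewrite -subr_ge0 in q2; have := mulr_ge0_le0 (mulr_ge0 i0 q2) (ltW Dn).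
  by move: q1; rewrite leNgt => ->.
have {}Dp : 0 < D' by rewrite lt_neqAle eq_sym D0.
have [||q1 q2] := hd (- (d / 2)).
- by rewrite /ball/= sub0r opprK gtr0_norm; lra.
- by rewrite oppr_eq0 gt_eqF// divr_gt0.
have i0 : (- (d / 2))^-1 <= 0 by rewrite invr_le0 oppr_le0 divr_ge0 ?ltW.
rewrite -subr_ge0 in q2; have := mulr_le0_ge0 (mulr_le0_ge0 i0 q2) (ltW Dp).
by move: q1; rewrite leNgt => ->.
Qed.

(** At a minimum the residual [f p - y] is orthogonal to all partial derivatives of [f], and these
    span by [omega4_basis]. *)
Lemma local_min_solves p y : U p -> (\forall q \near p, sqnorm4 (f p - y) <= sqnorm4 (f q - y)) ->
  f p = y.
Proof.
move=> Up hm; apply/eqP; rewrite -subr_eq0; apply/eqP; apply: (omega4_basis (B := fun i => 'D_(delta_mx 0 i) f p)) => [i j|i0].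
  exact: fw.
set v := delta_mx 0 i0.
have dc i : is_derive p v (fun q => (f q - y) ord0 i ^+ 2) (2 * ((f p - y) ord0 i * ('D_v f p) ord0 i)).
  have d := is_deriveBf (is_derive_coordf v i Up) (is_derive_cstf (y ord0 i) p v).
  have -> : (fun q => (f q - y) ord0 i ^+ 2) = (fun q => (f q ord0 i - y ord0 i) * (f q ord0 i - y ord0 i)).
    by apply/funext => q; rewrite !mxE expr2.
  by apply: (is_derive_eq (is_deriveMf d d)); rewrite !mxE; ring.
have dg := is_deriveDf (is_deriveDf (is_deriveDf (dc c0) (dc c1)) (dc c2)) (dc c3).
have E q : sqnorm4 (f q - y) = (f q - y) ord0 c0 ^+ 2 + (f q - y) ord0 c1 ^+ 2 +
    (f q - y) ord0 c2 ^+ 2 + (f q - y) ord0 c3 ^+ 2 by exact: sum4.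
have := derive_local_min dg; rewrite -!E => D0.
rewrite sum4; have {}D0 := D0 _; apply: (mulfI (_ : 2 != 0 :> R)) => //.
rewrite mulr0 -[RHS]D0; first ring.
by apply: filterS hm => q; rewrite !E.
Qed.

Lemma sqnorm4_continuous : continuous (@sqnorm4 R).
Proof.
have oT := @openT 'rV[R]_4; have sc i := @sm_coord R 4 setT i.
have -> : @sqnorm4 R = fun v => v ord0 c0 ^+ 2 + v ord0 c1 ^+ 2 + v ord0 c2 ^+ 2 + v ord0 c3 ^+ 2.
  by apply/funext => v; exact: sum4.
move=> v; apply: (@sm_cont _ _ _ setT) => //.
by do 3!(apply: smD => //; last exact: smX); exact: smX.
Qed.

Lemma sqnorm4_sub_continuous x y : U x -> {for x, continuous (fun q => sqnorm4 (f q - y))}.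
Proof.
move=> Ux; apply: (continuous_comp (f := fun q => f q - y) (g := @sqnorm4 R)).
  exact: continuous_subc (sm_cont sf Ux).
exact: sqnorm4_continuous.
Qed.

Lemma compact_dist (p : 'rV[R]_4) (r : R) (A : set R) : closed A -> A `<=` [set t | t <= r] ->
  compact [set x | A `|x - p|].
Proof.
move=> cA Ar; apply: bounded_closed_compact.
  exists (`|p| + r); split; first exact: num_real.
  move=> M hM x /Ar /= h; apply: le_trans (ltW hM).
  by rewrite -[x](subrK p) (le_trans (ler_normD _ _))// addrC lerD2l.
by apply: preimage_closed cA => x _; exact: dist_continuous.
Qed.

(* A minimiser over the closed cube of the squared distance to [y] is interior as soon
   as [y] is close to [f p], and an interior local_min_solves point is a solution. *)
Lemma locally_onto p r : 0 < r -> (forall x, `|x - p| <= r -> U x) ->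
  (forall x, `|x - p| = r -> f x <> f p) ->
  exists2 e, 0 < e & forall y, `|y - f p| < e -> exists2 x, `|x - p| < r & f x = y.
Proof.
move=> r0 KU hS; set K := [set x : 'rV[R]_4 | [set t | t <= r] `|x - p|].
have cK : compact K by apply: (compact_dist (r := r)) => [|t //]; exact: closed_le.
have [m m0 hm] : exists2 m, 0 < m & forall x, `|x - p| = r -> m <= sqnorm4 (f x - f p).
  have [nS|hs] := pselect ([set x : 'rV[R]_4 | [set t | t = r] `|x - p|] !=set0); last first.
    by exists 1 => // x Ex; case: hs; exists x.
  have cS : compact [set x : 'rV[R]_4 | [set t | t = r] `|x - p|].
    by apply: (compact_dist (r := r)) => [|t /= ->//]; exact: closed_eq.
  have [|c + cm] := EVT_min_rV (f := fun x => sqnorm4 (f x - f p)) nS cS.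
    apply: continuous_in_subspaceT => x; rewrite inE /= => xr.
    by apply: sqnorm4_sub_continuous; apply: KU; rewrite xr.
  rewrite inE /= => cr; exists (sqnorm4 (f c - f p)); last by move=> x xr; apply: cm; rewrite inE.
  rewrite lt_neqAle sqnorm4_ge0 andbT; apply/eqP => /esym/sqnorm4_eq0/eqP.
  by rewrite subr_eq0 => /eqP; exact: hS.
(* [4 * e ^+ 2] bounds [sqnorm4] on the ball of radius [e] in the maximum norm. A minimiser on the
   boundary would give [m < 2 (m / 4) + 2 (m / 4)] by [sqnorm4D]. *)
have [e e0 he] : exists2 e, 0 < e & 4 * e ^+ 2 < m / 4.
  exists (Num.min 1 (m / 32)); first by rewrite lt_min ltr01 divr_gt0.
  have h1 : Num.min 1 (m / 32) <= 1 by rewrite ge_min lexx.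
  have h2 : Num.min 1 (m / 32) <= m / 32 by rewrite ge_min lexx orbT.
  have h3 : 0 < Num.min 1 (m / 32) by rewrite lt_min ltr01 divr_gt0.
  by move: (Num.min _ _) h1 h2 h3 => t; nra.
exists e => // y hy; have yp := le_lt_trans (sqnorm4_le hy) he.
have Kp : K p by rewrite /K /= subrr normr0 ltW.
have [|c + cm] := EVT_min_rV (f := fun x => sqnorm4 (f x - y)) (ex_intro _ p Kp) cK.
  by apply: continuous_in_subspaceT => x; rewrite inE /K /= => /KU; exact: sqnorm4_sub_continuous.
rewrite inE /K /= => cr.
have py : sqnorm4 (f p - y) < m / 4.
  suff -> : sqnorm4 (f p - y) = sqnorm4 (y - f p) by [].
  by rewrite -opprB; apply: eq_bigr => i _; rewrite mxE sqrrN.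
have cp := cm p (mem_set Kp).
have clt : `|c - p| < r.
  rewrite lt_neqAle cr andbT; apply/eqP => /hm hc.
  have := sqnorm4D (f c - y) (y - f p); rewrite addrA subrK => h.
  by move: h cp py yp hc; lra.
exists c => //; apply: local_min_solves; first exact: KU.
have : \forall q \near c, `|q - p| < r by apply: (cvgr_lt _ (dist_continuous (p := p) (x := c))).
by apply: filterS => q hq; apply: cm; rewrite inE /K /= ltW.
Qed.

End LocalInverse.

(** * The family of embeddings *)

Section Family.
Variable R : realType.
Implicit Types (e : R) (p q : 'rV[R]_4).

Definition emax : R := Num.min (slit_end R / 4) (Clay R + 2)^-1.

Lemma emax_gt0 : 0 < emax.
Proof.
by rewrite lt_min divr_gt0 ?slit_end_gt0// invr_gt0; have := Clay_gt2 R; lra.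
Qed.

Lemma good_emax e : 0 < e < emax -> good e.
Proof.
have C2 := Clay_gt2 R; have C4 : 0 < Clay R + 2 by lra.
rewrite lt_min => /and3P[e0 e1 e2]; split => //; first by move: e1; rewrite ltr_pdivlMr// mulrC.
by move: e2; rewrite -[ltRHS]mul1r ltr_pdivlMr// mulrC.
Qed.

(** Dividing by [sqrt e] passes to the unit torus; the factor [e] in [torus_map_symplectic] restores
    the area form. *)
Definition torus_emb e p : 'rV[R]_4 :=
  torus_map e (p ord0 c0 / Num.sqrt e) (p ord0 c1 / Num.sqrt e) (p ord0 c2) (p ord0 c3).

Lemma lattE e (m n : int) : [/\ latt e m n ord0 c0 = Num.sqrt e * m%:~R,
  latt e m n ord0 c1 = Num.sqrt e * n%:~R, latt e m n ord0 c2 = 0 & latt e m n ord0 c3 = 0].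
Proof. by split; rewrite mxE. Qed.

Lemma sqrt_mulK e (a : R) : 0 < e -> Num.sqrt e * a / Num.sqrt e = a.
Proof. by move=> e0; rewrite mulrAC divff ?mul1r// sqrtr_eq0 -ltNge. Qed.

Section Fixed.
Variable e : R.
Hypothesis ge : good e.

Let e0 : 0 < e := e_gt0 ge.
Let s0 : Num.sqrt e != 0. Proof. by rewrite sqrtr_eq0 -ltNge. Qed.
Let J := torus_emb e.

Lemma torus_emb_periodic p (m n : int) : J (p + latt e m n) = J p.
Proof.
rewrite /J /torus_emb !(mxE _ _ ord0) /=.
by rewrite !mulrDl !(sqrt_mulK _ e0) !addr0 torus_map_periodic.
Qed.

Lemma sm_torus_emb : sm (dom e) J.
Proof.
have oD := open_dom e0; have sc i := @sm_coord R 4 (dom e) i.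
have sd i : sm (dom e) (fun q : 'rV[R]_4 => q ord0 i / Num.sqrt e).
  by apply: smM => //; exact: sm_cst.
by apply: sm_torus_map => // [|q|q]; [exact: sm_cst| |]; rewrite dom_nonlat// => -[].
Qed.

Lemma torus_emb_symplectic p : dom e p -> forall v w, omega4 ('D_v J p) ('D_w J p) = omega4 v w.
Proof.
move=> Dp v w; have oD := open_dom e0; have sc i := @sm_coord R 4 (dom e) i.
have sd i : sm (dom e) (fun q : 'rV[R]_4 => q ord0 i / Num.sqrt e).
  by apply: smM => //; exact: sm_cst.
have dd i u : is_derive p u (fun q : 'rV[R]_4 => q ord0 i / Num.sqrt e) (u ord0 i / Num.sqrt e).
  have d := is_deriveMf (is_derive_coord i p u) (is_derive_cstf (Num.sqrt e)^-1 p u).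
  by apply: (is_derive_eq d); rewrite mulr0 ?addr0 ?add0r // mulrC.
have nl q : dom e q -> nonlat (q ord0 c0 / Num.sqrt e) (q ord0 c1 / Num.sqrt e).
  by rewrite dom_nonlat// => -[].
have hz q : dom e q -> q ord0 c2 ^+ 2 + q ord0 c3 ^+ 2 < 1 by case.
have := @torus_map_symplectic R _ (dom e) (fun=> e) _ _ _ _ oD (sm_cst _ e) (sd c0) (sd c1)
  (fun _ _ => ge) nl hz e p v w _ _ _ _ _ _ _ _ erefl Dp (dd c0 v) (dd c0 w) (dd c1 v)
  (dd c1 w) (is_derive_coord c2 p v) (is_derive_coord c2 p w) (is_derive_coord c3 p v)
  (is_derive_coord c3 p w).
move=> ->; rewrite /omega4.
by move: s0 (sqr_sqrtr (ltW e0)); move: (Num.sqrt e) => s sn <-; field.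
Qed.

Lemma torus_emb_inj p q : dom e p -> dom e q -> J p = J q ->
  exists m n, q = p + latt e m n.
Proof.
rewrite !dom_nonlat// => -[p1 p2] [q1 q2] /(torus_map_inj ge p1 q1 p2 q2)[m [n [E0 E1 E2 E3]]].
have K (a b c : R) : a / Num.sqrt e = b / Num.sqrt e + c -> a = b + Num.sqrt e * c.
  by move=> /(congr1 ( *%R (Num.sqrt e))); rewrite mulrDr !(mulrC (Num.sqrt e) (_ / _)) !divfK.
have [l0 l1 l2 l3] := lattE e m n.
exists m, n; apply/rowP; apply: ord4P; rewrite mxE; rewrite ?l0 ?l1 ?l2 ?l3 ?addr0.
- exact: K.
- exact: K.
- exact: E2.
- exact: E3.
Qed.

Lemma latt_small (m n : int) : `|latt e m n| < Num.sqrt e -> latt e m n = 0.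
Proof.
have sp : 0 < Num.sqrt e by rewrite sqrtr_gt0.
have H i (k : int) : latt e m n ord0 i = Num.sqrt e * k%:~R ->
    `|latt e m n| < Num.sqrt e -> k = 0.
  move=> E h; have h1 : `|latt e m n ord0 i| < Num.sqrt e.
    apply: le_lt_trans h.
    by rewrite [leRHS]/Num.Def.normr/= mx_normrE; apply: (le_bigmax _ _ (ord0, i)).
  move: h1; rewrite E normrM gtr0_norm// -[ltRHS]mulr1 ltr_pM2l// -intr_norm.
  by rewrite (_ : 1 = 1%:~R)// ltr_int; lia.
have [l0 l1 l2 l3] := lattE e m n => h.
have m0 := H _ _ l0 h; have n0 := H _ _ l1 h.
by apply/rowP; apply: ord4P; rewrite [RHS]mxE ?l0 ?l1 ?l2 ?l3 ?m0 ?n0 ?mulr0.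
Qed.

Lemma torus_emb_homeo p (d : R) : dom e p -> 0 < d -> exists2 a : R, 0 < a &
  forall q, dom e q -> `|J q - J p| < a -> exists m n, `|q + latt e m n - p| < d.
Proof.
move=> Dp d0; have sp : 0 < Num.sqrt e by rewrite sqrtr_gt0.
have /nbhs_ballP[r1 /= r10 hr1] : nbhs p (dom e).
  by apply: open_nbhs_nbhs; split => //; exact: open_dom.
(* Three demands: the closed ball lies in the domain, it is no larger than [d], and its boundary
   contains no lattice translate of [p], so that [J] differs from [J p] there. *)
pose r := Num.min (r1 / 2) (Num.min d (Num.sqrt e / 2)).
have r0 : 0 < r by rewrite !lt_min !divr_gt0// d0.
have [ra rb rc] : [/\ r <= r1 / 2, r <= d & r <= Num.sqrt e / 2].
  by rewrite /r !ge_min !lexx !orbT.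
have KU x : `|x - p| <= r -> dom e x.
  by move=> h; apply: hr1; rewrite -ball_normE /ball_/= distrC; lra.
have hS x : `|x - p| = r -> J x <> J p.
  have Dx := KU x; move=> xr /esym Jx; rewrite xr lexx in Dx.
  have [m [n E]] := torus_emb_inj Dp (Dx isT) Jx.
  move: xr; rewrite E [p + _]addrC addrK => lr.
  have l0 : latt e m n = 0 by apply: latt_small; rewrite lr; move: rc r0; lra.
  by move: lr r0; rewrite l0 normr0 => <-; rewrite ltxx.
have [a a0 ha] := locally_onto sm_torus_emb torus_emb_symplectic r0 KU hS.
exists a => // q Dq /ha[x xr Jx].
have [m [n E]] := torus_emb_inj Dq (KU _ (ltW xr)) (esym Jx).
by exists m, n; rewrite -E; exact: lt_le_trans xr rb.
Qed.

Lemma torus_emb_bound p : dom e p ->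
  sqnorm4 (J p) < (Num.sqrt 3 + 20 * (Clay R + 2) * e) ^+ 2.
Proof.
rewrite dom_nonlat// => -[p1 p2]; apply: le_lt_trans (torus_map_bound ge p1 p2) _.
have s3 : Num.sqrt 3 ^+ 2 = 3 :> R by rewrite sqr_sqrtr.
have s1 : 0 <= Num.sqrt 3 :> R by exact: sqrtr_ge0.
have c0 : 0 < 20 * (Clay R + 2) * e.
  by rewrite !mulr_gt0//; have := Clay_gt2 R; lra.
(* As [2 sqrt 3 > 1], the square of [sqrt 3 + t] exceeds [3 + t], so the constant found for the
   squared norm also serves for the radius. *)
by move: (Num.sqrt 3) (_ * _) s3 s1 c0 => s t s3 s1 t0; nra.
Qed.

End Fixed.

Lemma torus_emb_family : smooth_family (emax / 2) torus_emb.
Proof.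
have m0 := emax_gt0.
(* [eps0] is half of [emax], so the formula extends to the open interval [(0, emax)]. The dilation
   cancels the division by [sqrt e], leaving [torus_map] on the unit torus. *)
exists [set t : R | 0 < t < emax], (fun x : R * 'rV[R]_4 => torus_map x.1 (x.2 ord0 c0) (x.2 ord0 c1) (x.2 ord0 c2) (x.2 ord0 c3)).
have oI : open [set t : R | 0 < t < emax].
  have -> : [set t : R | 0 < t < emax] = [set t | 0 < t] `&` [set t | t < emax].
    by apply/seteqP; split => t /=; [move=> /andP[] | move=> [-> ->]].
  by apply: openI; [exact: open_gt | exact: open_lt].
split => //; split; first by move=> t /=; rewrite in_itv /= => /andP[t0 t1]; apply/andP; split; lra.
split; last first.
  move=> t q /andP[t0 _] _; rewrite /torus_emb /=.
  by rewrite !(mxE _ _ ord0) /= !(sqrt_mulK _ t0).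
have d1 (q : 'rV[R]_4) : dom 1 q -> nonlat (q ord0 c0) (q ord0 c1) /\
    q ord0 c2 ^+ 2 + q ord0 c3 ^+ 2 < 1.
  by rewrite dom_nonlat// sqrtr1 !divr1.
have oU : open [set x : R * 'rV[R]_4 | [set t : R | 0 < t < emax] x.1 /\ dom 1 x.2].
  have o1 : open ((fun x : R * 'rV[R]_4 => x.1) @^-1` [set t : R | 0 < t < emax]).
    by apply: open_comp oI => x _; exact: cvg_fst.
  have o2 : open ((fun x : R * 'rV[R]_4 => x.2) @^-1` dom 1).
    by apply: open_comp (open_dom ltr01) => x _; exact: cvg_snd.
  exact: openI o1 o2.
apply: sm_smooth_on => //; apply: sm_torus_map => //.
- exact: sm_fst.
- exact: sm_snd_coord.
- exact: sm_snd_coord.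
- exact: sm_snd_coord.
- exact: sm_snd_coord.
- by move=> x [/= h _]; exact: good_emax.
- by move=> x [_ /d1[]].
- by move=> x [_ /d1[]].
Qed.

End Family.

Theorem theorem5p1 (R : realType) :
  exists (eps0 c : R) (J : R -> 'rV[R]_4 -> 'rV[R]_4),
    0 < eps0 /\ 0 < c /\
    smooth_family eps0 J /\
    (forall eps : R, 0 < eps <= eps0 ->
       sympl_emb_into_ball eps (J eps) (Num.sqrt 3 + c * eps)).
Proof.
have m0 := emax_gt0 R.
exists (emax R / 2), (20 * (Clay R + 2)), (@torus_emb R); split; first by rewrite divr_gt0.
split; first by rewrite mulr_gt0//; have := Clay_gt2 R; lra.
split; first exact: torus_emb_family.
move=> e /andP[e0 e1]; have ge : good e by apply: good_emax; rewrite e0 /=; lra.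
split; first by move=> p m n _; exact: torus_emb_periodic.
split; first by apply: sm_smooth_on; [exact: open_dom | exact: sm_torus_emb].
split; first by move=> p Dp; exact: torus_emb_symplectic.
split; first by move=> p q; exact: torus_emb_inj.
split; first by move=> p Dp d d0; exact: torus_emb_homeo.
by move=> p; exact: torus_emb_bound.
Qed.
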